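(* Let $(V,q)$ be a finite-dimensional quadratic space over a field $\mathbb{F}$ of characteristic different from 2, and let $c\in\mathbb{F}$. Then the complement $\widetilde{\mathbf{H}}_{V,q}^{c,o}$ of $\mathbb{F}\oplus V$ inside $\mathbb{F}\oplus V_{\mathbb{F}}^{c}$ can be completed to a space $\widetilde{\mathbf{H}}_{V,q}^{c}$ such that the paravector Vahlen group $\widetilde{\operatorname{V}}(V,q)$ acts transitively on this completion by Möbius transformations. If $V_{U,\mathbb{F}}$ is the direct sum of $V$ with a hyperbolic plane and a line generated by a vector of quadratic value $-1$, then $\widetilde{\mathbf{H}}_{V,q}^{c}$ can be identified with $\widetilde{\mathbf{K}}_{V,q}^{c}$, the set of vectors in $V_{U,\mathbb{F}}\setminus V^{\perp}$ with quadratic value $c$. This identification is $\widetilde{\operatorname{V}}(V,q)$-equivariant, and so is the identification (via $g\mapsto g\cdot\sigma_{c}$) with the left coset space inside $\widetilde{\operatorname{V}}(V,q)$ of the subgroup $$\Big\{\begin{pmatrix}\delta' & -c\gamma'\\ \gamma & \delta\end{pmatrix}\;\Big|\;\gamma,\delta\in\widetilde{\mathcal{T}}(V,q),\ \gamma\delta^{*}\in\mathbb{F}\oplus V,\ N(\delta)+cN(\gamma)\neq0\Big\}.$$ The action of the special paravector Vahlen group $\widetilde{\operatorname{SV}}(V,q)$ on $\widetilde{\mathbf{H}}_{V,q}^{c}$ is transitive in case $\widetilde{\mathbf{H}}_{V,q}^{c,o}$ is strictly contained in $\widetilde{\mathbf{H}}_{V,q}^{c}$; when they are equal, the space decomposes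 into $\widetilde{\operatorname{SV}}(V,q)$-orbits corresponding bijectively to the cosets, inside $\mathbb{F}^{\times}$, of the norm group. The stabilizer (of $\sigma_{c}$) in $\widetilde{\operatorname{SV}}(V,q)$ is the determinant 1 subgroup of the subgroup displayed above (i.e., with $N(\delta)+cN(\gamma)=1$).
   Context: $q:V\to\mathbb{F}$ is a quadratic form, possibly degenerate; $(u,v)=q(u+v)-q(u)-q(v)$; $V^{\perp}=\{v\in V: (u,v)=0\ \forall u\in V\}$. $\mathcal{C}=\mathcal{C}(V,q)=\mathcal{C}_{+}\oplus\mathcal{C}_{-}$ is the Clifford algebra with $v^{2}=q(v)$ for $v\in V$, with even and odd parts $\mathcal{C}_{\pm}$. $\alpha\mapsto\alpha'$ is the grading automorphism ($v'=-v$), $\alpha\mapsto\alpha^{*}$ is the anti-automorphism (transposition) fixing $V$ pointwise, $\overline{\alpha}=(\alpha')^{*}$, and $N(\alpha)=\alpha\overline{\alpha}$. The same notation is used in every Clifford algebra. For a quadratic space $(W,Q)$: $\Gamma(W,Q)=\{\alpha\in\mathcal{C}(W,Q)^{\times}:\alpha W\alpha'^{-1}=W\}$, and $\Gamma_{+}^{\mathbb{F}^{\times}}(W,Q)$ is the group of even elements $\alpha\in\Gamma(W,Q)$ with $N(\alpha)\in\mathbb{F}^{\times}$. Paravectors: $\mathbb{F}\oplus V\subseteq\mathcal{C}$ with quadratic form $q_{\mathbb{F}}(a+v)=q(v)-a^{2}$. $\widetilde{\mathcal{T}}(V,q)=\{\alpha\in\mathcal{C}:\alpha(\mathbb{F}\oplus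 V)\alpha^{*}\subseteq\mathbb{F}\oplus V,\ N(\alpha)\in\mathbb{F}\}$. Paravector Vahlen group: $V_{U,\mathbb{F}}=V\oplus\mathbb{F}\rho\oplus\mathbb{F}e\oplus\mathbb{F}f$ with $q_{U,\mathbb{F}}(v+a\rho+xe+yf)=q(v)-a^{2}+xy$. For $\alpha=\alpha_{+}+\alpha_{-}\in\mathcal{C}$ put $\alpha_{\rho}=\alpha_{+}+\alpha_{-}\rho$. The map $\begin{pmatrix}\alpha&\beta\\ \gamma&\delta\end{pmatrix}\mapsto\alpha_{\rho}ef+\beta_{\rho}e\rho+\gamma'_{\rho}f\rho+\delta'_{\rho}fe$ is an algebra isomorphism from $\operatorname{M}_{2}(\mathcal{C})$ onto the even Clifford algebra $\mathcal{C}(V_{U,\mathbb{F}},q_{U,\mathbb{F}})_{+}$. $\widetilde{\operatorname{V}}(V,q)\subseteq\operatorname{GL}_{2}(\mathcal{C})$ is the group of matrices whose image lies in $\Gamma_{+}^{\mathbb{F}^{\times}}(V_{U,\mathbb{F}},q_{U,\mathbb{F}})$. For such a matrix, $\det:=\alpha\delta^{*}-\beta\gamma^{*}\in\mathbb{F}^{\times}$ equals the norm of its image; $\det$ is a homomorphism with kernel $\widetilde{\operatorname{SV}}(V,q)$. A matrix with image $\eta$ acts on $V_{U,\mathbb{F}}$ by $\omega\mapsto\eta\omega\eta'^{-1}$, an isometry fixing $V^{\perp}$ pointwise. Spaces: $\widetilde{\mathbf{K}}_{V,q}^{c}=\{\omega\in V_{U,\mathbb{F}}\setminus V^{\perp}:q_{U,\mathbb{F}}(\omega)=c\}$.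 $V_{\mathbb{F}}^{c}=V\oplus\mathbb{F}\sigma_{c}$ with $q_{\mathbb{F}}^{c}(v+t\sigma_{c})=q(v)-ct^{2}$; elements of $\mathbb{F}\oplus V_{\mathbb{F}}^{c}$ are $\tau=\xi+t\sigma_{c}$ with $\xi\in\mathbb{F}\oplus V$, $t\in\mathbb{F}$, and $\widetilde{\mathbf{H}}_{V,q}^{c,o}=\{\xi+t\sigma_{c}:t\neq0\}$. The set $\partial(\mathbb{F}\oplus V_{\mathbb{F}}^{c})$ of boundary points consists of the formal symbols $(\infty\lambda)_{b}+\infty\sigma_{c}$ with $\lambda\in\mathbb{F}\oplus V$, $q_{\mathbb{F}}(\lambda)=c$, $b\in\mathbb{F}$, where if $c=0$ and $\lambda\in V^{\perp}$ one requires $b\neq0$. The completion is $\widetilde{\mathbf{H}}_{V,q}^{c}=\widetilde{\mathbf{H}}_{V,q}^{c,o}\cup\partial(\mathbb{F}\oplus V_{\mathbb{F}}^{c})$. With $\iota(a+v)=v-a\rho$, the bijection $\widetilde{\mathbf{H}}_{V,q}^{c}\leftrightarrow\widetilde{\mathbf{K}}_{V,q}^{c}$ giving the identification takes $\xi+t\sigma_{c}$ ($t\neq0$) to $\frac{\iota(\xi)+f+(ct^{2}-q_{\mathbb{F}}(\xi))e}{t}$ and $(\infty\lambda)_{b}+\infty\sigma_{c}$ to $\iota(\lambda)+be$. Möbius transformations of $\begin{pmatrix}\alpha&\beta\\ \gamma&\delta\end{pmatrix}\in\widetilde{\operatorname{V}}(V,q)$ on $\widetilde{\mathbf{H}}_{V,q}^{c}$,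 written $(\alpha\tau+\beta)(\gamma\tau+\delta)^{-1}$ (products in $\mathcal{C}(V_{\mathbb{F}}^{c},q_{\mathbb{F}}^{c})\supseteq\mathcal{C}$): (i) $\tau=\xi+t\sigma_{c}$, $t\neq0$, with the scalar $N(\gamma\tau+\delta)\neq0$: the literal product. (ii) $\tau=\xi+t\sigma_{c}$, $t\neq0$, with $N(\gamma\tau+\delta)=0$: the point $(\infty\lambda)_{b}+\infty\sigma_{c}$, where $\lambda$ is the $\mathbb{F}\oplus V$-part of $(\alpha\tau+\beta)\overline{(\gamma\tau+\delta)}\in\mathbb{F}\oplus V_{\mathbb{F}}^{c}$ divided by $t\det$, and $b=N(\alpha\tau+\beta)/(t\det)$. (iii) $\tau=(\infty\lambda)_{b}+\infty\sigma_{c}$: put $N(\gamma\tau+\delta)_{*}=bN(\gamma)+(\gamma\lambda\overline{\delta}+\delta\overline{\lambda}\overline{\gamma})$, $N(\alpha\tau+\beta)_{*}=bN(\alpha)+(\alpha\lambda\overline{\beta}+\beta\overline{\lambda}\overline{\alpha})$, both in $\mathbb{F}$, and $(\alpha\tau+\beta)\overline{(\gamma\tau+\delta)}_{*}=b\alpha\overline{\gamma}+(\alpha\lambda\overline{\delta}+\beta\overline{\lambda}\overline{\gamma})+(\alpha\delta^{*}-\beta\gamma^{*})\sigma_{c}\in\widetilde{\mathbf{H}}_{V,q}^{c,o}$. If $N(\gamma\tau+\delta)_{*}\neq0$ the image is $(\alpha\tau+\beta)\overline{(\gamma\tau+\delta)}_{*}/N(\gamma\tau+\delta)_{*}$; otherwise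 it is $(\infty\mu)_{a}+\infty\sigma_{c}$ with $\mu$ the $\mathbb{F}\oplus V$-part of $(\alpha\tau+\beta)\overline{(\gamma\tau+\delta)}_{*}$ divided by $\det$ and $a=N(\alpha\tau+\beta)_{*}/\det$. Norm group (when $\widetilde{\mathbf{H}}_{V,q}^{c}=\widetilde{\mathbf{H}}_{V,q}^{c,o}$): the subgroup of $\mathbb{F}^{\times}$ consisting of all $N(\gamma\tau+\delta)$ with $\begin{pmatrix}\alpha&\beta\\ \gamma&\delta\end{pmatrix}\in\widetilde{\operatorname{SV}}(V,q)$ (equivalently, $\in\widetilde{\operatorname{V}}(V,q)$) and $\tau\in\widetilde{\mathbf{H}}_{V,q}^{c}$.
   Formalization: For c=0 the claim that SV acts transitively whenever the open part is strictly contained in the completion is false as stated (e.g. V=0, F=Q); for c=0 it is asserted only if some λ in F⊕V not in V^⊥ has q_F(λ)=0. *)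

(* Defs.v *)
From HB Require Import structures.
From mathcomp Require Import all_boot all_order all_algebra generic_quotient.
From mathcomp Require Import boolp classical_sets functions.
From mathcomp Require Import ring.

Set Implicit Arguments.
Unset Strict Implicit.
Unset Printing Implicit Defensive.

Import GRing.Theory.
Local Open Scope ring_scope.
Local Open Scope classical_set_scope.
Local Open Scope quotient_scope.

Definition polar (F : fieldType) (V : vectType F) (q : V -> F) (u v : V) : F :=
  q (u + v) - q u - q v.

Record quadForm (F : fieldType) (V : vectType F) := QuadForm {
  quad_val :> V -> F;
  quadZ : forall a v, quad_val (a *: v) = a ^+ 2 * quad_val v;
  polarDl : forall u v w,
    polar quad_val (u + v) w = polar quad_val u w + polar quad_val v w;
  polarZl : forall a u v, polar quad_val (a *: u) v = a * polar quad_val u v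
}.

Lemma polarC (F : fieldType) (V : vectType F) (q : V -> F) u v :
  polar q u v = polar q v u.
Proof. by rewrite /polar [u + v]addrC addrAC. Qed.

Definition radical (F : fieldType) (V : vectType F) (q : quadForm V) : set V :=
  [set v | forall u, polar q u v = 0].

(* The Clifford algebra is the quotient of the free associative algebra on [V],
   presented by formal expressions, by the relations making [CVec] linear and
   [v ^+ 2 = q v].  Its universal property is [cl_lift], [cl_lift_vec] and
   [cl_lift_unique]. *)

Section CliffordPresentation.
Context {F : fieldType} {V : vectType F}.

Inductive cexpr : Type :=
| CVec of V
| CScal of F
| CAdd of cexpr & cexpr
| CMul of cexpr & cexpr.

Variable q : quadForm V.

Inductive ceq : cexpr -> cexpr -> Prop :=
| ceq_refl x : ceq x x
| ceq_sym x y : ceq x y -> ceq y x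
| ceq_trans y x z : ceq x y -> ceq y z -> ceq x z
| ceq_add x x' y y' : ceq x x' -> ceq y y' -> ceq (CAdd x y) (CAdd x' y')
| ceq_mul x x' y y' : ceq x x' -> ceq y y' -> ceq (CMul x y) (CMul x' y')
| ceq_addA x y z : ceq (CAdd x (CAdd y z)) (CAdd (CAdd x y) z)
| ceq_addC x y : ceq (CAdd x y) (CAdd y x)
| ceq_add0 x : ceq (CAdd (CScal 0) x) x
| ceq_addN x : ceq (CAdd (CMul (CScal (-1)) x) x) (CScal 0)
| ceq_mulA x y z : ceq (CMul x (CMul y z)) (CMul (CMul x y) z)
| ceq_mul1 x : ceq (CMul (CScal 1) x) x
| ceq_mulDl x y z : ceq (CMul (CAdd x y) z) (CAdd (CMul x z) (CMul y z))
| ceq_mulDr x y z : ceq (CMul x (CAdd y z)) (CAdd (CMul x y) (CMul x z))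
| ceq_scalD a b : ceq (CScal (a + b)) (CAdd (CScal a) (CScal b))
| ceq_scalM a b : ceq (CScal (a * b)) (CMul (CScal a) (CScal b))
| ceq_scalC a x : ceq (CMul (CScal a) x) (CMul x (CScal a))
| ceq_vecD u v : ceq (CVec (u + v)) (CAdd (CVec u) (CVec v))
| ceq_vecZ a v : ceq (CVec (a *: v)) (CMul (CScal a) (CVec v))
| ceq_sqr v : ceq (CMul (CVec v) (CVec v)) (CScal (q v)).

HB.instance Definition _ := gen_eqMixin cexpr.
HB.instance Definition _ := gen_choiceMixin cexpr.

Definition ceqb (x y : cexpr) : bool := `[< ceq x y >].

Lemma ceqb_equiv : equiv_class_of ceqb.
Proof.
split.
- by move=> x; apply/asboolP; constructor.
- by move=> x y; apply/asboolP/asboolP; apply: ceq_sym.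
- by move=> y x z /asboolP xy /asboolP yz; apply/asboolP/(ceq_trans xy).
Qed.

Canonical ceqb_equiv_rel := EquivRelPack ceqb_equiv.
Canonical ceqb_encModRel := defaultEncModRel ceqb.

Definition clifford : Type := {eq_quot ceqb}.
HB.instance Definition _ := Choice.on clifford.
HB.instance Definition _ := EqQuotient.on clifford.

Lemma cl_piP (x y : cexpr) : ceq x y <-> \pi_clifford x = \pi_clifford y.
Proof.
by rewrite (rwP eqP) piE (rwP (@asboolP (ceq x y))).
Qed.

Lemma cl_repr (x : cexpr) : ceq (repr (\pi_clifford x)) x.
Proof. by apply/cl_piP; rewrite reprK. Qed.

Definition cl_add (x y : clifford) : clifford := \pi_clifford (CAdd (repr x) (repr y)).
Definition cl_mul (x y : clifford) : clifford := \pi_clifford (CMul (repr x) (repr y)).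
Definition cl_scal (a : F) : clifford := \pi_clifford (CScal a).
Definition cl_vec (v : V) : clifford := \pi_clifford (CVec v).

Lemma cl_piD x y : \pi_clifford (CAdd x y) = cl_add (\pi x) (\pi y).
Proof. by apply/cl_piP/ceq_add; apply/ceq_sym/cl_repr. Qed.

Lemma cl_piM x y : \pi_clifford (CMul x y) = cl_mul (\pi x) (\pi y).
Proof. by apply/cl_piP/ceq_mul; apply/ceq_sym/cl_repr. Qed.

Lemma cl_ind (P : clifford -> Prop) :
  (forall x, P (\pi_clifford x)) -> forall x, P x.
Proof. by move=> Ppi x; rewrite -(reprK x). Qed.

Lemma cl_addA : associative cl_add.
Proof.
elim/cl_ind=> x; elim/cl_ind=> y; elim/cl_ind=> z.
rewrite -(cl_piD y z) -(cl_piD x y) -(cl_piD x (CAdd y z)) -(cl_piD _ z).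
exact/cl_piP/ceq_addA.
Qed.

Lemma cl_addC : commutative cl_add.
Proof.
by elim/cl_ind=> x; elim/cl_ind=> y; rewrite -!cl_piD; apply/cl_piP/ceq_addC.
Qed.

Lemma cl_add0 : left_id (cl_scal 0) cl_add.
Proof. by elim/cl_ind=> x; rewrite -!cl_piD; apply/cl_piP/ceq_add0. Qed.

Lemma cl_addN : left_inverse (cl_scal 0) (cl_mul (cl_scal (-1))) cl_add.
Proof. by elim/cl_ind=> x; rewrite -cl_piM -cl_piD; apply/cl_piP/ceq_addN. Qed.

Lemma cl_mulA : associative cl_mul.
Proof.
elim/cl_ind=> x; elim/cl_ind=> y; elim/cl_ind=> z.
rewrite -(cl_piM y z) -(cl_piM x y) -(cl_piM x (CMul y z)) -(cl_piM _ z).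
exact/cl_piP/ceq_mulA.
Qed.

Lemma cl_scalC a x : cl_mul (cl_scal a) x = cl_mul x (cl_scal a).
Proof. by elim/cl_ind: x => x; rewrite -!cl_piM; apply/cl_piP/ceq_scalC. Qed.

Lemma cl_mul1 : left_id (cl_scal 1) cl_mul.
Proof. by elim/cl_ind=> x; rewrite -!cl_piM; apply/cl_piP/ceq_mul1. Qed.

Lemma cl_mulr1 : right_id (cl_scal 1) cl_mul.
Proof. by move=> x; rewrite -cl_scalC cl_mul1. Qed.

Lemma cl_mulDl : left_distributive cl_mul cl_add.
Proof.
elim/cl_ind=> x; elim/cl_ind=> y; elim/cl_ind=> z.
rewrite -(cl_piD x y) -(cl_piM x z) -(cl_piM y z) -(cl_piM _ z)
  -(cl_piD (CMul x z)).
exact/cl_piP/ceq_mulDl.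
Qed.

Lemma cl_mulDr : right_distributive cl_mul cl_add.
Proof.
elim/cl_ind=> x; elim/cl_ind=> y; elim/cl_ind=> z.
rewrite -(cl_piD y z) -(cl_piM x y) -(cl_piM x z) -(cl_piM x _)
  -(cl_piD (CMul x y)).
exact/cl_piP/ceq_mulDr.
Qed.

Section Eval.
Variables (A : algType F) (f : V -> A).

Fixpoint ceval (x : cexpr) : A :=
  match x with
  | CVec v => f v
  | CScal a => a%:A
  | CAdd x y => ceval x + ceval y
  | CMul x y => ceval x * ceval y
  end.

Hypothesis flin : linear f.
Hypothesis fq : forall v, f v * f v = (q v)%:A.

Lemma ceval_ceq x y : ceq x y -> ceval x = ceval y.
Proof.
elim=> {x y} /=.
- by [].
- by move=> x y _ ->.
- by move=> y x z _ -> _ ->.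
- by move=> x x' y y' _ -> _ ->.
- by move=> x x' y y' _ -> _ ->.
- by move=> x y z; rewrite addrA.
- by move=> x y; rewrite addrC.
- by move=> x; rewrite scale0r add0r.
- by move=> x; rewrite mulr_algl scaleN1r addNr scale0r.
- by move=> x y z; rewrite mulrA.
- by move=> x; rewrite scale1r mul1r.
- by move=> x y z; rewrite mulrDl.
- by move=> x y z; rewrite mulrDr.
- by move=> a b; rewrite scalerDl.
- by move=> a b; rewrite mulr_algl scalerA.
- by move=> a x; rewrite mulr_algl mulr_algr.
- by move=> u v; rewrite -[u]scale1r flin !scale1r.
- move=> a v; rewrite mulr_algl -[a *: v]addr0 flin.
  have := flin (-1) 0 0; rewrite scaler0 addr0 scaleN1r addNr => ->.
  by rewrite addr0.
- by move=> v; rewrite fq.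
Qed.
End Eval.

(* A module on which [V] acts with square [q], needed for [1 != 0]: first for
   the split form [(x, y) |-> \sum_i x_i y_i] on [F^n + F^n], then for [q]
   through an isometry into such a split space. *)
Lemma split_module n : exists m (G : 'rV[F]_n -> 'rV[F]_n -> 'M[F]_m.+1),
  (forall a x y x' y', G (a *: x + x') (a *: y + y') = a *: G x y + G x' y')
  /\ (forall x y, G x y * G x y = (\sum_i x 0 i * y 0 i)%:A).
Proof.
elim: n => [|n [m [G [Glin Gsq]]]].
  exists 0%N, (fun _ _ => 0); split=> [a *|x y].
    by rewrite scaler0 addr0.
  by rewrite big_ord0 scale0r mul0r.
pose G' (x y : 'rV[F]_(1 + n)) : 'M[F]_(m.+1 + m.+1) :=
  block_mx (G (rsubmx x) (rsubmx y)) (y 0 0)%:M (x 0 0)%:M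
           (- G (rsubmx x) (rsubmx y)).
exists (m + m.+1)%N, (G' : 'rV_n.+1 -> 'rV_n.+1 -> 'M_((m + m.+1).+1)).
split.
  move=> a x y x' y'; rewrite /G' !mxE.
  rewrite [rsubmx (_ + _)]linearP [X in G _ X]linearP Glin opprD -scalerN.
  rewrite ![(_ * _ + _)%:M]raddfD /= -!scale_scalar_mx.
  by rewrite -add_block_mx -scale_block_mx.
move=> x y; rewrite -[LHS]/(G' x y *m G' x y) /G' mulmx_block.
set g := G _ _; rewrite !(mulmxN, mulNmx) opprK.
rewrite !mul_scalar_mx !mul_mx_scalar !subrr !scale_scalar_mx.
have -> : g *m g = (\sum_(i < n) x 0 (rshift 1 i) * y 0 (rshift 1 i))%:M.
  rewrite -[LHS]/(g * g) Gsq scalemx1; congr (_%:M).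
  by apply: eq_bigr => i _; rewrite !mxE.
rewrite [y 0 0 * _]mulrC [(x 0 0 * _)%:M + _]addrC -!(raddfD (@scalar_mx F m.+1)) /=.
rewrite -scalar_mx_block mulr1; congr (_%:M).
rewrite addrC [RHS]big_ord_recl; congr (_ + _).
by apply: eq_bigr => i _; congr (x 0 _ * y 0 _); apply/val_inj.
Qed.

Lemma polar_suml n (u : nat -> V) w :
  polar q (\sum_(i < n) u i) w = \sum_(i < n) polar q (u i) w.
Proof.
elim: n => [|n IHn]; last by rewrite !big_ord_recr /= polarDl IHn.
by rewrite !big_ord0 -(scale0r 0) polarZl mul0r.
Qed.

Lemma quad_sum n (u : nat -> V) :
  q (\sum_(i < n) u i) = \sum_(i < n) (q (u i) + \sum_(j < i) polar q (u j) (u i)).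
Proof.
elim: n => [|n IHn]; first by rewrite !big_ord0 -(scale0r 0) quadZ expr0n mul0r.
rewrite !big_ord_recr /= -IHn -polar_suml /polar.
set s := \sum_(i < n) _; ring.
Qed.

Lemma clifford_module :
  exists m (f : V -> 'M[F]_m.+1), linear f /\ forall v, f v * f v = (q v)%:A.
Proof.
set n := \dim {:V}; pose b := vbasis {:V}.
have [m [G [Glin Gsq]]] := split_module n.
pose x (v : V) : 'rV[F]_n := \row_i coord b i v.
pose y (v : V) : 'rV[F]_n :=
  \row_i (coord b i v * q b`_i
          + \sum_(j < n | (j < i)%N) coord b j v * polar q b`_j b`_i).
exists m, (fun v => G (x v) (y v)); split=> [a u v|v].
  rewrite -Glin; congr G; apply/rowP => i; rewrite !mxE linearP //=.
  rewrite mulrDl -mulrA mulrDr mulr_sumr addrACA; congr (_ + _).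
  by rewrite -big_split; apply: eq_bigr => j _ /=; rewrite linearP mulrDl mulrA.
rewrite Gsq; congr (_%:A).
pose c (i : nat) : F := if insub i is Some i' then coord b i' v else 0.
have cE (i : 'I_n) : c i = coord b i v by rewrite /c valK.
have vE : v = \sum_(i < n) c i *: b`_i.
  rewrite {1}(coord_vbasis (memvf v)).
  by apply: eq_bigr => i _; rewrite cE.
rewrite {3}vE (quad_sum n (fun i => c i *: b`_i)).
apply: eq_bigr => i _; rewrite !mxE mulrDr quadZ cE.
rewrite mulrA -expr2; congr (_ + _).
rewrite mulr_sumr (big_ord_widen_cond n predT
  (fun j => polar q (c j *: b`_j) (coord b i v *: b`_i)) (ltnW (ltn_ord i))).
apply: eq_bigr => j _.
by rewrite -!cE polarZl [in RHS]polarC polarZl [in RHS]polarC mulrCA.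
Qed.

Lemma cl_oner_neq0 : cl_scal 1 != cl_scal 0.
Proof.
have [m [f [flin fq]]] := clifford_module.
apply/eqP => /cl_piP/(ceval_ceq flin fq) /= /eqP.
by rewrite scale1r scale0r oner_eq0.
Qed.

HB.instance Definition _ := GRing.isNzRing.Build clifford
  cl_addA cl_addC cl_add0 cl_addN cl_mulA cl_mul1 cl_mulr1 cl_mulDl cl_mulDr
  cl_oner_neq0.

Definition cl_scale (a : F) (x : clifford) : clifford := cl_mul (cl_scal a) x.

Lemma cl_scalD a b : cl_scal (a + b) = cl_scal a + cl_scal b.
Proof. by rewrite -[RHS]cl_piD; apply/cl_piP/ceq_scalD. Qed.

Lemma cl_scalM a b : cl_scal (a * b) = cl_scal a * cl_scal b.
Proof. by rewrite -[RHS]cl_piM; apply/cl_piP/ceq_scalM. Qed.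

Lemma cl_scaleA a b x : cl_scale a (cl_scale b x) = cl_scale (a * b) x.
Proof. by rewrite /cl_scale cl_mulA cl_scalM. Qed.

Lemma cl_scaleDl x : {morph cl_scale^~ x : a b / a + b}.
Proof. by move=> a b; rewrite /cl_scale cl_scalD [LHS]cl_mulDl. Qed.

HB.instance Definition _ := GRing.Zmodule_isLmodule.Build F clifford
  cl_scaleA cl_mul1 (fun a => cl_mulDr (cl_scal a)) cl_scaleDl.

Lemma cl_scaleAl (a : F) (x y : clifford) : a *: (x * y) = (a *: x) * y.
Proof. exact: cl_mulA. Qed.
HB.instance Definition _ := GRing.Lmodule_isLalgebra.Build F clifford cl_scaleAl.

Lemma cl_scaleAr (a : F) (x y : clifford) : a *: (x * y) = x * (a *: y).
Proof. by rewrite -[LHS]/(cl_mul _ _) cl_scalC -cl_mulA -cl_scalC. Qed.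
HB.instance Definition _ := GRing.Lalgebra_isAlgebra.Build F clifford cl_scaleAr.

Lemma cl_scalE a : cl_scal a = a%:A.
Proof. by rewrite -[RHS]/(cl_mul (cl_scal a) (cl_scal 1)) cl_mulr1. Qed.

Lemma cl_vec_linear : linear cl_vec.
Proof.
move=> a u v; rewrite -[RHS]/(cl_add (cl_mul (cl_scal a) _) _).
rewrite -(cl_piM (CScal a) (CVec u)) -cl_piD; apply/cl_piP.
apply: (ceq_trans (ceq_vecD _ _)).
by apply: ceq_add; [exact: ceq_vecZ | exact: ceq_refl].
Qed.
HB.instance Definition _ := GRing.isLinear.Build F V clifford _ cl_vec cl_vec_linear.

Lemma cl_vec_sqr v : cl_vec v * cl_vec v = (q v)%:A.
Proof. by rewrite -cl_scalE -[LHS]cl_piM; apply/cl_piP/ceq_sqr. Qed.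

Section Lift.
Variables (A : algType F) (f : {linear V -> A}).
Definition cl_lift (fq : forall v, f v * f v = (q v)%:A) (x : clifford) : A :=
  ceval f (repr x).
Hypothesis fq : forall v, f v * f v = (q v)%:A.

Lemma cl_lift_pi x : cl_lift fq (\pi x) = ceval f x.
Proof. by apply: (ceval_ceq _ fq (cl_repr x)) => a u v; rewrite linearP. Qed.

Lemma cl_lift_linear : linear (cl_lift fq).
Proof.
move=> a; elim/cl_ind=> x; elim/cl_ind=> y.
rewrite -[a *: _]/(cl_mul _ _) -(cl_piM (CScal a)) -[_ + _]/(cl_add _ _) -cl_piD.
by rewrite !cl_lift_pi /= mulr_algl.
Qed.
HB.instance Definition _ :=
  GRing.isLinear.Build F clifford A _ (cl_lift fq) cl_lift_linear.

Lemma cl_lift_monoid : monoid_morphism (cl_lift fq).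
Proof.
split; first by rewrite -[1]/(\pi_clifford (CScal 1)) cl_lift_pi /= scale1r.
elim/cl_ind=> x; elim/cl_ind=> y.
by rewrite -[_ * _]/(cl_mul _ _) -cl_piM !cl_lift_pi.
Qed.
HB.instance Definition _ :=
  GRing.isMonoidMorphism.Build clifford A (cl_lift fq) cl_lift_monoid.

Lemma cl_lift_vec v : cl_lift fq (cl_vec v) = f v.
Proof. exact: cl_lift_pi. Qed.

Lemma cl_lift_unique (g : {lrmorphism clifford -> A}) :
  (forall v, g (cl_vec v) = f v) -> g =1 cl_lift fq.
Proof.
move=> gE; elim/cl_ind=> x; rewrite cl_lift_pi.
elim: x => [v|a|x IHx y IHy|x IHx y IHy] /=.
- exact: gE.
- by rewrite -[\pi _]/(cl_scal a) cl_scalE linearZ rmorph1.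
- rewrite cl_piD -IHx -IHy; exact: raddfD.
- rewrite cl_piM -IHx -IHy; exact: rmorphM.
Qed.
End Lift.

(* The transposition is an anti-automorphism, hence not a [cl_lift]; it is defined
   on expressions.  See [cl_trM], [cl_tr_vec] and [cl_tr1]. *)
Fixpoint crev (x : cexpr) : cexpr :=
  match x with
  | CAdd x y => CAdd (crev x) (crev y)
  | CMul x y => CMul (crev y) (crev x)
  | _ => x
  end.

Lemma crev_ceq x y : ceq x y -> ceq (crev x) (crev y).
Proof.
by elim=> {x y} /=; eauto using ceq.
Qed.

Definition cl_tr (x : clifford) : clifford := \pi_clifford (crev (repr x)).

Lemma cl_tr_pi x : cl_tr (\pi x) = \pi_clifford (crev x).
Proof. exact/cl_piP/crev_ceq/cl_repr. Qed.

Lemma cl_tr_linear : linear cl_tr.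
Proof.
move=> a; elim/cl_ind=> x; elim/cl_ind=> y.
rewrite -[a *: _]/(cl_mul _ _) -(cl_piM (CScal a)) -[_ + _]/(cl_add _ _) -cl_piD.
rewrite !cl_tr_pi /= -[RHS]/(cl_add (cl_mul (\pi_clifford (CScal a)) _) _).
by rewrite cl_piD cl_piM -cl_scalC.
Qed.
HB.instance Definition _ := GRing.isLinear.Build F clifford clifford _ cl_tr cl_tr_linear.

Lemma cl_trM x y : cl_tr (x * y) = cl_tr y * cl_tr x.
Proof.
elim/cl_ind: x => x; elim/cl_ind: y => y.
by rewrite -[_ * _]/(cl_mul _ _) -cl_piM !cl_tr_pi /= cl_piM.
Qed.

Lemma cl_tr_vec v : cl_tr (cl_vec v) = cl_vec v.
Proof. exact: cl_tr_pi. Qed.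

Lemma cl_tr1 : cl_tr 1 = 1.
Proof. exact: cl_tr_pi. Qed.


End CliffordPresentation.
Arguments cexpr {F} V.
Arguments cl_vec {F V} q v.
Arguments cl_lift {F V q A} f fq x.

(* An action is given by its graph: [act g x y] reads [g . x = y]. *)

Section Groups.
Variable R : nzRingType.

Definition is_inverse (x y : R) : Prop := x * y = 1 /\ y * x = 1.

Definition unit_subgroup (G : set R) : Prop :=
  [/\ G 1,
      forall x y, G x -> G y -> G (x * y) &
      forall x, G x -> exists2 y, G y & is_inverse x y].

Definition lcoset (x : R) (A : set R) : set R := [set x * y | y in A].

Definition lcosets (G A : set R) : set (set R) := [set lcoset g A | g in G].

Variables (X : Type) (act : R -> X -> X -> Prop).

Definition is_action (G : set R) (Y : set X) : Prop :=
  [/\ forall g x, G g -> Y x -> exists2 y, Y y & forall z, act g x z <-> z = y,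
      forall x, Y x -> act 1 x x &
      forall g h x y z, G g -> G h -> Y x ->
        act h x y -> act g y z -> act (g * h) x z].

Definition transitive_on (G : set R) (Y : set X) : Prop :=
  forall x y, Y x -> Y y -> exists2 g, G g & act g x y.

Definition orbit_of (G : set R) (x : X) : set X :=
  [set y | exists2 g, G g & act g x y].

Definition orbits_of (G : set R) (Y : set X) : set (set X) :=
  [set orbit_of G x | x in Y].
End Groups.

Section CliffordTheory.
Context {F : fieldType} {V : vectType F} (q : quadForm V).
Local Notation C := (clifford q).

Lemma cl_gr_subproof v : (\- cl_vec q)%R v * (\- cl_vec q)%R v = (q v)%:A.
Proof. by rewrite /= mulrNN cl_vec_sqr. Qed.

Definition cl_gr : C -> C := cl_lift (\- cl_vec q)%R cl_gr_subproof.
HB.instance Definition _ := GRing.LRMorphism.on cl_gr.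

Definition cl_bar (x : C) : C := cl_tr (cl_gr x).
Definition cl_norm (x : C) : C := x * cl_bar x.

(* The projections onto the two summands of the grading, that is onto the
   eigenspaces of [cl_gr]; the characteristic is not 2. *)
Definition cl_even (x : C) : C := 2^-1 *: (x + cl_gr x).
Definition cl_odd (x : C) : C := 2^-1 *: (x - cl_gr x).

Definition scalars : set C := range (fun a : F => a%:A).
Definition vectors : set C := range (cl_vec q).

(* [y] is the inverse of [x], so that [cl_gr y] is the one of [cl_gr x]. *)
Definition Gamma : set C :=
  [set x | exists2 y, is_inverse x y &
           [set x * w * cl_gr y | w in vectors] = vectors].

Definition GammaPlusF : set C :=
  [set x | [/\ Gamma x, cl_gr x = x &
               exists2 n : F, n != 0 & cl_norm x = n%:A]].

(* Paravectors: the pair [(a, v)] stands for [a + v]. *)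
Definition para : Type := (F^o * V)%type.
HB.instance Definition _ := Vector.on para.

Definition para_cl (xi : para) : C := (xi.1 : F)%:A + cl_vec q xi.2.
Definition quadF (xi : para) : F := q xi.2 - xi.1 ^+ 2.
Definition para_radical (xi : para) : Prop := xi.1 = 0 /\ radical q xi.2.

Definition Ttilde : set C :=
  [set x | [set x * p * cl_tr x | p in range para_cl] `<=` range para_cl /\
           scalars (cl_norm x)].
End CliffordTheory.
Arguments para {F} V.

Section Functoriality.
Context {F : fieldType} {V W : vectType F} (q : quadForm V) (Q : quadForm W).
Variable g : {linear V -> W}.
Hypothesis gq : forall v, Q (g v) = q v.

Lemma cl_map_subproof v : (cl_vec Q \o g) v * (cl_vec Q \o g) v = (q v)%:A.
Proof. by rewrite /= cl_vec_sqr gq. Qed.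

Definition cl_map : clifford q -> clifford Q :=
  cl_lift (cl_vec Q \o g) cl_map_subproof.
HB.instance Definition _ := GRing.LRMorphism.on cl_map.
End Functoriality.

Section Vahlen.
Context {F : fieldType} {V : vectType F} (q : quadForm V).

(* The vector [v + a rho + x e + y f] of V_{U,F} is [(v, a, x, y)]. *)
Definition VU : Type := (V * F^o * F^o * F^o)%type.
HB.instance Definition _ := Vector.on VU.

Definition VUvec (v : V) (a x y : F) : VU := (v, a, x, y).

Definition quadU_val (w : VU) : F :=
  let: (v, a, x, y) := w in q v - a ^+ 2 + x * y.

Lemma quadU_Z a w : quadU_val (a *: w) = a ^+ 2 * quadU_val w.
Proof.
case: w => [[[v b] x] y].
rewrite -[LHS]/(q (a *: v) - (a * (b : F)) ^+ 2 + (a * (x : F)) * (a * (y : F))).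
by rewrite quadZ /quadU_val; ring.
Qed.

Lemma quadU_polarE v v' (a x y a' x' y' : F) :
  polar quadU_val (VUvec v a x y) (VUvec v' a' x' y') =
  polar q v v' - 2 * a * a' + x * y' + x' * y.
Proof.
rewrite /polar.
rewrite -[quadU_val (_ + _)]/(q (v + v') - (a + a') ^+ 2 + (x + x') * (y + y')).
by rewrite /quadU_val /=; ring.
Qed.

Lemma quadU_polarDl u v w :
  polar quadU_val (u + v) w = polar quadU_val u w + polar quadU_val v w.
Proof.
case: u v w => [[[u a] x] y] [[[u' a'] x'] y'] [[[u'' a''] x''] y''].
rewrite -[(_, _, _, _) + (_, _, _, _)]
  /(VUvec (u + u') (a + a') (x + x') (y + y')).
by rewrite !quadU_polarE polarDl; ring.
Qed.

Lemma quadU_polarZl a u v : polar quadU_val (a *: u) v = a * polar quadU_val u v.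
Proof.
case: u v => [[[u b] x] y] [[[u' b'] x'] y'].
rewrite -[_ *: (_, _, _, _)]
  /(VUvec (a *: u) (a * (b : F)) (a * (x : F)) (a * (y : F))).
by rewrite !quadU_polarE polarZl; ring.
Qed.

Definition quadU : quadForm VU := QuadForm quadU_Z quadU_polarDl quadU_polarZl.

Definition inclU (v : V) : VU := VUvec v 0 0 0.

Lemma inclU_linear : linear inclU.
Proof.
move=> a u v; rewrite /inclU /VUvec.
by congr (_, _, _, _); rewrite /= scaler0 addr0.
Qed.
HB.instance Definition _ := GRing.isLinear.Build F V VU _ inclU inclU_linear.

Lemma inclU_isom v : quadU (inclU v) = q v.
Proof. by rewrite /= expr0n mul0r subr0 addr0. Qed.

Local Notation C := (clifford q).
Local Notation CU := (clifford quadU).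
Local Notation rho := (cl_vec quadU (VUvec 0 1 0 0)).
Local Notation e := (cl_vec quadU (VUvec 0 0 1 0)).
Local Notation f := (cl_vec quadU (VUvec 0 0 0 1)).

Definition clU : C -> CU := cl_map inclU_isom.

Definition cl_rho (x : C) : CU := clU (cl_even x) + clU (cl_odd x) * rho.

Definition vahlen_image (M : 'M[C]_2) : CU :=
  cl_rho (M 0 0) * e * f + cl_rho (M 0 1) * e * rho
  + cl_rho (cl_gr (M 1 0)) * f * rho + cl_rho (cl_gr (M 1 1)) * f * e.

Definition vahlen : set 'M[C]_2 :=
  [set M | (exists M', is_inverse M M') /\ GammaPlusF (vahlen_image M)].

Definition vdet (M : 'M[C]_2) : C :=
  M 0 0 * cl_tr (M 1 1) - M 0 1 * cl_tr (M 1 0).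

Definition svahlen : set 'M[C]_2 := [set M | vahlen M /\ vdet M = 1].

Definition vahlen_act (M : 'M[C]_2) (w w' : VU) : Prop :=
  exists2 y, is_inverse (vahlen_image M) y &
             cl_vec quadU w' = vahlen_image M * cl_vec quadU w * cl_gr y.

Definition Ktilde (c : F) : set VU :=
  [set w | quadU w = c] `\` [set inclU v | v in radical q].

(* The vector [v + t sigma_c] of V_F^c is [(v, t)]. *)
Definition VF : Type := (V * F^o)%type.
HB.instance Definition _ := Vector.on VF.

Definition VFvec (v : V) (t : F) : VF := (v, t).

Section AtC.
Variable c : F.

Definition quadc_val (w : VF) : F := let: (v, t) := w in q v - c * t ^+ 2.

Lemma quadc_Z a w : quadc_val (a *: w) = a ^+ 2 * quadc_val w.
Proof.
case: w => v t; rewrite -[LHS]/(q (a *: v) - c * (a * (t : F)) ^+ 2).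
by rewrite quadZ /quadc_val; ring.
Qed.

Lemma quadc_polarE v v' (t t' : F) :
  polar quadc_val (VFvec v t) (VFvec v' t') = polar q v v' - 2 * c * t * t'.
Proof.
rewrite /polar -[quadc_val (_ + _)]/(q (v + v') - c * (t + t') ^+ 2).
by rewrite /quadc_val /=; ring.
Qed.

Lemma quadc_polarDl u v w :
  polar quadc_val (u + v) w = polar quadc_val u w + polar quadc_val v w.
Proof.
case: u v w => [u t] [u' t'] [u'' t''].
rewrite -[(_, _) + (_, _)]/(VFvec (u + u') (t + t')).
by rewrite !quadc_polarE polarDl; ring.
Qed.

Lemma quadc_polarZl a u v : polar quadc_val (a *: u) v = a * polar quadc_val u v.
Proof.
case: u v => [u t] [u' t']; rewrite -[_ *: (_, _)]/(VFvec (a *: u) (a * (t : F))).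
by rewrite !quadc_polarE polarZl; ring.
Qed.

Definition quadc : quadForm VF := QuadForm quadc_Z quadc_polarDl quadc_polarZl.

Definition inclc (v : V) : VF := VFvec v 0.

Lemma inclc_linear : linear inclc.
Proof.
move=> a u v; rewrite /inclc /VFvec.
by congr (_, _); rewrite /= scaler0 addr0.
Qed.
HB.instance Definition _ := GRing.isLinear.Build F V VF _ inclc inclc_linear.

Lemma inclc_isom v : quadc (inclc v) = q v.
Proof. by rewrite /= expr0n mulr0 subr0. Qed.

Definition clc : C -> clifford quadc := cl_map inclc_isom.

(* [Inner xi t] is [xi + t sigma_c], and [Boundary la b] is the formal symbol
   [(oo la)_b + oo sigma_c]. *)
Inductive hpoint : Type :=
| Inner of para V & F
| Boundary of para V & F.

Definition Hopen : set hpoint :=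
  [set p | if p is Inner xi t then t != 0 else False].

Definition Hboundary : set hpoint :=
  [set p | if p is Boundary la b
           then quadF q la = c /\ (c = 0 -> para_radical q la -> b != 0)
           else False].

Definition Htilde : set hpoint := Hopen `|` Hboundary.

Definition sigma_pt : hpoint := Inner 0 1.

Definition Hinner_cl (xi : para V) (t : F) : clifford quadc :=
  clc (para_cl q xi) + t *: cl_vec quadc (VFvec 0 1).

(* [alpha tau + beta] and [gamma tau + delta] at [tau = xi + t sigma_c] *)
Definition mob_num (M : 'M[C]_2) xi t : clifford quadc :=
  clc (M 0 0) * Hinner_cl xi t + clc (M 0 1).
Definition mob_den (M : 'M[C]_2) xi t : clifford quadc :=
  clc (M 1 0) * Hinner_cl xi t + clc (M 1 1).

(* The starred expressions at [(oo la)_b + oo sigma_c]: [mob_bnorm x y la b] is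
   [N(x tau + y)_*], and [mob_bnum] is [(alpha tau + beta) (gamma tau + delta)bar_*]. *)
Definition mob_bnorm (x y : C) (la : para V) (b : F) : C :=
  let l := para_cl q la in
  b *: cl_norm x + (x * l * cl_bar y + y * cl_bar l * cl_bar x).

Definition mob_bnum (M : 'M[C]_2) (la : para V) (b : F) : clifford quadc :=
  let l := para_cl q la in
  clc (b *: (M 0 0 * cl_bar (M 1 0))
       + (M 0 0 * l * cl_bar (M 1 1) + M 0 1 * cl_bar l * cl_bar (M 1 0)))
  + clc (vdet M) * cl_vec quadc (VFvec 0 1).

Inductive mobius (M : 'M[C]_2) : hpoint -> hpoint -> Prop :=
| MobInnerInner xi t (n : F) y xi' t' of
    cl_norm (mob_den M xi t) = n%:A & n != 0 &
    is_inverse (mob_den M xi t) y &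
    Hinner_cl xi' t' = mob_num M xi t * y :
    mobius M (Inner xi t) (Inner xi' t')
| MobInnerBoundary xi t (d m : F) xi' s of
    cl_norm (mob_den M xi t) = 0 &
    vdet M = d%:A &
    Hinner_cl xi' s = mob_num M xi t * cl_bar (mob_den M xi t) &
    cl_norm (mob_num M xi t) = m%:A :
    mobius M (Inner xi t) (Boundary ((t * d)^-1 *: xi') (m / (t * d)))
| MobBoundaryInner la b (n : F) xi' s of
    mob_bnorm (M 1 0) (M 1 1) la b = n%:A & n != 0 &
    Hinner_cl xi' s = mob_bnum M la b :
    mobius M (Boundary la b) (Inner (n^-1 *: xi') (n^-1 * s))
| MobBoundaryBoundary la b (d m : F) xi' s of
    mob_bnorm (M 1 0) (M 1 1) la b = 0 &
    vdet M = d%:A &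
    Hinner_cl xi' s = mob_bnum M la b &
    mob_bnorm (M 0 0) (M 0 1) la b = m%:A :
    mobius M (Boundary la b) (Boundary (d^-1 *: xi') (m / d)).

Definition HtoK (p : hpoint) : VU :=
  match p with
  | Inner xi t => t^-1 *: VUvec xi.2 (- xi.1) (c * t ^+ 2 - quadF q xi) 1
  | Boundary la b => VUvec la.2 (- la.1) b 0
  end.

Definition stab_sigma : set 'M[C]_2 :=
  [set M | let: (ga, de) := (M 1 0, M 1 1) in
    [/\ M 0 0 = cl_gr de /\ M 0 1 = - (c *: cl_gr ga),
        Ttilde ga /\ Ttilde de,
        range (para_cl q) (ga * cl_tr de) &
        cl_norm de + c *: cl_norm ga != 0]].

Definition stab_sigma1 : set 'M[C]_2 :=
  [set M | let: (ga, de) := (M 1 0, M 1 1) in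
    [/\ M 0 0 = cl_gr de /\ M 0 1 = - (c *: cl_gr ga),
        Ttilde ga /\ Ttilde de,
        range (para_cl q) (ga * cl_tr de) &
        cl_norm de + c *: cl_norm ga = 1]].

Definition norm_group : set F :=
  [set n | exists M xi t,
    [/\ svahlen M, t != 0 & cl_norm (mob_den M xi t) = n%:A]].
End AtC.
End Vahlen.
Arguments VU {F} V.
Arguments VF {F} V.
Arguments sigma_pt {F V}.
Arguments hpoint {F} V.
Arguments Hopen {F} V.
Arguments vahlen {F V} q _.
Arguments svahlen {F V} q _.
Arguments vahlen_act {F V} q M w w'.
Arguments mobius {F V} q c M _ _.
Arguments stab_sigma {F V} q c _.
Arguments stab_sigma1 {F V} q c _.

(* Main.v *)
(** The even Clifford algebra of V_{U,F} is M_2(C): the matrix M acts on vectors, written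
    as 2x2 matrices A_w, by w |-> M A_w M^flat / det M.  The entries of M A_w M^flat are
    exactly the (starred) products and norms that define the Moebius transformation, so
    the bijection of the completed half-space with the vectors of norm c is equivariant,
    and the group laws for the Moebius action are inherited from the Clifford group.

    Translations, the inversion and diag(s, 1) move every vector of norm c to
    w_y = (c / y) e + y f and then to w_1, the image of sigma_c.  Only diag(s, 1) leaves
    the special group.  If a boundary vector lambda outside the radical exists, the special
    group moves lambda to every w_y; otherwise w_y and w_y' are in the same orbit exactly
    when y' / y is a norm N(gamma tau + delta).

    For a matrix fixing w_1 the equation M A M^flat = det(M) A, multiplied by the adjoint
    of M, gives alpha = delta' and beta = - c gamma'.  Conversely, a matrix of this shape
    has M M^dagger scalar, and it preserves vectors because one of gamma and delta is
    invertible; the finite dimension of C makes one-sided inverses two-sided. *)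

Require Import Defs.
From HB Require Import structures.
From mathcomp Require Import all_boot all_order all_algebra.
From mathcomp Require Import boolp classical_sets functions.
From mathcomp Require Import ring.

Set Implicit Arguments.
Unset Strict Implicit.
Unset Printing Implicit Defensive.

Import GRing.Theory.
Local Open Scope ring_scope.
Local Open Scope classical_set_scope.

(** * Identities in noncommutative rings *)

(** [clifford] is a quotient by relations, and no basis of it is at hand. What a basis would provide
    comes from explicit representations: [jet] shows that scalars and vectors stay independent,
    [rep] separates the matrices under [vahlen_image], and a finite spanning list makes one-sided
    inverses two-sided. Membership in the Clifford group is expressed without inverses, by a scalar
    [n] with M M^dagger = n and M A_w M^flat = n A_w' for every w. This scalar is the determinant,
    and it also links the two models: the f-coordinate of the image of xi + t sigma_c is N(gamma tau
    + delta) / (t n), so its vanishing decides between an inner and a boundary image. V^perp has to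
    be removed from the vectors of value c because the group fixes it pointwise; on boundary symbols
    this is the condition b != 0. *)

(* Both sides are expanded into lists of signed words, and opposite words are
   cancelled. *)
Inductive ncexpr :=
  NcVar of nat | NcOne | NcZero | NcAdd of ncexpr & ncexpr | NcOpp of ncexpr
| NcMul of ncexpr & ncexpr.

Fixpoint nc_words (e : ncexpr) : seq (bool * seq nat) :=
  match e with
  | NcVar n => [:: (true, [:: n])]
  | NcOne => [:: (true, [::])]
  | NcZero => [::]
  | NcAdd e1 e2 => nc_words e1 ++ nc_words e2
  | NcOpp e1 => [seq (~~ m.1, m.2) | m <- nc_words e1]
  | NcMul e1 e2 =>
      [seq (m1.1 == m2.1, m1.2 ++ m2.2) | m1 <- nc_words e1, m2 <- nc_words e2]
  end.

Fixpoint nc_cancel (n : nat) (l : seq (bool * seq nat)) :=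
  if n is n'.+1 then
    if l is m :: l' then
      if (~~ m.1, m.2) \in l' then nc_cancel n' (rem (~~ m.1, m.2) l')
      else m :: nc_cancel n' l'
    else [::]
  else l.

Definition nc_eqb (e1 e2 : ncexpr) : bool :=
  let l := nc_words (NcAdd e1 (NcOpp e2)) in nilp (nc_cancel (size l) l).

Section NcEval.
Variables (R : nzRingType) (env : seq R).

Fixpoint nc_eval (e : ncexpr) : R :=
  match e with
  | NcVar n => nth 0 env n
  | NcOne => 1
  | NcZero => 0
  | NcAdd e1 e2 => nc_eval e1 + nc_eval e2
  | NcOpp e1 => - nc_eval e1
  | NcMul e1 e2 => nc_eval e1 * nc_eval e2
  end.

Let weval (m : bool * seq nat) : R :=
  (-1) ^+ (~~ m.1) * \prod_(i <- m.2) nth 0 env i.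
Let leval (l : seq (bool * seq nat)) : R := \sum_(m <- l) weval m.

Let wevalN m : weval (~~ m.1, m.2) = - weval m.
Proof. by rewrite /weval; case: m.1; rewrite !(expr0, expr1, mul1r, mulNr, opprK). Qed.

Lemma nc_words_correct e : leval (nc_words e) = nc_eval e.
Proof.
rewrite /leval; elim: e => [n|||e1 IH1 e2 IH2|e IH|e1 IH1 e2 IH2] /=.
- by rewrite big_seq1 /weval big_seq1 expr0 mul1r.
- by rewrite big_seq1 /weval big_nil expr0 mul1r.
- by rewrite big_nil.
- by rewrite big_cat IH1 IH2.
- by rewrite big_map -IH -sumrN; apply: eq_bigr => m _; exact: wevalN.
- rewrite big_allpairs_dep -IH1 -IH2 mulr_suml; apply: eq_bigr => m1 _.
  rewrite mulr_sumr; apply: eq_bigr => m2 _; rewrite /weval big_cat /=.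
  case: m1.1 m2.1 => [] [];
    by rewrite /= !(expr0, expr1, mul1r, mulN1r, mulrN, mulNr, opprK).
Qed.

Lemma nc_cancel_correct n l : leval (nc_cancel n l) = leval l.
Proof.
rewrite /leval; elim: n l => [|n IH] [|m l] //=.
case: ifP => [ml|_]; last by rewrite !big_cons IH.
by rewrite IH big_cons (big_rem _ ml) /= wevalN addrA subrr add0r.
Qed.

Lemma nc_eqP e1 e2 : nc_eqb e1 e2 -> nc_eval e1 = nc_eval e2.
Proof.
move/nilP; set l := nc_words _ => l0; apply/eqP; rewrite -subr_eq0.
rewrite -[X in X == 0]/(nc_eval (NcAdd e1 (NcOpp e2))) -nc_words_correct.
by rewrite -(nc_cancel_correct (size l)) l0 /leval big_nil.
Qed.
End NcEval.

(** Atoms are compared up to conversion, so that an element seen through different structures keeps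
    one index. The dummy matches run [unify] while a term is being returned. *)
Ltac nc_index x env :=
  match env with
  | cons ?y ?env' => match constr:(tt) with
      | _ => let _ := match constr:(tt) with _ => unify x y end in constr:(0%N)
      | _ => let n := nc_index x env' in constr:(S n)
      end
  end.

Ltac nc_atoms t env :=
  match t with
  | (?a + ?b)%R => let env := nc_atoms a env in nc_atoms b env
  | (?a * ?b)%R => let env := nc_atoms a env in nc_atoms b env
  | (- ?a)%R => nc_atoms a env
  | 0%R => env
  | 1%R => env
  | _ => match constr:(tt) with
         | _ => let _ := nc_index t env in env
         | _ => constr:(cons t env)
         end
  end.

Ltac nc_reify t env :=
  match t with
  | (?a + ?b)%R =>
      let a := nc_reify a env in let b := nc_reify b env in constr:(NcAdd a b)
  | (?a * ?b)%R =>
      let a := nc_reify a env in let b := nc_reify b env in constr:(NcMul a b)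
  | (- ?a)%R => let a := nc_reify a env in constr:(NcOpp a)
  | 0%R => constr:(NcZero)
  | 1%R => constr:(NcOne)
  | _ => let n := nc_index t env in constr:(NcVar n)
  end.

Ltac nc_ring :=
  match goal with |- @eq ?T ?a ?b =>
    let env := nc_atoms a (@nil T) in
    let env := nc_atoms b env in
    let ea := nc_reify a env in
    let eb := nc_reify b env in
    apply: (@nc_eqP _ env ea eb); vm_compute; reflexivity
  end.

(** * Clifford algebras *)

Section CliffordBasics.
Context {F : fieldType} {V : vectType F} (q : quadForm V).
Local Notation C := (clifford q).
Local Notation vec := (cl_vec q).

(** Every element is the class of an expression in vectors and scalars. This induction stands in for
    a basis when identities between (anti)morphisms are checked. *)
Lemma cl_elim (P : C -> Prop) :
  (forall v, P (vec v)) -> (forall a, P a%:A) ->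
  (forall x y, P x -> P y -> P (x + y)) -> (forall x y, P x -> P y -> P (x * y)) ->
  forall x, P x.
Proof.
move=> Pv Ps PD PM; elim/(@cl_ind F V q); elim=> [v|a|x Px y Py|x Px y Py].
- exact: Pv.
- by rewrite -[X in P X]/(cl_scal q a) cl_scalE.
- by rewrite cl_piD; apply: PD.
- by rewrite cl_piM; apply: PM.
Qed.

Lemma cl_gr_vec v : cl_gr (vec v) = - vec v.
Proof. exact: cl_lift_vec. Qed.

Lemma cl_gr_scal a : cl_gr (a%:A : C) = a%:A.
Proof. by rewrite linearZ rmorph1. Qed.

Lemma cl_tr_scal a : cl_tr (a%:A : C) = a%:A.
Proof. by rewrite linearZ /= cl_tr1. Qed.

Lemma cl_grK : involutive (@cl_gr F V q).
Proof.
elim/cl_elim=> [v|a|x y xK yK|x y xK yK].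
- by rewrite cl_gr_vec rmorphN /= cl_gr_vec opprK.
- by rewrite !cl_gr_scal.
- by rewrite !raddfD /= xK yK.
- by rewrite !rmorphM /= xK yK.
Qed.

Lemma cl_trK : involutive (@cl_tr F V q).
Proof.
elim/cl_elim=> [v|a|x y xK yK|x y xK yK].
- by rewrite !cl_tr_vec.
- by rewrite !cl_tr_scal.
- by rewrite !raddfD /= xK yK.
- by rewrite !cl_trM xK yK.
Qed.

Lemma cl_tr_gr (x : C) : cl_tr (cl_gr x) = cl_gr (cl_tr x).
Proof.
elim/cl_elim: x => [v|a|x y xK yK|x y xK yK].
- by rewrite cl_gr_vec linearN /= !cl_tr_vec cl_gr_vec.
- by rewrite !cl_gr_scal !cl_tr_scal cl_gr_scal.
- by rewrite !raddfD /= xK yK.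
- by rewrite rmorphM /= !cl_trM rmorphM /= xK yK.
Qed.

Lemma cl_bar_linear : linear (@cl_bar F V q).
Proof. by move=> a x y; rewrite /cl_bar !linearP. Qed.
HB.instance Definition _ :=
  GRing.isLinear.Build F C C _ (@cl_bar F V q) cl_bar_linear.

Lemma cl_barM (x y : C) : cl_bar (x * y) = cl_bar y * cl_bar x.
Proof. by rewrite /cl_bar rmorphM cl_trM. Qed.

Lemma cl_bar_vec v : cl_bar (vec v) = - vec v.
Proof. by rewrite /cl_bar cl_gr_vec linearN /= cl_tr_vec. Qed.

Lemma cl_bar_scal a : cl_bar (a%:A : C) = a%:A.
Proof. by rewrite /cl_bar cl_gr_scal cl_tr_scal. Qed.

Lemma cl_barK : involutive (@cl_bar F V q).
Proof. by move=> x; rewrite /cl_bar -cl_tr_gr cl_grK cl_trK. Qed.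

Lemma cl_gr_tr (x : C) : cl_gr (cl_tr x) = cl_bar x.
Proof. by rewrite -cl_tr_gr. Qed.

Lemma cl_tr_bar (x : C) : cl_tr (cl_bar x) = cl_gr x.
Proof. exact: cl_trK. Qed.

Lemma cl_gr_bar (x : C) : cl_gr (cl_bar x) = cl_tr x.
Proof. by rewrite /cl_bar cl_tr_gr cl_grK. Qed.

Lemma cl_bar_gr (x : C) : cl_bar (cl_gr x) = cl_tr x.
Proof. by rewrite /cl_bar cl_grK. Qed.

Lemma cl_bar_tr (x : C) : cl_bar (cl_tr x) = cl_gr x.
Proof. by rewrite /cl_bar -cl_tr_gr cl_trK. Qed.

Lemma scal_inj : injective (fun a : F => a%:A : C).
Proof.
move=> a b /eqP; rewrite -subr_eq0 -scalerBl scaler_eq0 oner_eq0 orbF subr_eq0.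
by move/eqP.
Qed.

Lemma cl_vec_polar u v : vec u * vec v + vec v * vec u = (polar q u v)%:A.
Proof.
have := cl_vec_sqr q (u + v); rewrite raddfD /= mulrDl !mulrDr !cl_vec_sqr => E.
by rewrite /polar !scalerBl -E; nc_ring.
Qed.

Lemma cl_vec_anticomm u v : polar q u v = 0 -> vec u * vec v = - (vec v * vec u).
Proof.
move=> uv; apply/eqP; rewrite -subr_eq0 opprK cl_vec_polar uv scale0r; exact/eqP.
Qed.

(** Each vector factor crossed costs one sign. For radical [u] and even [x] it says that [x]
    commutes with [u], which is why the group fixes the radical pointwise. *)
Lemma cl_orth_comm u x : (forall v, polar q u v = 0) -> vec u * x = cl_gr x * vec u.
Proof.
move=> ou; elim/cl_elim: x => [v|a|x y xE yE|x y xE yE].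
- by rewrite cl_vec_anticomm // cl_gr_vec mulNr.
- by rewrite cl_gr_scal mulr_algl mulr_algr.
- by rewrite mulrDr xE yE -mulrDl -rmorphD.
- by rewrite mulrA xE -mulrA yE mulrA -rmorphM.
Qed.

Lemma cl_norm_scalM (x y : C) m n :
  cl_norm x = m%:A -> cl_norm y = n%:A -> cl_norm (x * y) = (m * n)%:A.
Proof.
move=> xm yn; rewrite /cl_norm cl_barM mulrA -(mulrA x) -[y * _]/(cl_norm y) yn.
by rewrite mulr_algr -scalerAl -[x * _]/(cl_norm x) xm scalerA mulrC.
Qed.

End CliffordBasics.

Section CliffordMap.
Context {F : fieldType} {V W : vectType F} (q : quadForm V) (Q : quadForm W).
Variables (g : {linear V -> W}) (gq : forall v, Q (g v) = q v).
Local Notation map := (cl_map gq).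

Lemma cl_map_vec v : map (cl_vec q v) = cl_vec Q (g v).
Proof. exact: cl_lift_vec. Qed.

Lemma cl_map_gr x : map (cl_gr x) = cl_gr (map x).
Proof.
elim/(@cl_elim F V q): x => [v|a|x y xK yK|x y xK yK].
- by rewrite cl_gr_vec raddfN /= cl_map_vec cl_gr_vec.
- by rewrite cl_gr_scal linearZ rmorph1 cl_gr_scal.
- by rewrite !raddfD /= xK yK.
- by rewrite !rmorphM /= xK yK.
Qed.

Lemma cl_map_tr x : map (cl_tr x) = cl_tr (map x).
Proof.
elim/(@cl_elim F V q): x => [v|a|x y xK yK|x y xK yK].
- by rewrite !(cl_map_vec, cl_tr_vec).
- by rewrite cl_tr_scal linearZ rmorph1 cl_tr_scal.
- by rewrite !raddfD /= xK yK.
- by rewrite cl_trM !rmorphM /= xK yK cl_trM.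
Qed.

Lemma cl_map_bar x : map (cl_bar x) = cl_bar (map x).
Proof. by rewrite /cl_bar cl_map_tr cl_map_gr. Qed.

Lemma cl_map_scal a : map (a%:A) = a%:A.
Proof. by rewrite linearZ rmorph1. Qed.
End CliffordMap.

(** * Two by two matrices over an algebra *)

Definition mx2 (R : nzRingType) (a b c d : R) : 'M[R]_2 :=
  \matrix_(i, j) if i == 0 then if j == 0 then a else b
                 else if j == 0 then c else d.

Section Mx2.
Variable R : nzRingType.
Implicit Types a b c d : R.

Lemma mx2E00 a b c d : mx2 a b c d 0 0 = a. Proof. by rewrite mxE. Qed.
Lemma mx2E01 a b c d : mx2 a b c d 0 1 = b. Proof. by rewrite mxE. Qed.
Lemma mx2E10 a b c d : mx2 a b c d 1 0 = c. Proof. by rewrite mxE. Qed.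
Lemma mx2E11 a b c d : mx2 a b c d 1 1 = d. Proof. by rewrite mxE. Qed.
Definition mx2E := (mx2E00, mx2E01, mx2E10, mx2E11).

Lemma mx2P (M N : 'M[R]_2) :
  M 0 0 = N 0 0 -> M 0 1 = N 0 1 -> M 1 0 = N 1 0 -> M 1 1 = N 1 1 -> M = N.
Proof.
move=> E00 E01 E10 E11; apply/matrixP => i j.
have ord2 (k : 'I_2) : k = 0 \/ k = 1.
  by case: k => [[|[|k]] lt_k2]; [left|right|]; try exact/val_inj.
by case: (ord2 i) => ->; case: (ord2 j) => ->.
Qed.

Lemma mx2_eta (M : 'M[R]_2) : M = mx2 (M 0 0) (M 0 1) (M 1 0) (M 1 1).
Proof. by apply: mx2P; rewrite mx2E. Qed.

Lemma mx2_mul a b c d a' b' c' d' :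
  mx2 a b c d * mx2 a' b' c' d' =
  mx2 (a * a' + b * c') (a * b' + b * d') (c * a' + d * c') (c * b' + d * d').
Proof.
by apply: mx2P; rewrite mx2E mxE !big_ord_recl big_ord0 /= addr0 !mxE.
Qed.

Lemma mx2_add a b c d a' b' c' d' :
  mx2 a b c d + mx2 a' b' c' d' = mx2 (a + a') (b + b') (c + c') (d + d').
Proof. by apply: mx2P; rewrite mxE !mx2E. Qed.

Lemma mx2_opp a b c d : - mx2 a b c d = mx2 (- a) (- b) (- c) (- d).
Proof. by apply: mx2P; rewrite mxE !mx2E. Qed.

Lemma mx2_scale x a b c d : x *: mx2 a b c d = mx2 (x * a) (x * b) (x * c) (x * d).
Proof. by apply: mx2P; rewrite mxE !mx2E. Qed.

Lemma mx2_1 : 1 = mx2 1 0 0 1 :> 'M[R]_2.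
Proof. by apply: mx2P; rewrite mx2E mxE. Qed.

Lemma mx2_inj a b c d a' b' c' d' :
  mx2 a b c d = mx2 a' b' c' d' -> [/\ a = a', b = b', c = c' & d = d'].
Proof.
move=> E; split.
- by rewrite -(mx2E00 a b c d) E mx2E.
- by rewrite -(mx2E01 a b c d) E mx2E.
- by rewrite -(mx2E10 a b c d) E mx2E.
- by rewrite -(mx2E11 a b c d) E mx2E.
Qed.

Lemma mx2_offdiagM b c b' c' : mx2 0 b c 0 * mx2 0 b' c' 0 = mx2 (b * c') 0 0 (c * b').
Proof. by rewrite mx2_mul !(mulr0, mul0r, addr0, add0r). Qed.

Lemma mx2_diagM a d a' d' : mx2 a 0 0 d * mx2 a' 0 0 d' = mx2 (a * a') 0 0 (d * d').
Proof. by rewrite mx2_mul !(mulr0, mul0r, addr0, add0r). Qed.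

Lemma mx2_diagD a d a' d' : mx2 a 0 0 d + mx2 a' 0 0 d' = mx2 (a + a') 0 0 (d + d').
Proof. by rewrite mx2_add !addr0. Qed.
End Mx2.

(* ['M[A]_2] as an algebra over [F]; its canonical scalars in the library are [A]. *)
Definition matalg (F : fieldType) (A : algType F) : Type := 'M[A]_2.

Section MatAlg.
Context {F : fieldType} {A : algType F}.
HB.instance Definition _ := GRing.NzRing.on (matalg A).

Definition matalg_scale (a : F) (M : matalg A) : matalg A := a%:A *: (M : 'M[A]_2).

Lemma matalg_scaleA a b M :
  matalg_scale a (matalg_scale b M) = matalg_scale (a * b) M.
Proof. by rewrite /matalg_scale scalerA mulr_algl scalerA. Qed.

Lemma matalg_scale1 : left_id 1 matalg_scale.
Proof. by move=> M; rewrite /matalg_scale !scale1r. Qed.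

Lemma matalg_scaleDr : right_distributive matalg_scale +%R.
Proof. by move=> a M N; rewrite /matalg_scale scalerDr. Qed.

Lemma matalg_scaleDl M : {morph matalg_scale^~ M : a b / a + b}.
Proof. by move=> a b; rewrite /matalg_scale !scalerDl. Qed.

HB.instance Definition _ := GRing.Zmodule_isLmodule.Build F (matalg A)
  matalg_scaleA matalg_scale1 matalg_scaleDr matalg_scaleDl.

Lemma matalg_scaleAl (a : F) (M N : matalg A) : a *: (M * N) = (a *: M) * N.
Proof. exact: (scalerAl (a%:A : A) (M : 'M[A]_2) N). Qed.
HB.instance Definition _ :=
  GRing.Lmodule_isLalgebra.Build F (matalg A) matalg_scaleAl.

Lemma matalg_scaleAr (a : F) (M N : matalg A) : a *: (M * N) = M * (a *: N).
Proof.
apply/matrixP => i j; rewrite !mxE mulr_sumr; apply: eq_bigr => k _.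
by rewrite !mxE mulr_algl scalerAr mulr_algl.
Qed.
HB.instance Definition _ :=
  GRing.Lalgebra_isAlgebra.Build F (matalg A) matalg_scaleAr.

Lemma matalgZ (a : F) (b c d e : A) :
  a *: (mx2 b c d e : matalg A) = mx2 (a *: b) (a *: c) (a *: d) (a *: e).
Proof. by rewrite -[LHS]/(a%:A *: mx2 b c d e) mx2_scale !mulr_algl. Qed.
End MatAlg.

(** * Independence of scalars and vectors in the Clifford algebra *)

Section ParaInj.
Context {F : fieldType} {V : vectType F} (q : quadForm V).
Local Notation C := (clifford q).
Local Notation vec := (cl_vec q).

Section Jet.
Variable phi : {linear V -> F^o}.

(** The opposite diagonal entries cancel the off-diagonal term of the square, so the Clifford
    relation holds for an arbitrary functional [phi]. In the induced morphism the upper right corner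
    is the contraction by [phi], a skew derivation. *)
Definition jet (v : V) : matalg C := mx2 (vec v) ((phi v : F)%:A) 0 (- vec v).

Lemma jet_linear : linear jet.
Proof.
move=> a u v; apply: etrans (esym (congr1 (+%R^~ (jet v)) (matalgZ _ _ _ _ _))).
rewrite [RHS]mx2_add /jet [phi _]linearP [vec _]linearP /= scaler0 addr0.
by rewrite opprD scalerN scalerA scalerDl.
Qed.
HB.instance Definition _ := GRing.isLinear.Build F V (matalg C) _ jet jet_linear.

Lemma jet_sqr v : jet v * jet v = (q v)%:A.
Proof.
rewrite [LHS]mx2_mul [in RHS]mx2_1 [RHS]matalgZ !cl_vec_sqr scaler0.
rewrite !(mul0r, mulr0, addr0, add0r) mulr_algl mulr_algr scalerN subrr.
by rewrite mulrNN cl_vec_sqr.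
Qed.
End Jet.

(* [jet] makes every linear functional vanish at a relation [a + v = 0]. *)
Lemma cl_vec_free a v : a%:A + vec v = 0 -> a = 0 /\ v = 0.
Proof.
move=> av0; suff v0 : v = 0.
  by split=> //; apply: (@scal_inj _ _ q); rewrite scale0r -av0 v0 raddf0 addr0.
rewrite (coord_vbasis (memvf v)) big1 // => i _.
pose phi : {linear V -> F^o} := coord (vbasis {:V}) i.
have := congr1 (cl_lift (jet phi) (jet_sqr phi)) av0.
rewrite raddf0 raddfD /= linearZ rmorph1 /= cl_lift_vec [1]mx2_1.
rewrite [_ *: _]matalgZ [LHS]mx2_add => /matrixP/(_ 0 1).
rewrite mx2E mxE scaler0 add0r => /eqP.
by rewrite scaler_eq0 oner_eq0 orbF => /eqP ->; rewrite scale0r.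
Qed.

Lemma cl_vec_inj : injective vec.
Proof.
move=> u v uv; apply/eqP; rewrite -subr_eq0; apply/eqP.
by case: (@cl_vec_free 0 (u - v)) => //; rewrite scale0r add0r raddfB /= uv subrr.
Qed.

Lemma para_cl_inj : injective (para_cl q).
Proof.
move=> [a u] [b v]; rewrite /para_cl /= => E.
case: (@cl_vec_free (a - b) (u - v)).
  rewrite raddfB scalerBl /=; move/eqP: E; rewrite -subr_eq0 => /eqP <-; nc_ring.
by move=> /subr0_eq -> /subr0_eq ->.
Qed.
End ParaInj.

(** * Finite-dimensional algebras are Dedekind finite *)

Section Algebraic.
Context {F : fieldType} {A : algType F}.

(** [clifford] carries no [vectType] structure, so finite dimension is stated by a spanning list.
    Coefficients are indexed by [nat], which keeps their type independent of the list. *)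
Definition spans (s : seq A) : set A :=
  [set x | exists u : nat -> F, x = \sum_(i < size s) u i *: s`_i].

Lemma spans0 s : spans s 0.
Proof. by exists (fun=> 0); rewrite big1 // => i _; rewrite scale0r. Qed.

Lemma spansD s x y : spans s x -> spans s y -> spans s (x + y).
Proof.
move=> [u ->] [w ->]; exists (fun i => u i + w i); rewrite -big_split.
by apply: eq_bigr => i _; rewrite scalerDl.
Qed.

Lemma spansZ s a x : spans s x -> spans s (a *: x).
Proof.
move=> [u ->]; exists (fun i => a * u i); rewrite scaler_sumr.
by apply: eq_bigr => i _; rewrite scalerA.
Qed.

Lemma spansN s x : spans s x -> spans s (- x).
Proof. by rewrite -scaleN1r; apply: spansZ. Qed.

Lemma spans_mem s x : x \in s -> spans s x.
Proof.
move=> xs; exists (fun i => (i == index x s)%:R).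
have lt_xs : (index x s < size s)%N by rewrite index_mem.
rewrite (bigD1 (Ordinal lt_xs)) //= eqxx scale1r nth_index // big1 ?addr0 //.
move=> i; rewrite -val_eqE /= => /negPf ->; by rewrite scale0r.
Qed.

Lemma spans_ind s (P : A -> Prop) :
  P 0 -> (forall x y, P x -> P y -> P (x + y)) -> (forall a x, P x -> P (a *: x)) ->
  (forall x, x \in s -> P x) -> forall x, spans s x -> P x.
Proof.
move=> P0 PD PZ Ps x [u ->]; apply: (big_ind P) => // i _.
by apply/PZ/Ps/mem_nth.
Qed.

Hypothesis fin : exists s : seq A, forall x, spans s x.

(** The coefficients of the n + 1 powers 1, ..., y^n on n spanning elements form a matrix with more
    rows than columns. A nonzero vector of its left kernel gives the coefficients of the
    polynomial. *)
Lemma spans_algebraic (y : A) : exists2 p : {poly F}, p != 0 & horner_alg y p = 0.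
Proof.
case: fin => s sT; have [u uE] := choice (fun i => sT (y ^+ i)).
set n := size s in uE.
pose U : 'M[F]_(n.+1, n) := \matrix_(i, j) u i j.
have : kermx U != 0.
  rewrite -mxrank_eq0 mxrank_ker subn_eq0 -ltnNge ltnS; exact: rank_leq_col.
case/rowV0Pn => w /sub_kermxP wU w0.
exists (\poly_(i < n.+1) w 0 (inord i)).
  apply: contraNneq w0 => p0; apply/eqP/rowP => i; rewrite mxE.
  have := congr1 (fun p : {poly F} => p`_i) p0.
  by rewrite coef0 coef_poly ltn_ord inord_val.
rewrite poly_def raddf_sum /=.
transitivity (\sum_(i < n.+1) \sum_(j < n) (w 0 i * u i j) *: s`_j).
  apply: eq_bigr => i _; rewrite linearZ rmorphXn /= horner_algX inord_val uE.
  by rewrite mulr_algl scaler_sumr; apply: eq_bigr => j _; rewrite scalerA.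
rewrite exchange_big big1 //= => j _; rewrite -scaler_suml.
have := congr1 (fun M : 'rV_n => M 0 j) wU; rewrite !mxE => wUj.
rewrite [X in X *: _](_ : _ = 0) ?scale0r // -[RHS]wUj.
by apply: eq_bigr => i _; rewrite mxE.
Qed.

(** Left multiplication by [x] cancels [y], so factors X can be stripped from a polynomial killing
    [y]. Once the constant term is nonzero, it yields a right inverse of [y], which must be [x]. *)
Lemma spans_dedekind_finite (x y : A) : x * y = 1 -> y * x = 1.
Proof.
move=> xy; case: (spans_algebraic y) => p; move: {2}(size p) (leqnn (size p)) => m.
elim: m p => [|m IH] p; first by rewrite leqn0 size_poly_eq0 => /eqP->; rewrite eqxx.
have [p0|p0 szp pn0 py] := eqVneq p.[0] 0.
  have /factor_theorem[r ->] : root p 0 by apply/eqP.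
  rewrite subr0 => szp; rewrite mulf_eq0 negb_or => /andP[r0 _].
  rewrite mulrC rmorphM /= horner_algX.
  move/(congr1 ( *%R x)); rewrite mulr0 mulrA xy mul1r.
  by apply: IH => //; rewrite size_mulX in szp.
have : root (p - p.[0]%:P) 0 by rewrite /root !hornerE subrr.
move/factor_theorem => [r]; rewrite subr0 => /eqP; rewrite subr_eq => /eqP pE.
move: py; rewrite pE mulrC raddfD /= rmorphM /= horner_algX horner_algC.
set a := p.[0]; set t := horner_alg y r => /eqP; rewrite addr_eq0 => /eqP ytE.
have yt : y * (- a^-1 *: t) = 1.
  by rewrite -scalerAr ytE -scaleNr scalerA mulrNN mulVf // scale1r.
by rewrite -[x]mulr1 -yt (mulrA x) xy mul1r.
Qed.
End Algebraic.

Section CliffordFinite.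
Context {F : fieldType} {V : vectType F} (q : quadForm V).
Local Notation C := (clifford q).
Local Notation vec := (cl_vec q).

(** The list is doubled for each new vector by right multiplication with it. The last clause carries
    a vector across the span; it is kept for every [v] because each later [b k] has to cross what
    was built before it. *)
Lemma spans_step (b : nat -> V) k : exists s : seq C,
  [/\ spans s 1, forall i, (i < k)%N -> forall x, spans s x -> spans s (vec (b i) * x)
    & forall v x, spans s x ->
        exists y z, [/\ spans s y, spans s z & vec v * x = y + z * vec v]].
Proof.
elim: k => [|k [s [s1 sM sC]]].
  exists [:: 1]; split=> [|//|v]; first by apply: spans_mem; rewrite mem_head.
  apply: spans_ind.
  - by exists 0, 0; split; [exact: spans0|exact: spans0|nc_ring].
  - move=> x x' [y [z [sy sz xE]]] [y' [z' [sy' sz' xE']]].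
    exists (y + y'), (z + z'); split; try exact: spansD.
    by rewrite mulrDr xE xE'; nc_ring.
  - move=> a x [y [z [sy sz xE]]]; exists (a *: y), (a *: z).
    by split; try exact: spansZ; rewrite -scalerAr xE scalerDr scalerAl.
  - move=> x; rewrite inE => /eqP ->; exists 0, 1.
    by split; [exact: spans0|apply: spans_mem; rewrite mem_head|nc_ring].
pose t := s ++ [seq x * vec (b k) | x <- s]; exists t.
have st x : spans s x -> spans t x.
  apply: spans_ind x; [exact: spans0|exact: spansD|exact: spansZ|] => x xs.
  by apply: spans_mem; rewrite mem_cat xs.
have stM x : spans s x -> spans t (x * vec (b k)).
  move: x; apply: spans_ind => [|x y xt yt|a x xt|x xs].
  - by rewrite mul0r; apply: spans0.
  - by rewrite mulrDl; apply: spansD.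
  - by rewrite -scalerAl; apply: spansZ.
  - by apply: spans_mem; rewrite mem_cat (map_f (fun x => x * _)) ?orbT.
have tP x : spans t x ->
    exists x1 x2, [/\ spans s x1, spans s x2 & x = x1 + x2 * vec (b k)].
  move: x; apply: spans_ind => [|x x' [y [z [sy sz ->]]] [y' [z' [sy' sz' ->]]]
    |a x [y [z [sy sz ->]]]|x].
  - by exists 0, 0; split; [exact: spans0|exact: spans0|nc_ring].
  - by exists (y + y'), (z + z'); split; try exact: spansD; nc_ring.
  - exists (a *: y), (a *: z); split; try exact: spansZ.
    by rewrite scalerDr scalerAl.
  - rewrite mem_cat => /orP[xs|/mapP[y ys ->]].
      by exists x, 0; split; [exact: spans_mem|exact: spans0|nc_ring].
    by exists 0, y; split; [exact: spans0|exact: spans_mem|nc_ring].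
split; first exact: st.
- move=> i; rewrite ltnS leq_eqVlt => /orP[/eqP ->|ik] x /tP[x1 [x2 [s1x s2x ->]]].
    have [y [z [sy sz yE]]] := sC (b k) _ s1x.
    have [y' [z' [sy' sz' yE']]] := sC (b k) _ s2x.
    rewrite mulrDr mulrA yE yE' mulrDl -mulrA cl_vec_sqr mulr_algr.
    by apply: spansD; apply: spansD; auto; apply/st/spansZ.
  by rewrite mulrDr mulrA; apply: spansD; [apply/st/sM|apply/stM/sM].
- move=> v x /tP[x1 [x2 [s1x s2x ->]]].
  have [y [z [sy sz yE]]] := sC v _ s1x.
  have [y' [z' [sy' sz' yE']]] := sC v _ s2x.
  (* After [v] has crossed [x2], the product of [v] and [b k] is replaced by their polar value minus
     the product in the other order. *)
  exists (y + y' * vec (b k) + polar q v (b k) *: z'), (z - z' * vec (b k)); split.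
  + by apply: spansD; [apply: spansD; [exact: st|exact: stM]|exact/spansZ/st].
  + by apply: spansD; [exact: st|exact/spansN/stM].
  rewrite -[_ *: z']mulr_algr -cl_vec_polar mulrDr mulrA yE yE'; nc_ring.
Qed.

Lemma clifford_fin : exists s : seq C, forall x, spans s x.
Proof.
pose n := \dim {:V}; pose b (i : nat) := (vbasis {:V})`_i.
have [s [s1 sM _]] := spans_step b n; exists s => x.
suff Ms y : spans s y -> spans s (x * y) by rewrite -[x]mulr1; apply: Ms.
elim/(@cl_elim F V q): x y => [v|a|x x' IH IH'|x x' IH IH'] y sy.
- rewrite (coord_vbasis (memvf v)) raddf_sum mulr_suml.
  apply: (big_ind (spans s)) => [||i _]; [exact: spans0|exact: spansD|].
  by rewrite /= linearZ -scalerAl; apply/spansZ/sM.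
- by rewrite mulr_algl; apply: spansZ.
- by rewrite mulrDl; apply: spansD; auto.
- by rewrite -mulrA; auto.
Qed.

(* Scalar norms [x * bar x] a priori give one-sided inverses only. *)
Lemma cl_dedekind_finite (x y : C) : x * y = 1 -> y * x = 1.
Proof. exact: (spans_dedekind_finite clifford_fin). Qed.

Lemma cl_dedekind_scal (x y : C) n : n != 0 -> x * y = n%:A -> y * x = n%:A.
Proof.
move=> n0 xy; have : x * (n^-1 *: y) = 1 by rewrite -scalerAr xy scalerA mulVf ?scale1r.
move/cl_dedekind_finite/(congr1 ( *:%R n)).
by rewrite -scalerAl scalerA divff // scale1r.
Qed.
End CliffordFinite.

(** * The even Clifford algebra as a matrix algebra *)

Section VahlenImage.
Context {F : fieldType} {V : vectType F} (q : quadForm V).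
Hypothesis two_neq0 : 2 != 0 :> F.
Local Notation C := (clifford q).
Local Notation vec := (cl_vec q).
Local Notation CU := (clifford (quadU q)).
Local Notation uvec := (cl_vec (quadU q)).
Local Notation rho := (uvec (VUvec 0 1 0 0)).
Local Notation e := (uvec (VUvec 0 0 1 0)).
Local Notation f := (uvec (VUvec 0 0 0 1)).
Local Notation Phi := (@vahlen_image F V q).
Local Notation clq := (@clU F V q).

HB.instance Definition _ := GRing.LRMorphism.copy clq (cl_map (inclU_isom q)).

Lemma clU_vec v : clq (vec v) = uvec (inclU v).
Proof. exact: cl_map_vec. Qed.

Lemma clU_gr x : clq (cl_gr x) = cl_gr (clq x).
Proof. exact: cl_map_gr. Qed.

Lemma quad0 : q 0 = 0.
Proof. by rewrite -(scale0r 0) quadZ expr0n mul0r. Qed.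

Lemma polar0 u : polar q 0 u = 0.
Proof. by rewrite -(scale0r 0) polarZl mul0r. Qed.

Lemma rho_sqr : rho * rho = - 1.
Proof.
rewrite cl_vec_sqr [quadU _ _](_ : _ = -1) ?scaleN1r //=.
by rewrite quad0; ring.
Qed.

Lemma e_sqr : e * e = 0.
Proof.
rewrite cl_vec_sqr [quadU _ _](_ : _ = 0) ?scale0r //=.
by rewrite quad0; ring.
Qed.

Lemma f_sqr : f * f = 0.
Proof.
rewrite cl_vec_sqr [quadU _ _](_ : _ = 0) ?scale0r //=.
by rewrite quad0; ring.
Qed.

Lemma ef_fe : e * f + f * e = 1.
Proof.
rewrite cl_vec_polar [polar _ _ _](_ : _ = 1) ?scale1r //.
by rewrite quadU_polarE polar0; ring.
Qed.

Lemma rho_e : rho * e = - (e * rho).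
Proof. by apply: cl_vec_anticomm; rewrite quadU_polarE polar0; ring. Qed.

Lemma rho_f : rho * f = - (f * rho).
Proof. by apply: cl_vec_anticomm; rewrite quadU_polarE polar0; ring. Qed.

Lemma efe : e * f * e = e.
Proof.
have /eqP := ef_fe; rewrite addrC eq_sym -subr_eq => /eqP feE.
by rewrite -mulrA -feE mulrBr mulrA e_sqr mul0r mulr1 subr0.
Qed.

Lemma fef : f * e * f = f.
Proof.
have /eqP := ef_fe; rewrite eq_sym -subr_eq => /eqP efE.
by rewrite -mulrA -efE mulrBr mulrA f_sqr mul0r mulr1 subr0.
Qed.

Let rho_rhor (x : CU) : x * rho * rho = - x.
Proof. by rewrite -mulrA rho_sqr mulrN1. Qed.
Let rho_er (x : CU) : x * rho * e = - (x * e * rho).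
Proof. by rewrite -mulrA rho_e mulrN mulrA. Qed.
Let rho_fr (x : CU) : x * rho * f = - (x * f * rho).
Proof. by rewrite -mulrA rho_f mulrN mulrA. Qed.
Let e_er (x : CU) : x * e * e = 0.
Proof. by rewrite -mulrA e_sqr mulr0. Qed.
Let f_fr (x : CU) : x * f * f = 0.
Proof. by rewrite -mulrA f_sqr mulr0. Qed.
(** Rewrite rules that normalize left-nested words in [e], [f], [rho]: [rho] moves to the right and
    repeated letters contract. The variants with a prefix [x] reach the inner positions. *)
Let wordE := (rho_er, rho_fr, rho_rhor, efe, fef, e_sqr, f_sqr, e_er, f_fr,
  @mulrN CU, @mulNr CU, @opprK CU, @mul0r CU, @mulr0 CU, @oppr0 CU).

Lemma clU_orth u x : (forall v, polar (quadU_val q) u (inclU v) = 0) ->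
  uvec u * clq x = clq (cl_gr x) * uvec u.
Proof.
move=> ou; elim/(@cl_elim F V q): x => [v|a|x y xE yE|x y xE yE].
- by rewrite cl_gr_vec raddfN /= clU_vec mulNr; apply: cl_vec_anticomm.
- by rewrite cl_gr_scal linearZ rmorph1 mulr_algl mulr_algr.
- by rewrite !raddfD /= mulrDr xE yE -mulrDl.
- by rewrite !rmorphM /= mulrA xE -mulrA yE mulrA.
Qed.

Lemma rho_clU x : rho * clq x = clq (cl_gr x) * rho.
Proof. by apply: clU_orth => v; rewrite quadU_polarE polar0; ring. Qed.
Lemma e_clU x : e * clq x = clq (cl_gr x) * e.
Proof. by apply: clU_orth => v; rewrite quadU_polarE polar0; ring. Qed.
Lemma f_clU x : f * clq x = clq (cl_gr x) * f.
Proof. by apply: clU_orth => v; rewrite quadU_polarE polar0; ring. Qed.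

Lemma cl_parts (x y z : C) : cl_gr x = x -> cl_gr y = - y -> z = x + y ->
  cl_even z = x /\ cl_odd z = y.
Proof.
have half (t : C) : 2^-1 *: (t + t) = t.
  by rewrite -mulr2n -scaler_nat scalerA mulVf ?scale1r.
move=> gx gy ->; rewrite /cl_even /cl_odd rmorphD /= gx gy; split.
- by rewrite -[RHS]half; congr (_ *: _); nc_ring.
- by rewrite -[RHS]half; congr (_ *: _); nc_ring.
Qed.

Lemma cl_gr_even (x : C) : cl_gr (cl_even x) = cl_even x.
Proof. by rewrite /cl_even linearZ rmorphD /= cl_grK addrC. Qed.

Lemma cl_gr_odd (x : C) : cl_gr (cl_odd x) = - cl_odd x.
Proof. by rewrite /cl_odd linearZ rmorphB /= cl_grK -scalerN opprB. Qed.

Lemma cl_even_odd (x : C) : x = cl_even x + cl_odd x.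
Proof.
rewrite /cl_even /cl_odd -scalerDr [_ + _](_ : _ = x + x); last by nc_ring.
by rewrite -mulr2n -scaler_nat scalerA mulVf ?scale1r.
Qed.

Lemma cl_rho_split (x y : C) : cl_gr x = x -> cl_gr y = - y ->
  cl_rho (x + y) = clq x + clq y * rho.
Proof. by move=> gx gy; rewrite /cl_rho; case: (cl_parts gx gy erefl) => -> ->. Qed.

Lemma cl_rho_linear : linear (@cl_rho F V q).
Proof.
move=> a x y; rewrite {1}[x]cl_even_odd {1}[y]cl_even_odd scalerDr.
rewrite [_ + _](_ : _ = a *: cl_even x + cl_even y + (a *: cl_odd x + cl_odd y)).
  rewrite cl_rho_split; first by rewrite /cl_rho !linearP /= mulrDl scalerDr -scalerAl;
    nc_ring.
    by rewrite linearP /= !cl_gr_even.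
  by rewrite linearP /= !cl_gr_odd opprD scalerN.
by nc_ring.
Qed.
HB.instance Definition _ :=
  GRing.isLinear.Build F C CU _ (@cl_rho F V q) cl_rho_linear.

(** For odd y one has x rho y rho = - x y rho^2 = x y: the anticommutation sign cancels rho^2 = -1.
    This is the reason for the value -1 on the added line. *)
Lemma cl_rho_monoid : monoid_morphism (@cl_rho F V q).
Proof.
split=> [|x y].
  rewrite -[X in cl_rho X]addr0 cl_rho_split ?rmorph1 ?raddf0 ?oppr0 ?mul0r ?addr0 //.
rewrite {1}[x]cl_even_odd {1}[y]cl_even_odd /(cl_rho x) /(cl_rho y).
move: (cl_even x) (cl_odd x) (cl_even y) (cl_odd y) (cl_gr_even x) (cl_gr_odd x)
  (cl_gr_even y) (cl_gr_odd y) => x0 x1 y0 y1 gx0 gx1 gy0 gy1.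
rewrite [_ * _](_ : _ = x0 * y0 + x1 * y1 + (x0 * y1 + x1 * y0)); last by nc_ring.
rewrite cl_rho_split; first last.
- by rewrite rmorphD !rmorphM /= gx0 gx1 gy0 gy1; nc_ring.
- by rewrite rmorphD !rmorphM /= gx0 gx1 gy0 gy1; nc_ring.
rewrite [RHS]mulrDl !mulrDr -!mulrA ![rho * (_ * _)]mulrA !rho_clU gy0 gy1.
rewrite rmorphN !rmorphD /= !rmorphM /= !mulrDl !mulNr !mulrN !mulrA !wordE.
by nc_ring.
Qed.
HB.instance Definition _ :=
  GRing.isMonoidMorphism.Build C CU (@cl_rho F V q) cl_rho_monoid.

Lemma cl_rho_vec v : cl_rho (vec v) = uvec (inclU v) * rho.
Proof.
rewrite -[vec v]add0r cl_rho_split ?raddf0 ?add0r ?cl_gr_vec //.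
by rewrite /= clU_vec.
Qed.

Lemma cl_rho_scal a : cl_rho (a%:A : C) = a%:A.
Proof. by rewrite linearZ rmorph1. Qed.

Lemma e_cl_rho x : e * cl_rho x = cl_rho x * e.
Proof.
rewrite /cl_rho mulrDr mulrA !e_clU cl_gr_even cl_gr_odd raddfN /=.
by rewrite [RHS]mulrDl -[_ * rho * e]mulrA rho_e; nc_ring.
Qed.

Lemma f_cl_rho x : f * cl_rho x = cl_rho x * f.
Proof.
rewrite /cl_rho mulrDr mulrA !f_clU cl_gr_even cl_gr_odd raddfN /=.
by rewrite [RHS]mulrDl -[_ * rho * f]mulrA rho_f; nc_ring.
Qed.

Lemma rho_cl_rho x : rho * cl_rho x = cl_rho (cl_gr x) * rho.
Proof.
rewrite {2}[x]cl_even_odd raddfD /= cl_rho_split; first last.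
- by rewrite cl_gr_odd raddfN /= cl_gr_odd.
- by rewrite !cl_gr_even.
rewrite /cl_rho mulrDr mulrA !rho_clU mulrDl.
by rewrite cl_gr_even cl_gr_odd raddfN /=; nc_ring.
Qed.

Lemma cl_gr_cl_rho (x : C) : cl_gr (cl_rho x) = cl_rho x.
Proof.
rewrite /cl_rho rmorphD /= [cl_gr (_ * rho)]rmorphM /= cl_gr_vec -!clU_gr cl_gr_even cl_gr_odd.
by rewrite raddfN /= mulrNN.
Qed.

Lemma cl_bar_cl_rho (x : C) : cl_bar (cl_rho x) = cl_rho (cl_bar x).
Proof.
elim/(@cl_elim F V q): x => [v|a|x y xE yE|x y xE yE].
- rewrite cl_bar_vec raddfN /= cl_rho_vec cl_barM !cl_bar_vec mulrNN.
  by apply: cl_vec_anticomm; rewrite quadU_polarE polar0; ring.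
- by rewrite cl_rho_scal !cl_bar_scal cl_rho_scal.
- by rewrite [cl_rho _]raddfD [LHS]raddfD /= xE yE [cl_bar (x + y)]raddfD raddfD.
- by rewrite cl_barM !rmorphM /= cl_barM xE yE.
Qed.

Lemma vahlen_image_mx2 (a b c d : C) :
  Phi (mx2 a b c d) = cl_rho a * (e * f) + cl_rho b * (e * rho)
    + cl_rho (cl_gr c) * (f * rho) + cl_rho (cl_gr d) * (f * e).
Proof. by rewrite /vahlen_image !mx2E !mulrA. Qed.

Let unit_mul (E E' E'' x y z : CU) : E * y = z * E -> E * E' = E'' ->
  (x * E) * (y * E') = x * z * E''.
Proof. by move=> Ey EE'; rewrite -mulrA (mulrA E) Ey -mulrA EE' mulrA. Qed.

(** [e * f], [e * rho], [f * rho], [f * e] multiply as matrix units. The diagonal ones commute with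
    [cl_rho x], the other two twist [x] by [cl_gr], and the gradings on the second row of
    [vahlen_image] absorb this twist. *)
Lemma vahlen_imageM M N : Phi (M * N) = Phi M * Phi N.
Proof.
rewrite [M]mx2_eta [N]mx2_eta mx2_mul.
move: (M 0 0) (M 0 1) (M 1 0) (M 1 1) (N 0 0) (N 0 1) (N 1 0) (N 1 1).
move=> a b c d a' b' c' d'; rewrite !vahlen_image_mx2.
have c11 x : e * f * cl_rho x = cl_rho x * (e * f).
  by rewrite -mulrA f_cl_rho mulrA e_cl_rho mulrA.
have c22 x : f * e * cl_rho x = cl_rho x * (f * e).
  by rewrite -mulrA e_cl_rho mulrA f_cl_rho mulrA.
have c12 x : e * rho * cl_rho x = cl_rho (cl_gr x) * (e * rho).
  by rewrite -mulrA rho_cl_rho mulrA e_cl_rho mulrA.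
have c21 x : f * rho * cl_rho x = cl_rho (cl_gr x) * (f * rho).
  by rewrite -mulrA rho_cl_rho mulrA f_cl_rho mulrA.
rewrite [RHS]mulrDl 2!(mulrDl _ _ (_ + _)) !mulrDr.
have m1111 : e * f * (e * f) = e * f by rewrite !mulrA !wordE.
have m1112 : e * f * (e * rho) = e * rho by rewrite !mulrA !wordE.
have m1121 : e * f * (f * rho) = 0 by rewrite !mulrA !wordE.
have m1122 : e * f * (f * e) = 0 by rewrite !mulrA !wordE.
have m1211 : e * rho * (e * f) = 0 by rewrite !mulrA !wordE.
have m1212 : e * rho * (e * rho) = 0 by rewrite !mulrA !wordE.
have m1221 : e * rho * (f * rho) = e * f by rewrite !mulrA !wordE.
have m1222 : e * rho * (f * e) = e * rho by rewrite !mulrA !wordE.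
have m2111 : f * rho * (e * f) = f * rho by rewrite !mulrA !wordE.
have m2112 : f * rho * (e * rho) = f * e by rewrite !mulrA !wordE.
have m2121 : f * rho * (f * rho) = 0 by rewrite !mulrA !wordE.
have m2122 : f * rho * (f * e) = 0 by rewrite !mulrA !wordE.
have m2211 : f * e * (e * f) = 0 by rewrite !mulrA !wordE.
have m2212 : f * e * (e * rho) = 0 by rewrite !mulrA !wordE.
have m2221 : f * e * (f * rho) = f * rho by rewrite !mulrA !wordE.
have m2222 : f * e * (f * e) = f * e by rewrite !mulrA !wordE.
rewrite (unit_mul _ (c11 _) m1111) (unit_mul _ (c11 _) m1112)
  (unit_mul _ (c11 _) m1121) (unit_mul _ (c11 _) m1122).
rewrite (unit_mul _ (c12 _) m1211) (unit_mul _ (c12 _) m1212)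
  (unit_mul _ (c12 _) m1221) (unit_mul _ (c12 _) m1222).
rewrite (unit_mul _ (c21 _) m2111) (unit_mul _ (c21 _) m2112)
  (unit_mul _ (c21 _) m2121) (unit_mul _ (c21 _) m2122).
rewrite (unit_mul _ (c22 _) m2211) (unit_mul _ (c22 _) m2212)
  (unit_mul _ (c22 _) m2221) (unit_mul _ (c22 _) m2222).
rewrite !(rmorphD (@cl_gr F V q)) !(rmorphM (@cl_gr F V q)) /= !cl_grK.
rewrite !(rmorphD (@cl_rho F V q)) !(rmorphM (@cl_rho F V q)) /=; nc_ring.
Qed.
(* Under [vahlen_image], [mx_rho] is the conjugation by [rho], [mx_dag] is the bar
   involution, and the vector [w] is [- mx_vec w * rho]; hence [eta w etabar] has the
   matrix [M * mx_vec w * mx_flat M], where [mx_flat M = mx_rho (mx_dag M)]. *)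
Definition mx_rho (M : 'M[C]_2) : 'M[C]_2 :=
  mx2 (cl_gr (M 0 0)) (- cl_gr (M 0 1)) (- cl_gr (M 1 0)) (cl_gr (M 1 1)).

Definition mx_dag (M : 'M[C]_2) : 'M[C]_2 :=
  mx2 (cl_tr (M 1 1)) (- cl_tr (M 0 1)) (- cl_tr (M 1 0)) (cl_tr (M 0 0)).

Definition mx_flat (M : 'M[C]_2) : 'M[C]_2 :=
  mx2 (cl_bar (M 1 1)) (cl_bar (M 0 1)) (cl_bar (M 1 0)) (cl_bar (M 0 0)).

(** The sign inverts iota, which sends a + v to v - a rho. *)
Definition para_of (w : VU V) : para V := let: (v, a, _, _) := w in (- (a : F), v).
Definition e_of (w : VU V) : F := let: (_, _, x, _) := w in x.
Definition f_of (w : VU V) : F := let: (_, _, _, y) := w in y.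
Local Notation pcl w := (para_cl q (para_of w)).

Definition mx_vec (w : VU V) : 'M[C]_2 :=
  mx2 (pcl w) ((e_of w)%:A) ((f_of w)%:A) (cl_bar (pcl w)).

Lemma vahlen_image1 : Phi 1 = 1.
Proof.
rewrite mx2_1 vahlen_image_mx2 !rmorph1 !raddf0 /= !mul0r !mul1r !addr0.
exact: ef_fe.
Qed.

Lemma vahlen_imageZ a M : Phi (a%:A *: M) = a *: Phi M.
Proof.
have grZ x : cl_gr (a%:A * x) = a%:A * cl_gr x.
  by rewrite rmorphM /= cl_gr_scal.
have rhoZ (x : C) : cl_rho (a%:A * x) = a *: cl_rho x.
  by rewrite mulr_algl linearZ.
rewrite [M]mx2_eta mx2_scale !vahlen_image_mx2 !grZ !rhoZ.
by rewrite -!scalerAl !scalerDr.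
Qed.

Lemma cl_gr_vahlen_image M : cl_gr (Phi M) = Phi M.
Proof.
rewrite [M]mx2_eta vahlen_image_mx2 !(rmorphD (@cl_gr _ _ _)) /=.
rewrite !(rmorphM (@cl_gr _ _ _) (cl_rho _)) /= !cl_gr_cl_rho.
by rewrite !(rmorphM (@cl_gr _ _ _) (uvec _)) /= !cl_gr_vec !mulrNN.
Qed.

Lemma cl_bar_vahlen_image M : cl_bar (Phi M) = Phi (mx_dag M).
Proof.
rewrite [M]mx2_eta /mx_dag !mx2E !vahlen_image_mx2 !(raddfD (@cl_bar _ _ _)) /=.
rewrite !(cl_barM (cl_rho _)) !cl_bar_cl_rho !(cl_barM (uvec _)) !cl_bar_vec !mulrNN.
rewrite !cl_bar_gr !(raddfN (@cl_gr F V q)) !(raddfN (@cl_rho F V q)) /= !cl_gr_tr.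
rewrite rho_e rho_f !mulNr -[f * e * _]mulrA e_cl_rho mulrA f_cl_rho.
rewrite -[e * f * _]mulrA f_cl_rho mulrA e_cl_rho -[e * rho * _]mulrA rho_cl_rho.
rewrite mulrA e_cl_rho -[f * rho * _]mulrA rho_cl_rho mulrA f_cl_rho.
by rewrite cl_gr_bar cl_gr_tr; nc_ring.
Qed.

Lemma rho_vahlen_image M : rho * Phi M = Phi (mx_rho M) * rho.
Proof.
rewrite [M]mx2_eta /mx_rho !mx2E !vahlen_image_mx2.
have rhoE x E E' : rho * E = E' * rho ->
    rho * (cl_rho x * E) = cl_rho (cl_gr x) * E' * rho.
  by move=> rE; rewrite mulrA rho_cl_rho -mulrA rE mulrA.
have r11 : rho * (e * f) = e * f * rho by rewrite !mulrA rho_e !wordE.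
have r12 : rho * (e * rho) = - (e * rho) * rho by rewrite !mulrA rho_e !wordE.
have r21 : rho * (f * rho) = - (f * rho) * rho by rewrite !mulrA rho_f !wordE.
have r22 : rho * (f * e) = f * e * rho by rewrite !mulrA rho_f !wordE.
rewrite 3!(mulrDr rho) (rhoE _ _ _ r11) (rhoE _ _ _ r12) (rhoE _ _ _ r21).
rewrite (rhoE _ _ _ r22).
rewrite !(raddfN (@cl_gr F V q)) !(raddfN (@cl_rho F V q)) /= !cl_grK; nc_ring.
Qed.

Lemma VU_eta (w : VU V) : w = VUvec (para_of w).2 (- (para_of w).1) (e_of w) (f_of w).
Proof. by case: w => [[[v a] x] y]; rewrite /= opprK. Qed.

Lemma uvec_decomp v a x y :
  uvec (VUvec v a x y) = uvec (inclU v) + a *: rho + x *: e + y *: f.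
Proof.
rewrite -!linearZ -!raddfD; congr (uvec _).
rewrite -[RHS]/(VUvec (v + a *: 0 + x *: 0 + y *: 0) (0 + a * 1 + x * 0 + y * 0)
  (0 + a * 0 + x * 1 + y * 0) (0 + a * 0 + x * 0 + y * 1)).
by rewrite !scaler0 !addr0; congr VUvec; ring.
Qed.

Lemma cl_gr_para (p : para V) : cl_gr (para_cl q p) = cl_bar (para_cl q p).
Proof. by rewrite /para_cl !raddfD /= cl_gr_scal cl_bar_scal cl_gr_vec cl_bar_vec. Qed.

Lemma cl_tr_para (p : para V) : cl_tr (para_cl q p) = para_cl q p.
Proof. by rewrite /para_cl raddfD /= cl_tr_scal cl_tr_vec. Qed.

Lemma cl_bar_para (p : para V) : cl_bar (para_cl q p) = (p.1 : F)%:A - vec p.2.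
Proof. by rewrite /para_cl !raddfD /= cl_bar_scal cl_bar_vec. Qed.

Lemma para_normE (p : para V) :
  para_cl q p * cl_bar (para_cl q p) = (- quadF q p)%:A.
Proof.
have H (a : F) v : (a%:A + vec v) * (a%:A - vec v) = (a ^+ 2 - q v)%:A.
  have av : a%:A * vec v = vec v * a%:A by rewrite mulr_algl mulr_algr.
  transitivity ((a%:A * a%:A : C) + (vec v * a%:A - a%:A * vec v) - vec v * vec v).
    by nc_ring.
  by rewrite av subrr addr0 mulr_algl scalerA cl_vec_sqr scalerBl expr2.
by rewrite cl_bar_para [LHS]H /quadF opprB.
Qed.

Lemma para_norm'E (p : para V) :
  cl_bar (para_cl q p) * para_cl q p = (- quadF q p)%:A.
Proof.
rewrite -cl_gr_para -{2}(cl_grK (para_cl q p)) -rmorphM /= cl_gr_para para_normE.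
exact: cl_gr_scal.
Qed.

Lemma uvec_vahlen_image w : uvec w = - (Phi (mx_vec w) * rho).
Proof.
rewrite {1}[w]VU_eta uvec_decomp /mx_vec vahlen_image_mx2.
rewrite cl_gr_scal !cl_rho_scal cl_gr_bar cl_tr_para !mulr_algl.
set R := cl_rho (pcl w).
(* The grading on the second row turns the lower diagonal entry, a conjugate paravector, back into
   the paravector; both diagonal terms then have coefficient [R]. *)
have RE : R * (e * f) + R * (f * e) = R by rewrite -mulrDr ef_fe mulr1.
have Rrho : R * rho = ((para_of w).1 : F) *: rho - uvec (inclU (para_of w).2).
  rewrite /R /para_cl raddfD /= cl_rho_scal cl_rho_vec mulrDl mulr_algl.
  by rewrite -mulrA rho_sqr mulrN1.
transitivity (- (R * rho + (e_of w *: (e * rho) + f_of w *: (f * rho)) * rho)).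
  rewrite Rrho mulrDl -!scalerAl -!mulrA rho_sqr !mulrN1 !scalerN scaleNr; nc_ring.
by rewrite -mulrDl -{1}RE; congr (- (_ * _)); nc_ring.
Qed.

Lemma mx_flatE M : mx_flat M = mx_rho (mx_dag M).
Proof. by rewrite /mx_flat /mx_rho /mx_dag !mx2E !raddfN /= !opprK !cl_gr_tr. Qed.

Lemma vahlen_sandwich M w :
  Phi M * uvec w * cl_bar (Phi M) = - (Phi (M * mx_vec w * mx_flat M) * rho).
Proof.
by rewrite mx_flatE cl_bar_vahlen_image !vahlen_imageM uvec_vahlen_image mulrN mulNr -!mulrA
  rho_vahlen_image.
Qed.

(* The odd part of the Clifford algebra acts by off-diagonal blocks: [w1 * w2] has
   the diagonal blocks of [mx_vec w1 * - mx_rho (mx_vec w2)] and its conjugate. *)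
Definition rep_vec (w : VU V) : matalg (matalg C) :=
  mx2 0 (mx_vec w : matalg C) (- mx_rho (mx_vec w) : matalg C) 0.

Lemma mx_vec_linear a (w w' : VU V) :
  mx_vec (a *: w + w') = a%:A *: mx_vec w + mx_vec w'.
Proof.
have para_linear : pcl (a *: w + w') = a%:A * pcl w + pcl w'.
  case: w w' => [[[v b] x] y] [[[v' b'] x'] y'].
  rewrite mulr_algl /para_cl /= linearP scalerDr /= scalerA.
  rewrite [(- (_ + _))%R](_ : _ = a * - (b : F) + - (b' : F)); last first.
    by rewrite -[a *: b]/(a * (b : F)); ring.
  by rewrite scalerDl; nc_ring.
have scal_linear b b' : a%:A * (b%:A : C) + b'%:A = (a * b + b')%:A.
  by rewrite mulr_algl scalerA scalerDl.
rewrite /mx_vec mx2_scale mx2_add !scal_linear; congr mx2 => //.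
- by case: w w' {para_linear} => [[[v b] x] y] [[[v' b'] x'] y'].
- by case: w w' {para_linear} => [[[v b] x] y] [[[v' b'] x'] y'].
- rewrite para_linear (raddfD (@cl_bar F V q)) /= cl_barM cl_bar_scal.
  by rewrite mulr_algl mulr_algr.
Qed.

Lemma rep_vec_linear : linear rep_vec.
Proof.
move=> a w w'.
have -> : a *: rep_vec w + rep_vec w' = mx2 (a *: 0 + 0)
    (a *: (mx_vec w : matalg C) + mx_vec w')
    (a *: (- mx_rho (mx_vec w) : matalg C) - mx_rho (mx_vec w')) (a *: 0 + 0).
  apply: (etrans (congr1 (+%R^~ (rep_vec w')) (matalgZ _ _ _ _ _))).
  exact: mx2_add.
rewrite scaler0 addr0 /rep_vec mx_vec_linear; congr mx2.
rewrite -[X in X - _]/(a%:A *: - mx_rho (mx_vec w)).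
rewrite [mx_vec w]mx2_eta [mx_vec w']mx2_eta /mx_rho mx2_scale mx2_add !mx2E.
rewrite !mx2_opp mx2_scale mx2_add !opprK.
by congr mx2; rewrite rmorphD rmorphM /= cl_gr_scal; nc_ring.
Qed.
HB.instance Definition _ := GRing.isLinear.Build F (VU V) (matalg (matalg C)) _
  rep_vec rep_vec_linear.

Lemma mx_vec_norm w : mx_vec w * - mx_rho (mx_vec w) = (quadU q w)%:A *: 1 /\
  - mx_rho (mx_vec w) * mx_vec w = (quadU q w)%:A *: 1.
Proof.
have qE : quadU q w = quadF q (para_of w) + e_of w * f_of w.
  by case: w => [[[v a] x] y]; rewrite /quadF /=; ring.
rewrite qE mx2_1 /mx_rho /mx_vec !mx2E !mx2_opp !mx2_mul mx2_scale.
rewrite !cl_gr_para cl_gr_bar cl_tr_para !cl_gr_scal !opprK !mulr_algl !mulr_algr.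
rewrite !mulNr !mulrN para_normE para_norm'E !scalerN !scalerA scaler0 scaleNr.
by rewrite (scalerDl _ (quadF q _)) opprK [f_of w * _]mulrC; split; congr mx2; nc_ring.
Qed.

Lemma rep_vec_sqr w : rep_vec w * rep_vec w = (quadU q w)%:A.
Proof.
case: (mx_vec_norm w) => N1 N2.
rewrite [LHS]mx2_mul [in RHS]mx2_1 [RHS]matalgZ !(mulr0, mul0r, addr0, add0r) scaler0.
by congr mx2; [exact: N1|exact: N2].
Qed.

Definition rep : CU -> matalg (matalg C) := cl_lift rep_vec rep_vec_sqr.
HB.instance Definition _ := GRing.LRMorphism.copy rep (cl_lift rep_vec rep_vec_sqr).

Lemma rep_uvec w : rep (uvec w) = rep_vec w.
Proof. exact: cl_lift_vec. Qed.

Lemma rep_uvecE v a x y : rep (uvec (VUvec v a x y)) =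
  mx2 0 (mx2 (vec v - a%:A) x%:A y%:A (- vec v - a%:A) : matalg C)
    (mx2 (vec v + a%:A) x%:A y%:A (- vec v + a%:A) : matalg C) 0.
Proof.
rewrite rep_uvec /rep_vec /mx_rho /mx_vec !mx2E mx2_opp cl_gr_para cl_gr_bar.
rewrite cl_tr_para cl_bar_para /para_cl /= !cl_gr_scal !opprK scaleNr.
by congr mx2; congr mx2; nc_ring.
Qed.

Let simp1 := (@oppr0 C, @subr0 C, @add0r C, @addr0 C, @scale0r F C, @scale1r F C).
Let simp2 := (@mulr0 C, @mul0r C, @mulr1 C, @mul1r C, @add0r C, @addr0 C).

Lemma rep_cl_rho x : rep (cl_rho x) =
  mx2 (mx2 x 0 0 (cl_gr x) : matalg C) 0 0 (mx2 (cl_gr x) 0 0 x : matalg C).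
Proof.
elim/(@cl_elim F V q): x => [v|a|x y xE yE|x y xE yE].
- rewrite cl_rho_vec rmorphM /= !rep_uvecE [LHS]mx2_mul raddf0 !simp1 cl_gr_vec.
  rewrite !(mulr0, mul0r, addr0, add0r); congr mx2.
    by rewrite [LHS]mx2_mul !simp2.
  by rewrite [LHS]mx2_mul !simp2 mulrNN mulr1 mulrN1.
- rewrite cl_rho_scal linearZ rmorph1 cl_gr_scal [1]mx2_1 [LHS]matalgZ scaler0.
  by rewrite [1]mx2_1 !matalgZ scaler0.
- rewrite (rmorphD (@cl_rho F V q)) /= (rmorphD rep) /= xE yE [LHS]mx2_add addr0.
  by congr mx2; rewrite [LHS]mx2_add addr0 rmorphD.
- rewrite (rmorphM (@cl_rho F V q)) /= (rmorphM rep) /= xE yE [LHS]mx2_mul.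
  rewrite !(mulr0, mul0r, addr0, add0r).
  by congr mx2; rewrite [LHS]mx2_mul !(mulr0, mul0r, addr0, add0r) rmorphM.
Qed.

(** The upper block returns M itself, so [vahlen_image] is injective without any count of
    dimensions. *)
Lemma rep_vahlen_image M : rep (Phi M) = mx2 (M : matalg C) 0 0 (mx_rho M).
Proof.
rewrite [M]mx2_eta vahlen_image_mx2 /mx_rho !mx2E.
rewrite !(rmorphD rep) /= !(rmorphM rep (cl_rho _)) !(rmorphM rep (uvec _)) /=.
rewrite !rep_cl_rho !rep_uvecE raddf0 !simp1.
rewrite !cl_grK !(mx2_offdiagM (R := matalg C)) !(mx2_diagM (R := matalg C)).
rewrite !(mx2_diagD (R := matalg C)); congr mx2.
  by rewrite !(mx2_mul (R := C)) !(mx2_add (R := C)) !simp2.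
by rewrite !(mx2_mul (R := C)) !(mx2_add (R := C)) !simp2 !mulrN1.
Qed.

Lemma vahlen_image_inj : injective Phi.
Proof. by move=> M N /(congr1 rep); rewrite !rep_vahlen_image => /mx2_inj[]. Qed.

End VahlenImage.

(** * The Clifford group and its action on vectors *)

Lemma injective_linear_surj (F : fieldType) (W : vectType F) (g : {linear W -> W}) :
  injective g -> forall w, exists w', g w' = w.
Proof.
move=> g_inj w; have ker0 : lker (linfun g) == 0%VS.
  by apply/lker0P => u v; rewrite !lfunE; apply: g_inj.
by exists ((linfun g)^-1%VF w); rewrite -[RHS](lker0_lfunVK ker0) lfunE.
Qed.

Section CliffordGroup.
Context {F : fieldType} {W : vectType F} (Q : quadForm W).
Local Notation C := (clifford Q).
Local Notation vec := (cl_vec Q).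

(** For even x of norm n the inverse is [n^-1 *: cl_bar x], so the twisted conjugation of w is x w
    bar(x) divided by n. In this form no inverse occurs, and the norm stays visible. *)
Definition gamma_at (x : C) (n : F) : Prop :=
  [/\ n != 0, cl_gr x = x, x * cl_bar x = n%:A, cl_bar x * x = n%:A &
      forall w, exists w', x * vec w * cl_bar x = n *: vec w'].

Definition cl_act (x : C) (w w' : W) : Prop :=
  exists2 y, is_inverse x y & vec w' = x * vec w * cl_gr y.

Lemma is_inverse_uniq (R : nzRingType) (x y z : R) :
  is_inverse x y -> is_inverse x z -> y = z.
Proof. by move=> [xy yx] [xz zx]; rewrite -[y]mulr1 -xz mulrA yx mul1r. Qed.

Lemma norm_inverse (x : C) n : n != 0 -> x * cl_bar x = n%:A ->
  is_inverse x (n^-1 *: cl_bar x).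
Proof.
move=> n0 xn; have xn' := cl_dedekind_scal n0 xn.
by split; rewrite -?scalerAr -?scalerAl ?xn ?xn' scalerA mulVf ?scale1r.
Qed.

Lemma gamma_at_act x n w w' : gamma_at x n ->
  cl_act x w w' <-> x * vec w * cl_bar x = n *: vec w'.
Proof.
move=> [n0 gx xn xn' _]; have xI := norm_inverse n0 xn.
have gI : cl_gr (n^-1 *: cl_bar x) = n^-1 *: cl_bar x.
  by rewrite linearZ /= cl_gr_bar -{1}gx.
split=> [[y /(is_inverse_uniq xI) <- ->]|E].
  by rewrite gI -scalerAr scalerA divff // scale1r.
by exists (n^-1 *: cl_bar x); rewrite // gI -scalerAr E scalerA mulVf // scale1r.
Qed.

(** The map w |-> w' is linear and injective, as the sandwich by bar(x) and x undoes it up to n^2.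
    On a finite-dimensional space it is then onto, so the inclusion in [gamma_at] recovers the
    equality required in [Gamma]. *)
Lemma gamma_at_surj x n : gamma_at x n ->
  forall w', exists w, x * vec w * cl_bar x = n *: vec w'.
Proof.
move=> [n0 gx xn xn' /choice[g gE]].
have g_lin : linear g.
  move=> a u v; apply: (@cl_vec_inj _ _ Q); apply: (scalerI n0).
  have xP : x * vec (a *: u + v) * cl_bar x =
      a *: (x * vec u * cl_bar x) + x * vec v * cl_bar x.
    by rewrite linearP mulrDr mulrDl -scalerAr -scalerAl.
  by rewrite -gE xP !gE [vec (_ + _)]linearP scalerDr !scalerA mulrC.
pose gl : {linear W -> W} := HB.pack g (GRing.isLinear.Build F W W _ g g_lin).
have xI := norm_inverse n0 xn => w'.
have [u v guv|w gw] := @injective_linear_surj _ _ gl _ w'; last first.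
  by exists w; rewrite gE -gw.
have : x * vec u * cl_bar x = x * vec v * cl_bar x by rewrite !gE (guv : g u = g v).
move/(congr1 (fun z => cl_bar x * z * x)); rewrite -!mulrA xn' !(mulrA (cl_bar x)) xn'.
rewrite !mulr_algl !mulr_algr !scalerA => /(scalerI _); rewrite mulf_neq0 //.
by move=> /(_ isT); exact: cl_vec_inj.
Qed.

Lemma gamma_atP x : GammaPlusF x <-> exists n, gamma_at x n.
Proof.
split=> [[[y xy xW] gx [n n0 xn]]|[n [n0 gx xn xn' xW]]].
  have xn' := cl_dedekind_scal n0 xn; exists n; split=> // w.
  have yE := is_inverse_uniq (norm_inverse n0 xn) xy.
  have : @vectors _ _ Q (x * vec w * cl_gr y).
    by rewrite -xW; exists (vec w) => //; exists w.
  have gb : cl_gr (cl_bar x) = cl_bar x by rewrite cl_gr_bar -{1}gx.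
  case=> w' _ w'E; exists w'; rewrite w'E -yE linearZ /= gb.
  by rewrite -scalerAr scalerA divff // scale1r.
have gxn : gamma_at x n by split.
split=> //; last by exists n.
exists (n^-1 *: cl_bar x); first exact: norm_inverse.
apply/seteqP; split=> [z [_ [w _ <-] <-]|_ [w' _ <-]].
  have [w' w'E] := xW w; exists w' => //.
  by case: (proj2 (gamma_at_act w w' gxn) w'E) => y /(is_inverse_uniq (norm_inverse n0 xn)) <-.
have [w /(gamma_at_act w w' gxn)[y yI ->]] := gamma_at_surj gxn w'.
by exists (vec w); [exists w|rewrite (is_inverse_uniq (norm_inverse n0 xn) yI)].
Qed.

Lemma gamma_atM x y m n : gamma_at x m -> gamma_at y n -> gamma_at (x * y) (m * n).
Proof.
move=> [m0 gx xm xm' xW] [n0 gy yn yn' yW]; split.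
- by rewrite mulf_neq0.
- by rewrite rmorphM /= gx gy.
- exact: cl_norm_scalM xm yn.
- rewrite cl_barM mulrA -(mulrA (cl_bar y)) xm' mulr_algr -scalerAl yn' scalerA.
  by [].
- move=> w; have [w' w'E] := yW w; have [w'' w''E] := xW w'; exists w''.
  rewrite cl_barM -!mulrA (mulrA y) (mulrA (y * _)) w'E -scalerAl -scalerAr mulrA.
  by rewrite w''E scalerA mulrC.
Qed.

Lemma gamma_at1 : gamma_at 1 1.
Proof.
have b1 : cl_bar (1 : C) = 1 by rewrite -[1 in LHS]scale1r cl_bar_scal scale1r.
split; rewrite ?b1 ?mulr1 ?scale1r ?rmorph1 ?oner_neq0 // => w; exists w.
by rewrite mul1r mulr1 scale1r.
Qed.

Lemma gamma_atV x n : gamma_at x n -> gamma_at (n^-1 *: cl_bar x) n^-1.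
Proof.
move=> gxn; have [n0 gx xn xn' xW] := gxn.
have gb : cl_gr (cl_bar x) = cl_bar x by rewrite cl_gr_bar -{1}gx.
split=> [|||| w]; rewrite ?invr_eq0 // ?linearZ /= ?gb ?cl_barK //.
- by rewrite -scalerAl -scalerAr xn' !scalerA -mulrA mulVf // mulr1.
- by rewrite -scalerAl -scalerAr xn !scalerA -mulrA mulVf // mulr1.
- have [w' w'E] := gamma_at_surj gxn w; exists w'.
  have -> : vec w = n^-1 *: (x * vec w' * cl_bar x).
    by rewrite w'E scalerA mulVf // scale1r.
  rewrite -!scalerAr -!scalerAl -!mulrA xn' (mulrA (cl_bar x)) xn'.
  by rewrite mulr_algl mulr_algr !scalerA -!mulrA mulKf // mulVf // mulr1.
Qed.

Lemma cl_act_fun x : GammaPlusF x ->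
  forall w, exists w', forall z, cl_act x w z <-> z = w'.
Proof.
move=> /gamma_atP[n xn] w; have [n0 _ _ _ /(_ w)[w' w'E]] := xn; exists w' => z.
split=> [/(gamma_at_act w z xn)|->]; last by apply/(gamma_at_act w w' xn).
by rewrite w'E => /(scalerI n0)/cl_vec_inj.
Qed.

Lemma cl_act1 w : cl_act 1 w w.
Proof. by apply/(gamma_at_act w w gamma_at1); case: gamma_at1 => _ _; rewrite mul1r => -> _ _;
  rewrite scale1r mul1r mulr1 scale1r. Qed.

Lemma cl_actM x y w w' w'' : cl_act y w w' -> cl_act x w' w'' -> cl_act (x * y) w w''.
Proof.
move=> [y1 [yI yI'] w'E] [x1 [xI xI'] w''E]; exists (y1 * x1).
  by split; rewrite -mulrA [X in _ * X]mulrA ?yI ?xI' mul1r.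
by rewrite w''E w'E rmorphM /= !mulrA.
Qed.

Lemma cl_actV x y w w' : is_inverse x y -> cl_act x w w' -> cl_act y w' w.
Proof.
move=> xy [z /(is_inverse_uniq xy) <- w'E]; case: xy => [xy yx]; exists x => //.
have grxy : cl_gr y * cl_gr x = 1 by rewrite -rmorphM yx rmorph1.
by rewrite w'E !mulrA yx mul1r -mulrA grxy mulr1.
Qed.

Lemma cl_act_quad x w w' : cl_gr x = x -> cl_act x w w' -> Q w' = Q w.
Proof.
move=> gx [y [xy yx] w'E]; apply: (@scal_inj _ _ Q); rewrite -!cl_vec_sqr w'E.
have -> : cl_gr y = y.
  by apply: (@is_inverse_uniq _ x); split=> //; rewrite -{1}gx -rmorphM ?xy ?yx ?rmorph1.
rewrite -!mulrA (mulrA y) yx mul1r (mulrA (vec w)) cl_vec_sqr mulr_algl -scalerAr xy.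
by [].
Qed.

Lemma cl_act_radical x w : cl_gr x = x -> (exists y, is_inverse x y) ->
  radical Q w -> cl_act x w w.
Proof.
move=> gx [y xy] ow; exists y => //; case: xy => xy yx.
rewrite -{1}gx -cl_orth_comm => [|u]; last by rewrite polarC.
rewrite -mulrA [_ * cl_gr y](_ : _ = 1) ?mulr1 //.
by rewrite -{1}gx -rmorphM xy rmorph1.
Qed.
End CliffordGroup.

(** * The paravector Vahlen group and its action on vectors *)

Section VahlenGroup.
Context {F : fieldType} {V : vectType F} (q : quadForm V).
Hypothesis two_neq0 : 2 != 0 :> F.
Local Notation C := (clifford q).
Local Notation vec := (cl_vec q).
Local Notation uvec := (cl_vec (quadU q)).
Local Notation Phi := (@vahlen_image F V q).
Implicit Types (M N : 'M[C]_2) (w : VU V).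

(** [gamma_at] carried to matrices through [vahlen_image]; the scalar [n] is both the norm of the
    image and the determinant. *)
Definition vahlen_at M (n : F) : Prop :=
  [/\ n != 0, M * mx_dag M = n%:A *: 1, mx_dag M * M = n%:A *: 1 &
      forall w, exists w', M * mx_vec q w * mx_flat M = n%:A *: mx_vec q w'].

Lemma vahlen_sandwichP M n w w' :
  Phi M * uvec w * cl_bar (Phi M) = n *: uvec w' <->
  M * mx_vec q w * mx_flat M = n%:A *: mx_vec q w'.
Proof.
rewrite vahlen_sandwich // (uvec_vahlen_image q two_neq0 w') scalerN scalerAl.
rewrite -(vahlen_imageZ two_neq0); split=> [/oppr_inj E|-> //].
apply: (vahlen_image_inj two_neq0); apply: oppr_inj.
by move/(congr1 (fun x => x * uvec (VUvec 0 1 0 0))): E; rewrite -!mulrA rho_sqr !mulrN1.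
Qed.

Lemma vahlen_atP M n : vahlen_at M n <-> gamma_at (Phi M) n.
Proof.
have PhiP X Y : X * Y = n%:A *: 1 <-> Phi X * Phi Y = n%:A.
  rewrite -(vahlen_imageM two_neq0) -(vahlen_image1 q two_neq0).
  rewrite -(vahlen_imageZ two_neq0); split=> [-> //|]; exact: vahlen_image_inj.
rewrite /vahlen_at /gamma_at (cl_bar_vahlen_image two_neq0).
split=> [] [n0].
- move=> /PhiP MN /PhiP NM MW; split=> //; first exact: cl_gr_vahlen_image.
  move=> w; have [w' w'E] := MW w; exists w'.
  by rewrite -(cl_bar_vahlen_image two_neq0); apply/vahlen_sandwichP.
- move=> _ /PhiP MN /PhiP NM MW; split=> // w; have [w' w'E] := MW w; exists w'.
  by apply/vahlen_sandwichP; rewrite (cl_bar_vahlen_image two_neq0).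
Qed.

(** The opposite product comes from Dedekind finiteness of the Clifford algebra of V_{U,F}, pulled
    back along the injective [vahlen_image]. *)
Lemma vahlen_at_suff M n : n != 0 -> M * mx_dag M = n%:A *: 1 ->
  (forall w, exists w', M * mx_vec q w * mx_flat M = n%:A *: mx_vec q w') ->
  vahlen_at M n.
Proof.
move=> n0 MN MW; split=> //; apply: (vahlen_image_inj two_neq0).
rewrite (vahlen_imageM two_neq0) (vahlen_imageZ two_neq0) vahlen_image1 //.
apply: cl_dedekind_scal n0 _.
by rewrite -(vahlen_imageM two_neq0) MN (vahlen_imageZ two_neq0) vahlen_image1.
Qed.

Lemma scal_mxC a M N : M * (a%:A *: N) = (a%:A : C) *: (M * N).
Proof. by have <- := matalg_scaleAr a (M : matalg C) (N : matalg C). Qed.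

Lemma vahlen_at_inverse M n :
  vahlen_at M n -> is_inverse M ((n^-1)%:A *: mx_dag M) /\
                   vahlen_at ((n^-1)%:A *: mx_dag M) n^-1.
Proof.
move=> Mn; have [n0 MN NM _] := Mn; split; last first.
  apply/vahlen_atP; rewrite vahlen_imageZ // -cl_bar_vahlen_image //.
  exact/gamma_atV/vahlen_atP.
split; rewrite ?scal_mxC -?scalerAl ?MN ?NM scalerA mulr_algl scalerA mulVf //;
  by rewrite !scale1r.
Qed.

Lemma vahlenP M : vahlen q M <-> exists n, vahlen_at M n.
Proof.
split=> [[_ /gamma_atP[n /vahlen_atP Mn]]|[n Mn]]; first by exists n.
split; last by apply/gamma_atP; exists n; apply/vahlen_atP.
by exists ((n^-1)%:A *: mx_dag M); case: (vahlen_at_inverse Mn).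
Qed.

Lemma vahlen_at1 : vahlen_at 1 1.
Proof. by apply/vahlen_atP; rewrite vahlen_image1 //; apply: gamma_at1. Qed.

Lemma vahlen_atM M N m n : vahlen_at M m -> vahlen_at N n -> vahlen_at (M * N) (m * n).
Proof.
by move=> /vahlen_atP Mm /vahlen_atP Nn; apply/vahlen_atP; rewrite vahlen_imageM //;
  apply: gamma_atM.
Qed.

Lemma vahlen_group : unit_subgroup (vahlen q).
Proof.
split=> [|M N /vahlenP[m Mm] /vahlenP[n Nn]|M /vahlenP[n Mn]].
- by apply/vahlenP; exists 1; apply: vahlen_at1.
- by apply/vahlenP; exists (m * n); apply: vahlen_atM.
- have [MI VI] := vahlen_at_inverse Mn.
  by exists ((n^-1)%:A *: mx_dag M) => //; apply/vahlenP; exists n^-1.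
Qed.

Lemma vahlen_at_eqs M n (a := M 0 0) (b := M 0 1) (c := M 1 0) (d := M 1 1) :
  M * mx_dag M = n%:A *: 1 <->
  [/\ a * cl_tr d - b * cl_tr c = n%:A, a * cl_tr b = b * cl_tr a,
      c * cl_tr d = d * cl_tr c & d * cl_tr a - c * cl_tr b = n%:A].
Proof.
rewrite {1}[M]mx2_eta /mx_dag mx2_mul mx2_1 mx2_scale -/a -/b -/c -/d !mulrN.
rewrite !mulr1 !mulr0; split=> [/mx2_inj[E1 E2 E3 E4]|[-> -> -> E]]; last first.
  by rewrite addNr subrr addrC E.
split=> //; last by rewrite addrC.
- by apply/eqP; rewrite eq_sym -subr_eq0 addrC E2.
- by apply/eqP; rewrite -subr_eq0 E3.
Qed.

Lemma vahlen_at_det M n : vahlen_at M n -> vdet M = n%:A.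
Proof. by case=> _ /vahlen_at_eqs[]. Qed.

Lemma svahlenP M : svahlen q M <-> vahlen_at M 1.
Proof.
split=> [[/vahlenP[n Mn]]|M1].
  by rewrite (vahlen_at_det Mn) -[in RHS](scale1r 1) => /scal_inj n1; rewrite -n1.
by split; [apply/vahlenP; exists 1|rewrite (vahlen_at_det M1) scale1r].
Qed.

Lemma svahlen_group : unit_subgroup (svahlen q).
Proof.
split=> [|M N /svahlenP M1 /svahlenP N1|M /svahlenP M1].
- exact/svahlenP/vahlen_at1.
- by apply/svahlenP; rewrite -[1]mulr1; apply: vahlen_atM.
- have [MI VI] := vahlen_at_inverse M1.
  by exists ((1^-1)%:A *: mx_dag M) => //; apply/svahlenP; rewrite -{2}[1]invr1.
Qed.

Lemma vahlen_actP M n w w' : vahlen_at M n ->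
  vahlen_act q M w w' <-> M * mx_vec q w * mx_flat M = n%:A *: mx_vec q w'.
Proof.
move=> /vahlen_atP Mn; have := gamma_at_act w w' Mn; rewrite /cl_act /vahlen_act => ->.
exact: vahlen_sandwichP.
Qed.

(** The hyperbolic plane is nondegenerate, and so is the line of [rho] when 2 is nonzero. The set
    removed in [Ktilde] is thus the radical of V_{U,F} itself, on which the group acts trivially. *)
Lemma radicalU w : radical (quadU q) w <-> [set inclU v | v in radical q] w.
Proof.
split=> [|[v ov <-] [[[u a] x] y]]; last first.
  by apply: etrans (quadU_polarE q u v a x y 0 0 0) _; rewrite ov; ring.
case: w => [[[v a] x] y] ow.
have E u a' x' y' := etrans (esym (quadU_polarE q u v a' x' y' a x y)) (ow _).
have y0 : y = 0 by rewrite -(E 0 0 1 0) polar0; ring.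
have x0 : x = 0 by rewrite -(E 0 0 0 1) polar0; ring.
have a0 : a = 0.
  by apply: (mulfI two_neq0); rewrite mulr0 -(E 0 (-1) 0 0) polar0; ring.
exists v; last by rewrite a0 x0 y0.
by move=> u; rewrite -(E u 0 0 0); ring.
Qed.

Lemma vahlen_actK_action c : is_action (vahlen_act q) (vahlen q) (Ktilde q c).
Proof.
split=> [M w [_ Mg] [wc wR]|w _|M N u v w [_ Mg] [_ Ng] _].
- have [w' w'P] := cl_act_fun Mg w; exists w' => //.
  have [[y My yE] gM _] := Mg; have Mw := proj2 (w'P w') erefl.
  split; first exact: etrans (cl_act_quad gM Mw) wc.
  (* If the image w' were radical, M would fix it; the inverse of M then sends w' both to w and to
     w', so w = w' would be radical. *)
  move=> /radicalU Rw'; apply: wR; apply/radicalU.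
  have Mw' : cl_act (Phi M) w' w' by apply: cl_act_radical => //; exists y.
  have /gamma_atP := Mg; case=> n Mn.
  have yw := cl_actV My Mw; have yw' := cl_actV My Mw'.
  have [z zP] : exists z, forall z', cl_act y w' z' <-> z' = z.
    apply: cl_act_fun; apply/gamma_atP; exists n^-1.
    have [n0 _ xn _ _] := Mn.
    by rewrite (is_inverse_uniq My (norm_inverse n0 xn)); apply: gamma_atV.
  by rewrite (proj1 (zP _) yw) -(proj1 (zP _) yw').
- by rewrite /vahlen_act vahlen_image1 //; apply: cl_act1.
- by rewrite /vahlen_act vahlen_imageM // => Nuv Mvw; apply: cl_actM Nuv Mvw.
Qed.
End VahlenGroup.

(** * The half-space and its Moebius transformations *)

Section HalfSpace.
Context {F : fieldType} {V : vectType F} (q : quadForm V) (c : F).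
Hypothesis two_neq0 : 2 != 0 :> F.
Local Notation C := (clifford q).
Implicit Types (M : 'M[C]_2) (w : VU V) (p : hpoint V) (x y z u : C).
Local Notation H := (Htilde q c).
Local Notation K := (Ktilde q c).

(** The coordinate along [f] is 1 / t at an inner point and 0 at a boundary symbol, hence the case
    distinction and the inverses. *)
Definition KtoH w : hpoint V :=
  if f_of w == 0 then Boundary (para_of w) (e_of w)
  else Inner ((f_of w)^-1 *: para_of w) (f_of w)^-1.

Lemma VU_ext w w' :
  para_of w = para_of w' -> e_of w = e_of w' -> f_of w = f_of w' -> w = w'.
Proof. by move=> E1 E2 E3; rewrite (VU_eta w) (VU_eta w') E1 E2 E3. Qed.

Lemma quadU_coord w : quadU q w = quadF q (para_of w) + e_of w * f_of w.
Proof. by case: w => [[[v a] x] y]; rewrite /quadF /=; ring. Qed.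

Lemma quadF_Z a (l : para V) : quadF q (a *: l) = a ^+ 2 * quadF q l.
Proof.
by case: l => b v; rewrite /quadF /= quadZ -[a *: b]/(a * (b : F)); ring.
Qed.

Lemma para_of_inner xi t : para_of (HtoK q c (Inner xi t)) = t^-1 *: xi.
Proof.
case: xi => a v; rewrite /= -[_ *: (a, v)]/(t^-1 * (a : F), t^-1 *: v).
by congr (_, _); rewrite -[_ *: _]/(t^-1 * - (a : F)); ring.
Qed.

Lemma e_of_inner xi t :
  e_of (HtoK q c (Inner xi t)) = t^-1 * (c * t ^+ 2 - quadF q xi).
Proof. by []. Qed.

Lemma f_of_inner xi t : f_of (HtoK q c (Inner xi t)) = t^-1.
Proof. by rewrite /= -[LHS]/(t^-1 * 1) mulr1. Qed.

Lemma para_of_boundary la b : para_of (HtoK q c (Boundary la b)) = la.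
Proof. by case: la => a v; rewrite /= opprK. Qed.

Lemma HtoK_in p : H p -> K (HtoK q c p).
Proof.
case: p => [xi t|la b] [] //=.
- move=> t0; split=> [|[v _] /(congr1 f_of)]; last first.
    by move/eqP; rewrite f_of_inner eq_sym invr_eq0 (negPf t0).
  apply: etrans (quadU_coord _) _.
  by rewrite para_of_inner e_of_inner f_of_inner quadF_Z; field.
- move=> [lac rad]; split=> [|[v ov wE]].
    by apply: etrans (quadU_coord _) _; rewrite para_of_boundary mulr0 addr0.
  have laE : la = (0, v).
    have := congr1 (@para_of F V) (wE : inclU v = HtoK q c (Boundary la b)).
    by rewrite para_of_boundary /= oppr0.
  have b0 : b = 0 by have /= := congr1 e_of wE.
  (* A radical vector pairs with itself to 2 q(v), so it has value 0. A boundary symbol mapped into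
     V^perp would therefore force c = 0 and b = 0, which [Hboundary] excludes. *)
  have qv : q v = 0.
    apply: (mulfI two_neq0); rewrite mulr0 -(ov v) /polar -[v]scale1r -scalerDl.
    by rewrite !quadZ; ring.
  have c0 : c = 0 by rewrite -lac laE /quadF /= qv; ring.
  have Rla : para_radical q la by rewrite laE.
  by have := rad c0 Rla; rewrite b0 eqxx.
Qed.

Lemma KtoH_in w : K w -> H (KtoH w).
Proof.
move=> [wc rad]; rewrite /KtoH; case: eqVneq => [f0|f0]; last first.
  by left; rewrite /= invr_eq0.
right=> /=; split; first by apply/esym; apply: etrans (esym wc) _;
  apply: etrans (quadU_coord _) _; rewrite f0; ring.
move=> _ [a0 ov]; apply/eqP => e0; apply: rad; exists (para_of w).2 => //.
by rewrite [RHS]VU_eta a0 e0 f0 oppr0.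
Qed.

Lemma HtoK_K p : H p -> KtoH (HtoK q c p) = p.
Proof.
rewrite /KtoH; case: p => [xi t|la b] [] //.
  move=> t0; rewrite para_of_inner f_of_inner invr_eq0 (negPf t0) invrK.
  by rewrite scalerA divff // scale1r.
by move=> _; rewrite para_of_boundary eqxx.
Qed.

Lemma KtoH_K w : K w -> HtoK q c (KtoH w) = w.
Proof.
move=> [wc _]; rewrite /KtoH; case: eqVneq => [f0|f0]; apply: VU_ext.
- exact: para_of_boundary.
- by [].
- by rewrite f0.
- by rewrite para_of_inner invrK scalerA divff // scale1r.
- rewrite e_of_inner quadF_Z invrK -wc [quadU q w]quadU_coord; field.
  by [].
- by rewrite f_of_inner invrK.
Qed.

Lemma HtoK_bij : set_bij H K (HtoK q c).
Proof.
split=> [p|p p' /set_mem Hp /set_mem Hp' E|w Kw]; first exact: HtoK_in.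
  by rewrite -(HtoK_K Hp) E HtoK_K.
by exists (KtoH w); [exact: KtoH_in|exact: KtoH_K].
Qed.

Local Notation clcq := (@clc F V q c).
Local Notation sigma := (cl_vec (quadc q c) (VFvec 0 1)).
HB.instance Definition _ := GRing.LRMorphism.copy clcq (cl_map (inclc_isom q c)).

Lemma clc_bar x : clcq (cl_bar x) = cl_bar (clcq x).
Proof. exact: cl_map_bar. Qed.
Lemma clc_scal a : clcq a%:A = a%:A.
Proof. exact: cl_map_scal. Qed.

Lemma sigma_clc x : sigma * clcq x = clcq (cl_gr x) * sigma.
Proof.
elim/(@cl_elim F V q): x => [v|a|x y xE yE|x y xE yE].
- rewrite cl_gr_vec raddfN /= [clcq _]cl_map_vec mulNr; apply: cl_vec_anticomm.
  by apply: etrans (quadc_polarE _ _ _ _ _ _) _; rewrite polar0; ring.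
- by rewrite cl_gr_scal clc_scal mulr_algl mulr_algr.
- by rewrite !raddfD /= mulrDr xE yE -mulrDl.
- by rewrite !rmorphM /= mulrA xE -mulrA yE mulrA.
Qed.

(** A point of the half-space is itself a paravector for V_F^c, so [para_normE] gives its norm c t^2
    - q_F(xi), the numerator of the e-coordinate. *)
Lemma Hinner_clE xi t : Hinner_cl q c xi t = para_cl (quadc q c) (xi.1, VFvec xi.2 t).
Proof.
rewrite /Hinner_cl /para_cl /= rmorphD /= clc_scal [clcq (cl_vec _ _)]cl_map_vec.
rewrite -addrA -linearZ -linearD; congr (_ + cl_vec _ _).
rewrite -[RHS]/(VFvec _ _) -[LHS]/(VFvec (xi.2 + t *: 0) (0 + t * 1)).
by rewrite scaler0 addr0 add0r mulr1.
Qed.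

Lemma Hinner_cl_inj xi t xi' t' :
  Hinner_cl q c xi t = Hinner_cl q c xi' t' -> xi = xi' /\ t = t'.
Proof.
rewrite !Hinner_clE /VFvec => /para_cl_inj.
by case: xi xi' => [a v] [a' v'] /= [-> -> ->].
Qed.

Lemma para_cl_Z a (l : para V) : para_cl q (a *: l) = a *: para_cl q l.
Proof.
case: l => b v; rewrite /para_cl /= linearZ scalerDr scalerA.
by rewrite -[a *: b]/(a * (b : F)).
Qed.

Lemma para_cl_D (l l' : para V) : para_cl q (l + l') = para_cl q l + para_cl q l'.
Proof.
case: l l' => [a v] [b u]; rewrite /para_cl /= raddfD /= (scalerDl _ (a : F)).
by nc_ring.
Qed.

Lemma Hinner_cl_Z a xi t :
  Hinner_cl q c (a *: xi) (a * t) = a *: Hinner_cl q c xi t.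
Proof. by rewrite /Hinner_cl para_cl_Z linearZ scalerDr scalerA. Qed.

(* These are the entries of [M * mx_vec w * mx_flat M]; at an inner point [tau],
   [t * sesq x y z u] is also the [C]-part of [(x tau + y) * bar (z tau + u)]. *)
Definition sesq x y z u w : C :=
  let l := para_cl q (para_of w) in
  (x * l + y * (f_of w)%:A) * cl_bar u + (x * (e_of w)%:A + y * cl_bar l) * cl_bar z.

Lemma mx_act_sesq M w : M * mx_vec q w * mx_flat M =
  mx2 (sesq (M 0 0) (M 0 1) (M 1 0) (M 1 1) w) (sesq (M 0 0) (M 0 1) (M 0 0) (M 0 1) w)
      (sesq (M 1 0) (M 1 1) (M 1 0) (M 1 1) w) (sesq (M 1 0) (M 1 1) (M 0 0) (M 0 1) w).
Proof. by rewrite {1}[M]mx2_eta /mx_vec /mx_flat !mx2_mul. Qed.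

(** tau bar(tau) is scalar, which leaves a C-part with the coordinates of the vector of tau. In the
    rest, moving sigma_c to the right turns [cl_bar] into [cl_tr], and bar(sigma_c) = - sigma_c
    gives the minus sign. The sigma-part is the determinant for the two rows of M, and it cancels
    for a row against itself. *)
Lemma tau_prod x y z u xi t (tau := Hinner_cl q c xi t) : t != 0 ->
  (clcq x * tau + clcq y) * cl_bar (clcq z * tau + clcq u) =
  t *: (clcq (sesq x y z u (HtoK q c (Inner xi t)))
        + clcq (x * cl_tr u - y * cl_tr z) * sigma).
Proof.
move=> t0; have -> : sesq x y z u (HtoK q c (Inner xi t)) =
    t^-1 *: (x * para_cl q xi * cl_bar u + y * cl_bar u
             + (c * t ^+ 2 - quadF q xi) *: (x * cl_bar z)
             + y * cl_bar (para_cl q xi) * cl_bar z).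
  rewrite /sesq para_of_inner f_of_inner e_of_inner para_cl_Z !mulr_algr.
  rewrite [cl_bar (_ *: _)]linearZ /= -!scalerAr -!scalerA -!scalerDr -!scalerAl.
  by rewrite -scalerDr !mulrDl -scalerAl; congr (_ *: _); nc_ring.
have tauE : tau = clcq (para_cl q xi) + t *: sigma by [].
have bartau : cl_bar tau = clcq (cl_bar (para_cl q xi)) - t *: sigma.
  rewrite tauE (raddfD (@cl_bar _ _ (quadc q c))) /= -clc_bar.
  by rewrite [cl_bar (_ *: _)]linearZ /= cl_bar_vec scalerN.
have tautau : tau * cl_bar tau = (c * t ^+ 2 - quadF q xi)%:A.
  rewrite /tau Hinner_clE para_normE; congr (_ *: _).
  by rewrite /quadF /=; ring.
rewrite (raddfD (@cl_bar _ _ (quadc q c))) /= cl_barM -!clc_bar.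
transitivity (clcq x * (tau * cl_bar tau) * clcq (cl_bar z) + clcq y * clcq (cl_bar u)
  + (clcq x * tau * clcq (cl_bar u) + clcq y * cl_bar tau * clcq (cl_bar z))).
  by nc_ring.
rewrite tautau bartau tauE mulr_algr -scalerAl.
have sig r s : clcq r * (t *: sigma) * clcq (cl_bar s) = t *: (clcq (r * cl_tr s) * sigma).
  rewrite -scalerAr -scalerAl -mulrA sigma_clc cl_gr_bar rmorphM /= mulrA.
  by [].
transitivity ((c * t ^+ 2 - quadF q xi) *: (clcq x * clcq (cl_bar z))
  + clcq y * clcq (cl_bar u) + (clcq x * clcq (para_cl q xi) * clcq (cl_bar u)
  + clcq y * clcq (cl_bar (para_cl q xi)) * clcq (cl_bar z))
  + (clcq x * (t *: sigma) * clcq (cl_bar u) - clcq y * (t *: sigma) * clcq (cl_bar z))).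
  by nc_ring.
rewrite !sig scalerDr [clcq (t^-1 *: _)]linearZ /= [t *: (t^-1 *: _)]scalerA divff //.
rewrite scale1r.
rewrite (rmorphB clcq) /= mulrBl scalerBr; congr (_ + _).
move: (para_cl q xi) (_ - _) => l b.
rewrite !(rmorphD clcq) /= [clcq (b *: _)]linearZ /= !(rmorphM clcq) /=; nc_ring.
Qed.
End HalfSpace.

(** * Moebius transformations are the linear action in other coordinates *)

Section Mobius.
Context {F : fieldType} {V : vectType F} (q : quadForm V) (c : F).
Hypothesis two_neq0 : 2 != 0 :> F.
Local Notation C := (clifford q).
Implicit Types (M : 'M[C]_2) (w : VU V) (p : hpoint V).
Local Notation H := (Htilde q c).
Local Notation K := (Ktilde q c).
Local Notation clcq := (@clc F V q c).
Local Notation sigma := (cl_vec (quadc q c) (VFvec 0 1)).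
Local Notation mob := (mobius q c).

Lemma sesq_act M n w w' : M * mx_vec q w * mx_flat M = n%:A *: mx_vec q w' ->
  [/\ sesq (M 0 0) (M 0 1) (M 1 0) (M 1 1) w = n *: para_cl q (para_of w'),
      sesq (M 0 0) (M 0 1) (M 0 0) (M 0 1) w = (n * e_of w')%:A &
      sesq (M 1 0) (M 1 1) (M 1 0) (M 1 1) w = (n * f_of w')%:A].
Proof.
rewrite mx_act_sesq /mx_vec mx2_scale => /mx2_inj[-> -> -> _].
by rewrite !mulr_algl !scalerA.
Qed.

(** The sigma-part drops out since gamma delta^* = delta gamma^*. The norm vanishes exactly when the
    image vector has no f-coordinate, that is when it is a boundary symbol. *)
Lemma mob_den_norm M n xi t w' : vahlen_at M n -> t != 0 ->
  M * mx_vec q (HtoK q c (Inner xi t)) * mx_flat M = n%:A *: mx_vec q w' ->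
  cl_norm (mob_den c M xi t) = (t * (n * f_of w'))%:A.
Proof.
move=> [_ /vahlen_at_eqs[_ _ cdE _] _ _] t0 /sesq_act[_ _ Ef].
by rewrite [LHS]tau_prod // Ef cdE subrr raddf0 mul0r addr0 linearZ rmorph1 scalerA.
Qed.

Lemma mobius_exists M n p w' : vahlen_at M n -> H p ->
  M * mx_vec q (HtoK q c p) * mx_flat M = n%:A *: mx_vec q w' -> mob M p (KtoH w').
Proof.
move=> Mn Hp Mw'; have [Epara Ee Ef] := sesq_act Mw'.
have [n0 /vahlen_at_eqs[detE abE _ _] _ _] := Mn.
rewrite /KtoH; case: p Hp Mw' Epara Ee Ef => [xi t|la b].
- move=> [t0|//] Mw' Epara Ee Ef; have normD := mob_den_norm Mn t0 Mw'.
  have normN : cl_norm (mob_num c M xi t) = (t * (n * e_of w'))%:A.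
    by rewrite [LHS]tau_prod // Ee abE subrr raddf0 mul0r addr0 linearZ rmorph1 scalerA.
  (* The product is [t * n] times [para_of w'] + sigma_c. Dividing by the denominator norm
     [t * (n * f_of w')] gives the inner point of w', dividing by [t * n] its boundary vector. *)
  have ND : mob_num c M xi t * cl_bar (mob_den c M xi t) =
      Hinner_cl q c ((t * n) *: para_of w') (t * n).
    rewrite [LHS]tau_prod // Epara detE clc_scal mulr_algl.
    by rewrite -scalerA Hinner_cl_Z /Hinner_cl para_cl_Z.
  case: eqVneq => [f0|f0].
    have := MobInnerBoundary _ (vahlen_at_det Mn) (esym ND) normN.
    rewrite scalerA mulVf ?mulf_neq0 // scale1r mulrA [_ / _]mulrC mulKf ?mulf_neq0 //.
    by apply; rewrite normD f0 !mulr0 scale0r.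
  have nD0 : t * (n * f_of w') != 0 by rewrite !mulf_neq0.
  apply: (MobInnerInner normD nD0 (norm_inverse nD0 normD)).
  rewrite -scalerAr ND -Hinner_cl_Z scalerA; congr Hinner_cl; last by field; rewrite f0 t0 n0.
  by congr (_ *: _); field; rewrite f0 t0 n0.
- move=> _; set w := HtoK q c (Boundary la b) => _ Epara Ee Ef.
  have bnormE (x y : C) : mob_bnorm x y la b = sesq x y x y w.
    rewrite /mob_bnorm /sesq para_of_boundary scale0r mulr0 addr0 /= mulr_algr mulrDl.
    by rewrite -scalerAl /cl_norm; nc_ring.
  have bnumE : mob_bnum c M la b = Hinner_cl q c (n *: para_of w') n.
    rewrite /mob_bnum (vahlen_at_det Mn) clc_scal mulr_algl /Hinner_cl para_cl_Z -Epara.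
    congr (clc _ _ + _); rewrite /sesq para_of_boundary scale0r mulr0 addr0 /= mulr_algr.
    by rewrite mulrDl -scalerAl; nc_ring.
  case: eqVneq => [f0|f0].
    have := MobBoundaryBoundary _ (vahlen_at_det Mn) (esym bnumE).
    move=> /(_ (n * e_of w')); rewrite !bnormE Ee Ef f0 mulr0 scale0r => /(_ erefl erefl).
    by rewrite scalerA mulVf // scale1r mulrC mulKf.
  have nf0 : n * f_of w' != 0 by rewrite mulf_neq0.
  have := MobBoundaryInner (etrans (bnormE _ _) Ef) nf0 (esym bnumE).
  by rewrite scalerA (_ : (n * f_of w')^-1 * n = (f_of w')^-1) //; field; rewrite f0 n0.
Qed.

Lemma mobius_fun M p z1 z2 : mob M p z1 -> mob M p z2 -> z1 = z2.
Proof.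
have scal_neq0 (W : vectType F) (Q : quadForm W) (n : F) (x : clifford Q) :
    x = n%:A -> n != 0 -> x <> 0.
  by move=> -> n0; apply/eqP; rewrite scaler_eq0 oner_eq0 orbF.
case=> [xi t n y xi' t' nE n0 yI zE|xi t d m xi' s dE detE zE mE
  |la b n xi' s nE n0 zE|la b d m xi' s dE detE zE mE].
- move Ep: (Inner xi t) => p' Mz2.
  case: Mz2 Ep => [xi2 t2 n2 y2 xi2' t2' nE2 n02 yI2 zE2
    |xi2 t2 d2 m2 xi2' s2 dE2 detE2 zE2 mE2|//|//] [? ?]; subst.
    move: zE; rewrite (is_inverse_uniq yI yI2) -zE2 => /Hinner_cl_inj[-> ->] //.
  by case: (scal_neq0 _ _ _ _ nE n0).
- move Ep: (Inner xi t) => p' Mz2.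
  case: Mz2 Ep => [xi2 t2 n2 y2 xi2' t2' nE2 n02 yI2 zE2
    |xi2 t2 d2 m2 xi2' s2 dE2 detE2 zE2 mE2|//|//] [? ?]; subst.
    by case: (scal_neq0 _ _ _ _ nE2 n02).
  move: zE detE mE; rewrite -zE2 detE2 mE2 => /Hinner_cl_inj[-> _].
  by move=> /scal_inj-> /scal_inj->.
- move Ep: (Boundary la b) => p' Mz2.
  case: Mz2 Ep => [//|//|la2 b2 n2 xi2' s2 nE2 n02 zE2
    |la2 b2 d2 m2 xi2' s2 dE2 detE2 zE2 mE2] [? ?]; subst.
    by move: zE nE; rewrite -zE2 nE2 => /Hinner_cl_inj[-> ->] /scal_inj->.
  by case: (scal_neq0 _ _ _ _ nE n0).
- move Ep: (Boundary la b) => p' Mz2.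
  case: Mz2 Ep => [//|//|la2 b2 n2 xi2' s2 nE2 n02 zE2
    |la2 b2 d2 m2 xi2' s2 dE2 detE2 zE2 mE2] [? ?]; subst.
    by case: (scal_neq0 _ _ _ _ nE2 n02).
  move: zE detE mE; rewrite -zE2 detE2 mE2 => /Hinner_cl_inj[-> _].
  by move=> /scal_inj-> /scal_inj->.
Qed.

(** Both relations have exactly one image at p, and [mobius_exists] shows that these images
    correspond. *)
Lemma mobius_act M p p' : vahlen q M -> H p ->
  mob M p p' <-> H p' /\ vahlen_act q M (HtoK q c p) (HtoK q c p').
Proof.
move=> MG Hp; have [n Mn] := proj1 (vahlenP two_neq0 M) MG.
have [MK _ _] := vahlen_actK_action q two_neq0 c.
have [w' Kw' w'P] := MK _ _ MG (HtoK_in two_neq0 Hp).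
have Mw' := proj2 (w'P w') erefl.
have Mp : mob M p (KtoH w').
  exact: mobius_exists Mn Hp (proj1 (vahlen_actP two_neq0 _ _ Mn) Mw').
split=> [/(mobius_fun Mp) <-|[Hp' /w'P p'E]].
  by rewrite KtoH_K //; split=> //; apply: KtoH_in.
by rewrite -(HtoK_K Hp') p'E.
Qed.

Lemma mobius_action : is_action mob (vahlen q) H.
Proof.
have [MK K1 KM] := vahlen_actK_action q two_neq0 c.
have [G1 GM _] := vahlen_group q two_neq0.
split=> [M p MG Hp|p Hp|M N p p' p'' MG NG Hp].
- have [w' Kw' w'P] := MK _ _ MG (HtoK_in two_neq0 Hp).
  exists (KtoH w') => [|z]; first exact: KtoH_in.
  rewrite mobius_act //; split=> [[Hz /w'P zE]|->].
    by rewrite -zE HtoK_K.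
  by split; [exact: KtoH_in|rewrite KtoH_K //; apply/w'P].
- by apply/mobius_act => //; split=> //; apply/K1/HtoK_in.
- move=> /(mobius_act _ NG Hp)[Hp' E] /(mobius_act _ MG Hp')[Hp'' E'].
  apply: (proj2 (mobius_act _ (GM _ _ MG NG) Hp)); split=> //.
  exact: KM MG NG (HtoK_in two_neq0 Hp) E E'.
Qed.
End Mobius.

(** * The stabilizer of sigma *)

Section Stabilizer.
Context {F : fieldType} {V : vectType F} (q : quadForm V) (c : F).
Hypothesis two_neq0 : 2 != 0 :> F.
Local Notation C := (clifford q).
Implicit Types (M N : 'M[C]_2) (w : VU V) (x y z u : C).
Local Notation pcl := (para_cl q).
Local Notation is_para := (range pcl).
Local Notation is_scal := (@scalars F V q).

Lemma scalsD x y : is_scal x -> is_scal y -> is_scal (x + y).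
Proof. by move=> [a _ <-] [b _ <-]; exists (a + b); rewrite ?scalerDl. Qed.

Lemma scalsZ a x : is_scal x -> is_scal (a *: x).
Proof. by move=> [b _ <-]; exists (a * b); rewrite ?scalerA. Qed.

Lemma scals1 : is_scal 1.
Proof. by exists 1; rewrite ?scale1r. Qed.

Lemma scals_gr x : is_scal x -> cl_gr x = x.
Proof. by move=> [b _ <-]; rewrite cl_gr_scal. Qed.

Lemma parasD x y : is_para x -> is_para y -> is_para (x + y).
Proof.
by move=> [l _ <-] [l' _ <-]; exists (l + l') => //; rewrite para_cl_D.
Qed.

Lemma parasZ a x : is_para x -> is_para (a *: x).
Proof. by move=> [l _ <-]; exists (a *: l) => //; rewrite para_cl_Z. Qed.

Lemma paras_gr x : is_para x -> is_para (cl_gr x).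
Proof.
move=> [[a v] _ <-]; exists (a : F, - v) => //.
by rewrite cl_gr_para cl_bar_para /para_cl raddfN.
Qed.

Lemma paras_grE x : is_para x -> cl_gr x = cl_bar x.
Proof. by move=> [l _ <-]; rewrite cl_gr_para. Qed.

Lemma paras_trE x : is_para x -> cl_tr x = x.
Proof. by move=> [l _ <-]; rewrite cl_tr_para. Qed.

Lemma paras_norm x : is_para x -> is_scal (x * cl_bar x).
Proof. by move=> [l _ <-]; exists (- quadF q l); rewrite ?para_normE. Qed.

Lemma paras_polar x y : is_para x -> is_para y -> is_scal (x * cl_bar y + y * cl_bar x).
Proof.
move=> px py; rewrite (_ : _ + _ = (x + y) * cl_bar (x + y)
  + -1 *: (x * cl_bar x) + -1 *: (y * cl_bar y)).
  apply: scalsD; last exact/scalsZ/paras_norm.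
  by apply: scalsD; [exact/paras_norm/parasD|exact/scalsZ/paras_norm].
by rewrite (raddfD (@cl_bar F V q)) /= !scaleN1r; nc_ring.
Qed.

Lemma VU_of p e f : exists w, [/\ para_of w = p, e_of w = e & f_of w = f].
Proof. by case: p => a v; exists (VUvec v (- (a : F)) e f); rewrite /= opprK. Qed.

Lemma sesq_bar x y z u w : cl_bar (sesq x y z u w) = sesq z u x y w.
Proof.
have scal_bar a : cl_bar (a%:A : C) = a%:A by apply: cl_bar_scal.
rewrite /sesq; move: (pcl _) (scal_bar (e_of w)) (scal_bar (f_of w)) => l.
move: ((e_of w)%:A) ((f_of w)%:A) => E G barE barG.
rewrite !(raddfD (@cl_bar F V q)) /= !cl_barM !(raddfD (@cl_bar F V q)) /= !cl_barM.
by rewrite barE barG !cl_barK; nc_ring.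
Qed.

Lemma sesqE x y z u w (l := pcl (para_of w)) :
  sesq x y z u w = x * l * cl_bar u + y * cl_bar l * cl_bar z
    + (f_of w *: (y * cl_bar u) + e_of w *: (x * cl_bar z)).
Proof.
by rewrite /sesq -/l !mulr_algr !mulrDl -!scalerAl; nc_ring.
Qed.

Lemma pcl0 : pcl 0 = 0.
Proof. by rewrite -[0 in LHS](scale0r 0) para_cl_Z scale0r. Qed.

(* One of the two entries is invertible, say [N(de) = m]; then
   [m *: ga = eta * cl_gr de] for the paravector [eta = ga * cl_tr de]. *)
Lemma Ttilde_polar (ga de l : C) : Ttilde ga -> Ttilde de -> is_para (ga * cl_tr de) ->
  cl_norm ga != 0 \/ cl_norm de != 0 -> is_para l ->
  is_scal (ga * l * cl_bar de + de * cl_bar l * cl_bar ga).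
Proof.
have main x y k : Ttilde x -> Ttilde y -> is_para (x * cl_tr y) -> cl_norm y != 0 ->
    is_para k -> is_scal (x * k * cl_bar y + y * cl_bar k * cl_bar x).
  move=> [_ _] [yP [m _ my]] xy y0 pk; set eta := x * cl_tr y in xy.
  have m0 : m != 0 by move: y0; rewrite -my scaler_eq0 oner_eq0 orbF.
  have ym := cl_dedekind_scal m0 (esym my).
  have yg : cl_tr y * cl_gr y = m%:A by rewrite -cl_gr_bar -rmorphM ym /= cl_gr_scal.
  have mx : m *: x = eta * cl_gr y by rewrite -mulrA yg mulr_algr.
  have mxb : m *: cl_bar x = cl_tr y * cl_bar eta.
    by rewrite -linearZ /= mx cl_barM cl_bar_gr.
  have pz : is_para (y * cl_gr k * cl_tr y).
    by apply: yP; exists (cl_gr k) => //; apply: paras_gr.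
  have := scalsZ m^-1 (paras_polar xy pz); congr is_scal.
  apply: (scalerI m0); rewrite scalerA divff // scale1r.
  transitivity (m *: x * k * cl_bar y + y * cl_bar k * (m *: cl_bar x)); last first.
    by rewrite -!scalerAl -scalerAr -scalerDr.
  have bz : cl_bar (y * cl_gr k * cl_tr y) = cl_gr y * k * cl_bar y.
    by rewrite !cl_barM cl_bar_tr cl_bar_gr (paras_trE pk) mulrA.
  by rewrite mx mxb bz (paras_grE pk); nc_ring.
move=> Tga Tde gd [ga0|de0] pl; last exact: main.
(* The expression is symmetric under exchanging [ga] with [de] and [l] with its conjugate, so the
   case of invertible [ga] reduces to [main]. *)
have -> : ga * l * cl_bar de + de * cl_bar l * cl_bar ga =
    de * cl_bar l * cl_bar ga + ga * cl_bar (cl_bar l) * cl_bar de.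
  by rewrite cl_barK addrC.
apply: main => //; last by rewrite -paras_grE //; apply: paras_gr.
by rewrite -[de]cl_trK -cl_trM paras_trE.
Qed.

(** The remaining diagonal entry of the sandwich is the conjugate of the first by [sesq_bar], as the
    shape of [mx_vec] demands. *)
Lemma vahlen_at_of_sesq M n (al := M 0 0) (be := M 0 1) (ga := M 1 0) (de := M 1 1) :
  n != 0 -> M * mx_dag M = n%:A *: 1 ->
  (forall w, is_para (sesq al be ga de w)) ->
  (forall w, is_scal (sesq al be al be w)) ->
  (forall w, is_scal (sesq ga de ga de w)) -> vahlen_at M n.
Proof.
move=> n0 MM Mp Me Mf; apply: vahlen_at_suff => // w.
have [p _ pE] := Mp w; have [e _ eE] := Me w; have [f _ fE] := Mf w.
have [w' [pw' ew' fw']] := VU_of (n^-1 *: p) (n^-1 * e) (n^-1 * f).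
have nK (x : C) : n%:A * (n^-1 *: x) = x by rewrite mulr_algl scalerA divff ?scale1r.
exists w'; rewrite mx_act_sesq -/al -/be -/ga -/de /mx_vec mx2_scale.
rewrite pw' ew' fw' para_cl_Z -!scalerA pE eE fE !nK; congr mx2.
by rewrite -sesq_bar -[X in cl_bar X]nK -pE cl_barM cl_bar_scal mulr_algl mulr_algr.
Qed.

Lemma HtoK_sigma : let w := HtoK q c sigma_pt in
  [/\ para_of w = 0, e_of w = c & f_of w = 1].
Proof.
rewrite /sigma_pt para_of_inner e_of_inner f_of_inner scaler0 invr1.
by rewrite /quadF /= quad0; split=> //; ring.
Qed.

(** With alpha = delta' and beta = - c gamma', the entries of the sandwich split, up to the grading,
    into de l de^*, ga l ga^*, the polar term of [Ttilde_polar], norms, and multiples of gamma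
    delta^*. The displayed conditions control each of these; the nonzero sum of norms makes one of
    gamma, delta invertible and is the determinant. *)
Lemma stab_sigma_vahlen M : stab_sigma q c M ->
  exists2 n, vahlen_at M n &
    M * mx_vec q (HtoK q c sigma_pt) * mx_flat M = n%:A *: mx_vec q (HtoK q c sigma_pt).
Proof.
case=> [[alE beE] [Tga Tde] gd normD0].
set ga := M 1 0 in alE beE Tga Tde gd normD0; set de := M 1 1 in alE beE Tga Tde gd normD0.
have [_ [k _ kE]] := Tga; have [_ [m _ mE]] := Tde.
have [gaP _] := Tga; have [deP _] := Tde.
pose n := m + c * k.
have nE : cl_norm de + c *: cl_norm ga = n%:A by rewrite -kE -mE scalerA -scalerDl.
have n0 : n != 0 by move: normD0; rewrite nE scaler_eq0 oner_eq0 orbF.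
have dg : de * cl_tr ga = ga * cl_tr de.
  by rewrite -[de]cl_trK -cl_trM (paras_trE gd) cl_trK.
have norm_or : cl_norm ga != 0 \/ cl_norm de != 0.
  have [g0|] := eqVneq (cl_norm ga) 0; [right|by left].
  by move: normD0; rewrite g0 scaler0 addr0.
have gg : cl_gr ga * cl_tr ga = k%:A.
  by rewrite -cl_gr_bar -rmorphM -[ga * _]/(cl_norm ga) -kE /= cl_gr_scal.
have dd : cl_gr de * cl_tr de = m%:A.
  by rewrite -cl_gr_bar -rmorphM -[de * _]/(cl_norm de) -mE /= cl_gr_scal.
have gd' : cl_gr ga * cl_bar de = cl_gr (ga * cl_tr de) by rewrite rmorphM /= cl_gr_tr.
have dg' : cl_gr de * cl_bar ga = cl_gr (ga * cl_tr de).
  by rewrite -dg rmorphM /= cl_gr_tr.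
have trbe : cl_tr (M 0 1) = - (c *: cl_bar ga).
  by rewrite beE linearN linearZ.
have barbe : cl_bar (M 0 1) = - (c *: cl_tr ga).
  by rewrite beE linearN linearZ /= cl_bar_gr.
have baral : cl_bar (M 0 0) = cl_tr de by rewrite alE cl_bar_gr.
have tral : cl_tr (M 0 0) = cl_bar de by rewrite alE.
have MM : M * mx_dag M = n%:A *: 1.
  apply/vahlen_at_eqs; rewrite -/ga -/de trbe tral alE beE; split.
  - by rewrite mulNr opprK -scalerAl dd gg scalerA -scalerDl.
  - by rewrite mulrN mulNr -scalerAr -scalerAl dg' gd'.
  - by [].
  - by rewrite mulrN opprK -scalerAr -nE.
have beE' : M 0 1 = - c *: cl_gr ga by rewrite beE scaleNr.
have barbe' : cl_bar (M 0 1) = - c *: cl_tr ga by rewrite barbe scaleNr.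
have pgd := paras_gr gd.
exists n.
  apply: vahlen_at_of_sesq => // w; rewrite -/ga -/de sesqE;
    set l := pcl (para_of w); have pl : is_para l by exists (para_of w).
  - rewrite alE beE' -!scalerAl gd' dg'; apply: parasD; last first.
      by apply: parasD; do ?apply: parasZ.
    apply: parasD; last apply: parasZ.
      rewrite (_ : _ * _ * _ = cl_gr (de * cl_gr l * cl_tr de)); last first.
        by rewrite !rmorphM /= cl_grK cl_gr_tr.
      by apply/paras_gr/deP; exists (cl_gr l) => //; apply: paras_gr.
    rewrite (_ : _ * _ * _ = cl_gr (ga * l * cl_tr ga)); last first.
      by rewrite !rmorphM /= (paras_grE pl) cl_gr_tr.
    by apply/paras_gr/gaP; exists l.
  - rewrite baral barbe' alE beE' -!scalerAl -!scalerAr gg dd.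
    apply: scalsD; last by apply: scalsD; do !apply: scalsZ; apply: scals1.
    rewrite -scalerDr; apply: scalsZ.
    rewrite (_ : _ + _ = cl_gr (ga * l * cl_bar de + de * cl_bar l * cl_bar ga)).
      by rewrite scals_gr; apply: Ttilde_polar.
    rewrite rmorphD !rmorphM /= !cl_gr_bar (paras_grE pl) (paras_trE pl).
    by rewrite addrC.
  - apply: scalsD; first exact: Ttilde_polar.
    by apply: scalsD; apply: scalsZ; [exists m|exists k].
have [w0 we wf] := HtoK_sigma.
rewrite mx_act_sesq -/ga -/de /mx_vec mx2_scale !sesqE.
rewrite w0 we wf pcl0 raddf0 !mulr0 !mul0r !addr0 !add0r !scale1r.
rewrite baral barbe' alE beE' -!scalerAl -!scalerAr gg dd gd' dg' -scalerDl addNr.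
rewrite dg -scalerDl addNr !scale0r !mulr1 -nE; congr mx2.
rewrite !scalerA -!scalerDl; congr (_ *: _); rewrite /n; ring.
Qed.

Lemma mx_rhoM M N : mx_rho (M * N) = mx_rho M * mx_rho N.
Proof.
rewrite [M]mx2_eta [N]mx2_eta mx2_mul /mx_rho !mx2E mx2_mul.
by congr mx2; rewrite rmorphD !rmorphM /=; nc_ring.
Qed.

Lemma mx_rhoK M : mx_rho (mx_rho M) = M.
Proof. by rewrite /mx_rho !mx2E !raddfN /= !opprK !cl_grK -mx2_eta. Qed.

Lemma mx_rhoZ a M : mx_rho (a%:A *: M) = a%:A *: mx_rho M.
Proof.
rewrite /mx_rho !mxE mx2_scale; congr mx2; rewrite ?mulrN rmorphM /= cl_gr_scal //.
Qed.

Lemma scal_mxI a M N : a != 0 -> (a%:A : C) *: M = a%:A *: N -> M = N.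
Proof.
move=> a0 /(congr1 (fun X => (a^-1)%:A *: X)).
by rewrite !scalerA mulr_algl scalerA mulVf // !scale1r.
Qed.

(** Inserting bar(eta) eta = n between two vectors gives n (eta w1 w2 bar(eta)) = (eta w1 bar(eta))
    (eta w2 bar(eta)). Up to sign, [mx_vec w1 * mx_rho (mx_vec w2)] is the matrix of w1 w2. *)
Lemma vahlen_at_even M n w1 w2 : vahlen_at M n -> exists w1' w2',
  M * (mx_vec q w1 * mx_rho (mx_vec q w2)) * mx_dag M =
  n%:A *: (mx_vec q w1' * mx_rho (mx_vec q w2')).
Proof.
move=> [n0 MD DM Mw]; have [w1' E1] := Mw w1; have [w2' E2] := Mw w2.
exists w1', w2'; apply: (scal_mxI n0).
have rho2 : mx_rho M * mx_rho (mx_vec q w2) * mx_dag M = n%:A *: mx_rho (mx_vec q w2').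
  by rewrite -mx_rhoZ -E2 !mx_rhoM mx_flatE mx_rhoK.
have rhoD : mx_flat M * mx_rho M = n%:A *: 1.
  rewrite mx_flatE -mx_rhoM DM mx_rhoZ; congr (_ *: _).
  by rewrite mx2_1 /mx_rho !mx2E rmorph1 raddf0 oppr0.
rewrite [RHS](_ : _ = (n%:A *: mx_vec q w1') * (n%:A *: mx_rho (mx_vec q w2'))).
  rewrite -E1 -rho2 -!mulrA [mx_flat M * _]mulrA rhoD -scalerAl mul1r !scal_mxC.
  by [].
by rewrite scal_mxC -scalerAl.
Qed.
Lemma parasN x : is_para x -> is_para (- x).
Proof. by rewrite -scaleN1r; apply: parasZ. Qed.

(* The (2,1) entry of the image of a product of two vectors is a paravector; for the
   products with matrices [l E_12] and [l E_21] it is [- ga l ga^*] and [de l de^*]. *)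
Lemma paras_tr_act M n (ga := M 1 0) (de := M 1 1) l : vahlen_at M n -> is_para l ->
  is_para (ga * l * cl_tr ga) /\ is_para (de * l * cl_tr de).
Proof.
move=> Mn pl.
have prodE w1 w2 : is_para ((n%:A *: (mx_vec q w1 * mx_rho (mx_vec q w2))) 1 0).
  rewrite /mx_rho /mx_vec !mx2E mx2_mul mx2_scale mx2E cl_gr_scal mulr_algl.
  apply/parasZ; rewrite mulr_algl mulrN mulr_algr -scalerN; apply: parasD.
    by apply/parasZ/paras_gr; exists (para_of w2).
  apply/parasZ/parasN; rewrite -paras_grE; last by exists (para_of w1).
  by apply: paras_gr; exists (para_of w1).
have [p _ pE] := pl.
split.
- have [w1 [p1 e1 f1]] := VU_of 0 1 0; have [w2 [p2 e2 f2]] := VU_of p 0 0.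
  have [w1' [w2' E]] := vahlen_at_even w1 w2 Mn.
  have := prodE w1' w2'; rewrite -E /mx_vec /mx_rho !mx2E p1 p2 e1 e2 f1 f2 pcl0 pE.
  rewrite raddf0 scale0r scale1r raddf0 oppr0 cl_gr_bar (paras_trE pl) mx2_mul.
  rewrite !(mul0r, mulr0, addr0, add0r, mul1r) {1}[M]mx2_eta /mx_dag !mx2_mul mx2E.
  rewrite !(mul0r, mulr0, addr0, add0r) -/ga mulrN => /parasN; rewrite opprK.
  by [].
- have [p' _ pE'] := paras_gr pl.
  have [w1 [p1 e1 f1]] := VU_of 0 0 1; have [w2 [p2 e2 f2]] := VU_of p' 0 0.
  have [w1' [w2' E]] := vahlen_at_even w1 w2 Mn.
  have := prodE w1' w2'; rewrite -E /mx_vec /mx_rho !mx2E p1 p2 e1 e2 f1 f2 pcl0 pE'.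
  rewrite raddf0 scale0r scale1r raddf0 oppr0 cl_grK mx2_mul.
  rewrite !(mul0r, mulr0, addr0, add0r, mul1r) {1}[M]mx2_eta /mx_dag !mx2_mul mx2E.
  by rewrite !(mul0r, mulr0, addr0, add0r) -/de.
Qed.

Lemma vahlen_at_Ttilde M n : vahlen_at M n ->
  [/\ Ttilde (M 1 0), Ttilde (M 1 1) & is_para (M 0 0 * cl_bar (M 1 0))].
Proof.
move=> Mn; have [n0 _ _ Mw] := Mn.
have act_sesq w : is_para (sesq (M 0 0) (M 0 1) (M 1 0) (M 1 1) w) /\
    is_scal (sesq (M 1 0) (M 1 1) (M 1 0) (M 1 1) w).
  have [w' /sesq_act[-> _ ->]] := Mw w; split; last by exists (n * f_of w').
  by apply: parasZ; exists (para_of w').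
(* The isotropic vectors e and f serve as probes: e isolates N(gamma) and alpha bar(gamma), and f
   isolates N(delta). *)
have [we [pe ee fe]] := VU_of 0 1 0; have [wf [pf ef ff]] := VU_of 0 0 1.
have norm1 : is_scal (cl_norm (M 1 0)).
  have [_] := act_sesq we; rewrite sesqE pe ee fe pcl0 raddf0 !mulr0 !mul0r !add0r.
  by rewrite scale0r scale1r add0r.
have norm2 : is_scal (cl_norm (M 1 1)).
  have [_] := act_sesq wf; rewrite sesqE pf ef ff pcl0 raddf0 !mulr0 !mul0r !add0r.
  by rewrite scale0r scale1r addr0.
split.
- split=> // _ [_ [p _ <-] <-].
  by case: (paras_tr_act (l := pcl p) Mn) => //; exists p.
- split=> // _ [_ [p _ <-] <-].
  by case: (paras_tr_act (l := pcl p) Mn) => //; exists p.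
have [] := act_sesq we; rewrite sesqE pe ee fe pcl0 raddf0 !mulr0 !mul0r !add0r.
by rewrite scale0r scale1r add0r.
Qed.

Lemma stab_sigmaP M : stab_sigma q c M <-> vahlen q M /\ mobius q c M sigma_pt sigma_pt.
Proof.
have Hs : Htilde q c sigma_pt by left; rewrite /= oner_neq0.
split=> [/stab_sigma_vahlen[n Mn E]|[MG]].
  have MG : vahlen q M by apply/(vahlenP two_neq0); exists n.
  by split=> //; apply/mobius_act => //; split=> //; apply/(vahlen_actP two_neq0 _ _ Mn).
have [n Mn] := proj1 (vahlenP two_neq0 M) MG.
have [n0 /vahlen_at_eqs[_ _ cdE _] DM _] := Mn.
move=> /(mobius_act two_neq0 _ MG Hs)[_ /(vahlen_actP two_neq0 _ _ Mn) E].
have [w0 we wf] := HtoK_sigma.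
have [Tga Tde gd] := vahlen_at_Ttilde Mn.
have /sesq_act[_ _] := E; rewrite sesqE w0 we wf pcl0 raddf0 !mulr0 !mul0r !add0r.
rewrite scale1r mulr1 -!/(cl_norm _) => nE.
have : mx_vec q (HtoK q c sigma_pt) * mx_flat M = mx_dag M * mx_vec q (HtoK q c sigma_pt).
  apply: (scal_mxI n0); rewrite -[RHS]scal_mxC -E -!mulrA (mulrA (mx_dag M)) DM.
  by rewrite -scalerAl mul1r.
rewrite /mx_vec w0 we wf pcl0 raddf0 /mx_flat /mx_dag !mx2_mul !mul0r !mulr0.
rewrite !add0r !addr0 scale1r !mul1r !mulr1 mulr_algl.
case/mx2_inj=> beE _ alE' _.
have alE : M 0 0 = cl_gr (M 1 1) by rewrite -[LHS]cl_trK -alE' cl_tr_bar.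
split=> //; last first.
- by rewrite nE scaler_eq0 oner_eq0 orbF.
(* gamma delta^* = delta gamma^* is the grading image of alpha bar(gamma), already known to be a
   paravector. *)
- rewrite cdE -[M 1 1]cl_grK -alE -[cl_tr _]cl_grK cl_gr_tr -rmorphM.
  exact: paras_gr.
split=> //.
by apply: oppr_inj; rewrite -[- M 0 1]cl_trK linearN /= -beE opprK linearZ /= cl_tr_bar.
Qed.
End Stabilizer.

(** * Transitivity and orbits *)

Section Transitivity.
Context {F : fieldType} {V : vectType F} (q : quadForm V) (c : F).
Hypothesis two_neq0 : 2 != 0 :> F.
Local Notation C := (clifford q).
Implicit Types (M N : 'M[C]_2) (w u v : VU V) (P : set 'M[C]_2).
Local Notation pcl := (para_cl q).
Local Notation K := (Ktilde q c).
Local Notation H := (Htilde q c).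

(** Orbits are computed on vectors, where the action has no cases, and returned to the half-space by
    [orbit_krel]. *)
Definition krel P w w' : Prop := exists2 M, P M & vahlen_act q M w w'.

Section Krel.
Variable P : set 'M[C]_2.
Hypotheses (P_group : unit_subgroup P) (PG : P `<=` vahlen q).

Lemma krel_refl w : krel P w w.
Proof.
have [P1 _ _] := P_group; exists 1 => //.
by rewrite /vahlen_act vahlen_image1 //; apply: cl_act1.
Qed.

Lemma krel_trans w w' w'' : krel P w w' -> krel P w' w'' -> krel P w w''.
Proof.
have [_ PM _] := P_group => -[M PMm Mw] [N PN Nw']; exists (N * M); first exact: PM.
by rewrite /vahlen_act vahlen_imageM //; apply: cl_actM Mw Nw'.
Qed.

Lemma krel_sym w w' : krel P w w' -> krel P w' w.
Proof.
have [_ _ PV] := P_group => -[M /PV[N PN [MN NM]] Mw]; exists N => //.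
apply: cl_actV Mw; split; rewrite -vahlen_imageM // ?MN ?NM; exact: vahlen_image1.
Qed.

Lemma krel_K w w' : K w -> krel P w w' -> K w'.
Proof.
move=> Kw [M /PG MG Mw]; have [MK _ _] := vahlen_actK_action q two_neq0 c.
by have [w'' Kw'' /(_ w')[/(_ Mw) ->]] := MK _ _ MG Kw.
Qed.

Lemma orbit_krel p p' : H p ->
  orbit_of (mobius q c) P p p' <-> H p' /\ krel P (HtoK q c p) (HtoK q c p').
Proof.
move=> Hp; split=> [[M PM /(mobius_act two_neq0 _ (PG PM) Hp)[Hp' Mp]]|].
  by split=> //; exists M.
by case=> Hp' [M PM Mp]; exists M => //; apply/mobius_act => //; apply: PG.
Qed.
End Krel.

Lemma svahlen_sub : svahlen q `<=` vahlen q.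
Proof. by move=> M []. Qed.

Local Notation srel := (krel (svahlen q)).
Local Notation grel := (krel (vahlen q)).
Let SG := svahlen_group q two_neq0.
Let GG := vahlen_group q two_neq0.

Lemma srel_grel w w' : srel w w' -> grel w w'.
Proof. by move=> [M /svahlen_sub MG Mw]; exists M. Qed.

Lemma vahlen_act_of_sesq M n w w' (al := M 0 0) (be := M 0 1) (ga := M 1 0) (de := M 1 1) :
  vahlen_at M n -> sesq al be ga de w = n *: pcl (para_of w') ->
  sesq al be al be w = (n * e_of w')%:A -> sesq ga de ga de w = (n * f_of w')%:A ->
  vahlen_act q M w w'.
Proof.
move=> Mn Ep Ee Ef; apply/(vahlen_actP two_neq0 _ _ Mn).
rewrite mx_act_sesq -[sesq (M 1 0) (M 1 1) (M 0 0) _ w]sesq_bar -/al -/be -/ga -/de.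
by rewrite Ep Ee Ef /mx_vec mx2_scale linearZ /= !mulr_algl !scalerA.
Qed.

Let bar1 : cl_bar (1 : C) = 1.
Proof. by rewrite -[1 in LHS]scale1r cl_bar_scal scale1r. Qed.
Let bar0 : cl_bar (0 : C) = 0.
Proof. exact: raddf0. Qed.
Let tr0 : cl_tr (0 : C) = 0.
Proof. exact: raddf0. Qed.
Let tr1 : cl_tr (1 : C) = 1 := cl_tr1 q.
Let simp := (bar1, bar0, tr1, tr0, @mul0r C, @mulr0 C, @mul1r C, @mulr1 C, @add0r C,
  @addr0 C, @scaler0 F C, @oppr0 C, @subr0 C, @sub0r C, @scale1r F C).

Definition trans_mx (l : para V) : 'M[C]_2 := mx2 1 (pcl l) 0 1.

Lemma trans_sesq l w (eta := pcl l) (m := pcl (para_of w)) :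
  [/\ sesq 1 eta 0 1 w = m + f_of w *: eta,
      sesq 1 eta 1 eta w = m * cl_bar eta + eta * cl_bar m
        + (f_of w *: (eta * cl_bar eta) + (e_of w)%:A) &
      sesq (0 : C) 1 0 1 w = (f_of w)%:A].
Proof. by split; rewrite sesqE -/m !simp. Qed.

Lemma trans_vahlen l : vahlen_at (trans_mx l) 1.
Proof.
apply: (vahlen_at_of_sesq two_neq0); first exact: oner_neq0.
- apply/vahlen_at_eqs; rewrite /trans_mx !mx2E !simp cl_tr_para //.
- move=> w; rewrite /trans_mx !mx2E; have [-> _ _] := trans_sesq l w.
  by apply: parasD; [exists (para_of w)|apply: parasZ; exists l].
- move=> w; rewrite /trans_mx !mx2E; have [_ -> _] := trans_sesq l w.
  have pl : range pcl (pcl l) by exists l.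
  apply: scalsD; first by apply: paras_polar => //; exists (para_of w).
  by apply: scalsD; [apply/scalsZ/paras_norm|exists (e_of w)].
- move=> w; rewrite /trans_mx !mx2E; have [_ _ ->] := trans_sesq l w.
  by exists (f_of w).
Qed.

(** The translation tau |-> tau + l. The new e-coordinate is stated inside the Clifford algebra,
    where the pairing of paravectors appears as m bar(l) + l bar(m). *)
Lemma trans_act l w : exists w', [/\ srel w w',
  para_of w' = para_of w + f_of w *: l, f_of w' = f_of w &
  (e_of w')%:A = pcl (para_of w) * cl_bar (pcl l) + pcl l * cl_bar (pcl (para_of w))
     + (f_of w *: (pcl l * cl_bar (pcl l)) + (e_of w)%:A)].
Proof.
have Mn := trans_vahlen l; have [_ _ _ /(_ w)[w' E]] := Mn.
have [] := sesq_act E; rewrite /trans_mx !mx2E; have [-> -> ->] := trans_sesq l w.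
rewrite scale1r !mul1r => pE eE fE; exists w'; split.
- by exists (trans_mx l); [apply/(svahlenP two_neq0)|apply/(vahlen_actP two_neq0 _ _ Mn)].
- by apply: (@para_cl_inj _ _ q); rewrite -pE -para_cl_Z -para_cl_D.
- by apply: (@scal_inj _ _ q); rewrite -fE.
- by rewrite eE.
Qed.

(** The inversion tau |-> - tau^-1; the sign in its matrix makes the determinant 1. *)
Lemma swap_srel w : exists w', [/\ srel w w', e_of w' = f_of w & f_of w' = e_of w].
Proof.
pose M : 'M[C]_2 := mx2 0 1 (- 1) 0.
have sE : sesq (0 : C) 1 (- 1) 0 w = - cl_bar (pcl (para_of w)).
  by rewrite sesqE !simp raddfN /= bar1 mulrN1.
have eE : sesq (0 : C) 1 0 1 w = (f_of w)%:A by rewrite sesqE !simp.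
have fE : sesq (- 1 : C) 0 (- 1) 0 w = (e_of w)%:A.
  by rewrite sesqE !simp raddfN /= bar1 !mulrN1 opprK.
have Mn : vahlen_at M 1.
  apply: (vahlen_at_of_sesq two_neq0); first exact: oner_neq0.
  - by apply/vahlen_at_eqs; rewrite /M !mx2E (raddfN (@cl_tr _ _ q)) /= !simp opprK.
  - move=> w1; rewrite /M !mx2E sesqE !simp raddfN /= bar1 mulrN1.
    by rewrite -cl_gr_para; apply/parasN/paras_gr; exists (para_of w1).
  - by move=> w1; rewrite /M !mx2E sesqE !simp; exists (f_of w1).
  - move=> w1; rewrite /M !mx2E sesqE !simp raddfN /= bar1 !mulrN1 opprK.
    by exists (e_of w1).
have [_ _ _ /(_ w)[w' E]] := Mn; have [_] := sesq_act E.
rewrite /M !mx2E eE fE !mul1r => /scal_inj e'E /scal_inj f'E; exists w'; split=> //.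
by exists M; [apply/(svahlenP two_neq0)|apply/(vahlen_actP two_neq0 _ _ Mn)].
Qed.

(** For nonzero y this is the vector of t sigma_c with t = 1 / y. *)
Definition kpt (y : F) : VU V := VUvec 0 0 (c / y) y.

Lemma kpt_coord y : [/\ para_of (kpt y) = 0, e_of (kpt y) = c / y & f_of (kpt y) = y].
Proof. by rewrite /= oppr0. Qed.

Lemma diag_vahlen s : s != 0 -> vahlen_at (mx2 s%:A 0 0 1 : 'M[C]_2) s.
Proof.
move=> s0; apply: (vahlen_at_of_sesq two_neq0) => //.
- by apply/vahlen_at_eqs; rewrite !mx2E cl_tr_scal !simp.
- move=> w; rewrite !mx2E sesqE !simp mulr_algl.
  by apply: parasZ; exists (para_of w).
- move=> w; rewrite !mx2E sesqE !simp cl_bar_scal mulr_algl.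
  by apply/scalsZ/scalsZ/scalsZ/scals1.
- by move=> w; rewrite !mx2E sesqE !simp; exists (f_of w).
Qed.

Lemma diag_act s y : s != 0 -> y != 0 ->
  vahlen_act q (mx2 s%:A 0 0 1) (kpt y) (kpt (y / s)).
Proof.
move=> s0 y0; have [p1 e1 f1] := kpt_coord y; have [p2 e2 f2] := kpt_coord (y / s).
apply: (vahlen_act_of_sesq (diag_vahlen s0)); rewrite !mx2E sesqE p1 e1 f1.
- by rewrite p2 pcl0 !simp.
- rewrite e2 pcl0 !simp cl_bar_scal mulr_algl !scalerA; congr (_ *: _); field.
  by rewrite y0 s0.
- by rewrite f2 pcl0 !simp; congr (_ *: _); field.
Qed.

Lemma K_coord w : K w -> quadF q (para_of w) + e_of w * f_of w = c.
Proof. by move=> [wc _]; rewrite -quadU_coord. Qed.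

Lemma srel_kpt w : K w -> f_of w != 0 -> srel w (kpt (f_of w)).
Proof.
move=> Kw f0; have [w' [ww' pE fE _]] := trans_act (- (f_of w)^-1 *: para_of w) w.
(* The translation is chosen to kill the paravector part and keeps the f-coordinate; the quadratic
   value c then determines the e-coordinate. *)
suff <- : w' = kpt (f_of w) by [].
have Kw' := krel_K svahlen_sub Kw ww'.
have [p2 e2 f2] := kpt_coord (f_of w).
have p0 : para_of w' = 0.
  by rewrite pE scalerA mulrN divff // scaleN1r subrr.
apply: VU_ext; rewrite ?p2 ?e2 ?f2 //.
have := K_coord Kw'; rewrite p0 fE /quadF /= quad0 => <-; field.
by [].
Qed.

(* The translation by [l] gives [w] the [e]-coordinate [s], and the swap of [e] and
   [f] then moves it to the affine part. *)
Lemma srel_kpt_bdry w l s : K w -> e_of w = 0 -> f_of w = 0 -> s != 0 ->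
  pcl (para_of w) * cl_bar (pcl l) + pcl l * cl_bar (pcl (para_of w)) = s%:A ->
  srel w (kpt s).
Proof.
move=> Kw e0 f0 s0 lE; have [w' [ww' _ _ e'E]] := trans_act l w.
have e's : e_of w' = s.
  by apply: (@scal_inj _ _ q); rewrite e'E lE e0 f0 !scale0r !addr0.
have [w2 [w'w2 _ f2]] := swap_srel w'.
have ww2 := krel_trans SG ww' w'w2.
apply: (krel_trans SG ww2); rewrite -e's -f2; apply: srel_kpt.
  exact: (krel_K svahlen_sub Kw ww2).
by rewrite f2 e's.
Qed.

(** One nonzero pairing suffices, as [l'] can be rescaled. A nonzero scalar part a pairs with 1 to 2
    a; otherwise the vector part is outside the radical. *)
Lemma polar_nonrad l : ~ para_radical q l -> forall s, exists l',
  pcl l * cl_bar (pcl l') + pcl l' * cl_bar (pcl l) = s%:A.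
Proof.
move=> rad s; suff [l' [s' [s'0 E]]] : exists l' s', s' != 0 /\
    pcl l * cl_bar (pcl l') + pcl l' * cl_bar (pcl l) = s'%:A.
  exists ((s / s') *: l'); rewrite para_cl_Z linearZ /= -scalerAr -scalerAl -scalerDr.
  by rewrite E scalerA divfK.
case: l rad => a v rad; have [a0|a0] := eqVneq (a : F) 0; last first.
  exists ((1 : F), 0 : V), (2 * (a : F)); split; first exact: mulf_neq0.
  rewrite (_ : pcl (1, 0) = 1); last by rewrite /para_cl /= raddf0 addr0 scale1r.
  rewrite bar1 mulr1 mul1r cl_bar_para /para_cl /= mulrDl mul1r scalerDl; nc_ring.
have [x xv] : exists x : V, polar q x v != 0.
  apply: contra_notP rad => /forallNP xv; split=> // x; apply/eqP.
  by have /negP := xv x; rewrite negbK.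
exists ((0 : F), x), (- polar q x v); split; first by rewrite oppr_eq0.
rewrite !cl_bar_para /para_cl /= a0 scale0r scaleNr -cl_vec_polar; nc_ring.
Qed.

Lemma K_kpt w : K w -> exists2 y, y != 0 & srel w (kpt y).
Proof.
move=> Kw; have [f0|f0] := eqVneq (f_of w) 0; last by exists (f_of w) => //; apply: srel_kpt.
have [e0|e0] := eqVneq (e_of w) 0; last first.
  have [w' [ww' _ f']] := swap_srel w; exists (e_of w) => //.
  apply: (krel_trans SG ww'); rewrite -f'; apply: srel_kpt; last by rewrite f'.
  exact: (krel_K svahlen_sub Kw ww').
(* With both isotropic coordinates zero, a radical paravector part would put w in the removed set
   V^perp. *)
have rad : ~ para_radical q (para_of w).
  move=> [a0 ov]; case: Kw => _; apply; exists (para_of w).2 => //.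
  by rewrite [RHS]VU_eta a0 e0 f0 oppr0.
have [l lE] := polar_nonrad rad 1; exists 1; first exact: oner_neq0.
exact: (srel_kpt_bdry Kw e0 f0 (oner_neq0 _) lE).
Qed.

Lemma kpt_srel_all l : quadF q l = c -> ~ para_radical q l ->
  forall y y', y != 0 -> y' != 0 -> srel (kpt y) (kpt y').
Proof.
move=> lc rad y y' y0 y'0; have [w [pw ew fw]] := VU_of l 0 0.
have Kw : K w.
  split; first by apply: etrans (quadU_coord _ _) _; rewrite pw ew fw mulr0 addr0.
  case=> v ov wE; apply: rad; have := congr1 (@para_of F V) wE.
  by rewrite pw /= oppr0 => <-.
have toy s : s != 0 -> srel w (kpt s).
  move=> s0; have [l' lE] := polar_nonrad rad s.
  by apply: (srel_kpt_bdry Kw ew fw s0 (l := l')); rewrite pw.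
by apply: (krel_trans SG (w' := w)); [apply: krel_sym SG _ _ _|]; apply: toy.
Qed.

Lemma kpt_grel y y' : y != 0 -> y' != 0 -> grel (kpt y) (kpt y').
Proof.
move=> y0 y'0; have s0 : y / y' != 0 by rewrite mulf_neq0 ?invr_eq0.
exists (mx2 (y / y')%:A 0 0 1).
  by apply/(vahlenP two_neq0); exists (y / y'); apply: diag_vahlen.
have yE : y / (y / y') = y' by field; rewrite y0 y'0.
by have := diag_act s0 y0; rewrite yE.
Qed.

Lemma grel_all w w' : K w -> K w' -> grel w w'.
Proof.
move=> /K_kpt[y y0 wy] /K_kpt[y' y'0 wy'].
apply: (krel_trans GG (srel_grel wy)); apply: (krel_trans GG (kpt_grel y0 y'0)).
exact/(krel_sym GG)/srel_grel.
Qed.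

Lemma transitive_of_krel P : unit_subgroup P -> P `<=` vahlen q ->
  (forall w w', K w -> K w' -> krel P w w') -> transitive_on (mobius q c) P H.
Proof.
move=> Pg PG Prel p p' Hp Hp'; apply/(orbit_krel PG) => //; split=> //.
by apply: Prel; apply: HtoK_in.
Qed.

Lemma vahlen_transitive : transitive_on (mobius q c) (vahlen q) H.
Proof. exact: transitive_of_krel GG _ grel_all. Qed.

Lemma svahlen_transitive : Hopen V `<` H ->
  (c = 0 -> exists2 la, quadF q la = 0 & ~ para_radical q la) ->
  transitive_on (mobius q c) (svahlen q) H.
Proof.
move=> [_ HoH] c0; apply: (transitive_of_krel SG svahlen_sub) => w w' Kw Kw'.
have [l lc lrad] : exists2 l, quadF q l = c & ~ para_radical q l.
  have [cz|cnz] := eqVneq c 0; first by rewrite cz; apply: c0.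
  have [[xi t|l b] /=] : exists2 p, H p & ~ Hopen V p.
  - by apply: contrapT => nH; apply: HoH => p Hp; apply: contrapT => np; apply: nH; exists p.
  - by case.
  (* The paravector form vanishes on the radical, so a boundary vector of nonzero value c lies
     outside it. *)
  - case=> // -[lc _] _; exists l => // -[l0 ov]; move/eqP: cnz; apply.
    rewrite -lc /quadF l0 expr0n subr0; apply: (mulfI two_neq0).
    rewrite mulr0 -(ov l.2) /polar -[l.2]scale1r -scalerDl !quadZ; ring.
have [[y y0 wy] [y' y'0 wy']] := (K_kpt Kw, K_kpt Kw').
apply: (krel_trans SG wy); apply: (krel_trans SG (kpt_srel_all lc lrad y0 y'0)).
exact: krel_sym.
Qed.
End Transitivity.

(** * Orbits of the special group and cosets of the norm group *)

Section NormGroup.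
Context {F : fieldType} {V : vectType F} (q : quadForm V) (c : F).
Hypothesis two_neq0 : 2 != 0 :> F.
Local Notation C := (clifford q).
Implicit Types (M : 'M[C]_2) (w : VU V) (p : hpoint V).
Local Notation K := (Ktilde q c).
Local Notation H := (Htilde q c).
Local Notation N := (norm_group q c).
Local Notation srel := (krel (svahlen q)).
Local Notation kpt := (@kpt F V c).
Local Notation orbit := (orbit_of (mobius q c) (svahlen q)).
Let SG := svahlen_group q two_neq0.

Hypothesis HoE : Hopen V = H.

Lemma H_inner p : H p -> exists xi t, t != 0 /\ p = Inner xi t.
Proof. by rewrite -HoE; case: p => [xi t|//]; exists xi, t. Qed.

Lemma K_f_neq0 w : K w -> f_of w != 0.
Proof.
by move=> /KtoH_in; rewrite -HoE /KtoH; case: eqVneq => // _ [].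
Qed.

Lemma Hinner_in xi t : t != 0 -> H (Inner xi t).
Proof. by move=> t0; left. Qed.

Lemma inner0_kpt t : t != 0 -> HtoK q c (Inner 0 t) = kpt t^-1.
Proof.
move=> t0; apply: VU_ext; rewrite ?para_of_inner ?e_of_inner ?f_of_inner //=.
  by rewrite scaler0 oppr0.
by rewrite /quadF /= quad0; field; rewrite t0 oner_neq0.
Qed.

(* Conjugation by [diag (s, 1)] normalizes the special group. *)
Lemma srel_kpt_scale s y y' : s != 0 -> y != 0 -> y' != 0 ->
  srel (kpt y) (kpt y') -> srel (kpt (y / s)) (kpt (y' / s)).
Proof.
move=> s0 y0 y'0 [M /(svahlenP two_neq0) M1 My].
have Dn := diag_vahlen q two_neq0 s0.
have [[DI DI'] DVn] := vahlen_at_inverse two_neq0 Dn.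
set D := mx2 _ _ _ _ in Dn DI DI' DVn *.
set D' := _ *: mx_dag D in DI DI' DVn.
exists (D * M * D').
  apply/(svahlenP two_neq0); rewrite (_ : 1 = s * 1 * s^-1); last by field.
  by apply: vahlen_atM => //; apply: vahlen_atM.
rewrite /vahlen_act !vahlen_imageM // -mulrA.
apply: cl_actM; last exact: (diag_act q c two_neq0 s0 y'0).
apply: cl_actM My; apply: cl_actV (diag_act q c two_neq0 s0 y0).
by split; rewrite -vahlen_imageM // ?DI ?DI'; apply: vahlen_image1.
Qed.

(** If w' is the image of xi + t sigma_c, the norm is s = t f(w'), while the two vectors are
    equivalent to [kpt] at 1 / t and at f(w'). Rescaling by t carries this pair to 1 and s.
    Conversely, evaluate at sigma_c. The group laws of N then follow from those of the orbit
    relation. *)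
Lemma norm_groupP s : N s <-> s != 0 /\ srel (kpt 1) (kpt s).
Proof.
split=> [[M [xi [t [/(svahlenP two_neq0) M1 t0 nE]]]]|[s0 [M MS M1s]]].
  have [_ _ _ /(_ (HtoK q c (Inner xi t)))[w' Mw']] := M1.
  have /eqP := mob_den_norm M1 t0 Mw'; rewrite nE mul1r => /eqP/scal_inj sE.
  have Kt := HtoK_in two_neq0 (Hinner_in xi t0).
  have tw' : srel (HtoK q c (Inner xi t)) w'.
    by exists M; [apply/(svahlenP two_neq0)|apply/(vahlen_actP two_neq0 _ _ M1)].
  have Kw' := krel_K two_neq0 (@svahlen_sub _ _ q) Kt tw'.
  have f0 := K_f_neq0 Kw'; have s0 : s != 0 by rewrite sE mulf_neq0.
  split=> //; have ti0 : t^-1 != 0 by rewrite invr_eq0.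
  have := srel_kpt_scale ti0 ti0 f0; rewrite divff // invrK mulrC -sE; apply.
  have := srel_kpt two_neq0 Kt (K_f_neq0 Kt); rewrite f_of_inner => tk.
  apply: (krel_trans two_neq0 SG (krel_sym two_neq0 SG tk)).
  exact: (krel_trans two_neq0 SG tw' (srel_kpt two_neq0 Kw' f0)).
have M1 := proj1 (svahlenP two_neq0 M) MS.
exists M, 0, 1; split=> //; first exact: oner_neq0.
have /(vahlen_actP two_neq0 _ _ M1) := M1s; rewrite -{1}[1]invr1.
rewrite -inner0_kpt ?oner_neq0 // => /(mob_den_norm M1 (oner_neq0 _)) ->.
by rewrite !mul1r.
Qed.

Lemma norm_group_units : N `<=` [set x | x != 0].
Proof. by move=> s /norm_groupP[]. Qed.

Lemma norm_group_srel y y' : y != 0 -> y' != 0 -> srel (kpt y) (kpt y') <-> N (y' / y).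
Proof.
move=> y0 y'0; split=> [yy'|/norm_groupP[_ y1]].
  apply/norm_groupP; split; first by rewrite mulf_neq0 ?invr_eq0.
  by have := srel_kpt_scale y0 y0 y'0 yy'; rewrite divff.
have yi0 : y^-1 != 0 by rewrite invr_eq0.
have yy0 : y' / y != 0 by rewrite mulf_neq0.
have := srel_kpt_scale yi0 (oner_neq0 _) yy0 y1.
by rewrite !invrK mul1r divfK.
Qed.

Lemma norm_group1 : N 1.
Proof.
by apply/norm_groupP; split; [exact: oner_neq0|exact: krel_refl].
Qed.

Lemma norm_groupM s t : N s -> N t -> N (s * t).
Proof.
move=> /norm_groupP[s0 sN] tN; have t0 := norm_group_units tN.
apply/norm_groupP; split; first exact: mulf_neq0.
(* The path runs from 1 through s to s t, whose second step has quotient t. *)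
apply: (krel_trans two_neq0 SG sN); apply/norm_group_srel; rewrite ?mulf_neq0 //.
by rewrite mulrC mulKf.
Qed.

Lemma norm_groupV s : N s -> N s^-1.
Proof.
move=> /norm_groupP[s0 sN]; rewrite -[s^-1]mul1r.
by apply/norm_group_srel => //; [exact: oner_neq0|exact: krel_sym].
Qed.

Lemma norm_group_group : unit_subgroup N.
Proof.
split=> [|s t|s sN]; [exact: norm_group1|exact: norm_groupM|].
have s0 := norm_group_units sN.
by exists s^-1; [exact: norm_groupV|split; rewrite ?mulVf ?mulfV].
Qed.

(** Translations remove xi and xi'. The f-coordinates are 1 / t and 1 / t', so the quotient from
    [norm_group_srel] appears inverted, which the group N permits. *)
Lemma orbit_inner xi t xi' t' : t != 0 ->
  orbit (Inner xi t) (Inner xi' t') <-> t' != 0 /\ N (t' / t).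
Proof.
move=> t0; have Ht := Hinner_in xi t0.
have toP := orbit_krel two_neq0 (@svahlen_sub _ _ q) (Inner xi' t') Ht.
have k xi1 t1 : t1 != 0 -> srel (HtoK q c (Inner xi1 t1)) (kpt t1^-1).
  move=> t10; have Kt := HtoK_in two_neq0 (Hinner_in xi1 t10).
  by have := srel_kpt two_neq0 Kt (K_f_neq0 Kt); rewrite f_of_inner.
split=> [/toP[]|[t'0 tN]].
  rewrite -HoE => t'0 tt'; split=> //; rewrite -[_ / _]invrK.
  apply: norm_groupV; rewrite invfM.
  apply/norm_group_srel; rewrite ?invr_eq0 //.
  apply: (krel_trans two_neq0 SG (krel_sym two_neq0 SG (k xi _ t0))).
  exact: (krel_trans two_neq0 SG tt' (k xi' _ t'0)).
apply/toP; split; first exact: Hinner_in.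
apply: (krel_trans two_neq0 SG (k xi _ t0)).
apply: (krel_trans two_neq0 SG _ (krel_sym two_neq0 SG (k xi' _ t'0))).
apply/norm_group_srel; rewrite ?invr_eq0 //.
by have := norm_groupV tN; rewrite invfM.
Qed.

Lemma orbit_eq p p' : H p -> orbit p p' -> orbit p = orbit p'.
Proof.
move=> Hp /(orbit_krel two_neq0 (@svahlen_sub _ _ q) _ Hp)[Hp' pp'].
apply/seteqP; split=> z /(orbit_krel two_neq0 (@svahlen_sub _ _ q) _)[//|Hz zr].
  apply/(orbit_krel two_neq0 (@svahlen_sub _ _ q)) => //; split=> //.
  exact: (krel_trans two_neq0 SG (krel_sym two_neq0 SG pp')).
apply/(orbit_krel two_neq0 (@svahlen_sub _ _ q)) => //; split=> //.
exact: (krel_trans two_neq0 SG pp').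
Qed.

(** Membership in an orbit depends on the height t alone, so the heights determine the orbit, and
    they form a coset of N. *)
Definition orbit_coset (O : set (hpoint V)) : set F := [set t | exists xi, O (Inner xi t)].

Lemma orbit_cosetE xi t : t != 0 -> orbit_coset (orbit (Inner xi t)) = lcoset t N.
Proof.
move=> t0; apply/seteqP; split=> [s [xi' /(orbit_inner _ _ _ t0)[s0 sN]]|_ [s sN <-]].
  by exists (s / t) => //; rewrite mulrC divfK.
exists 0; apply/(orbit_inner _ _ _ t0); split.
  by rewrite mulf_neq0 //; apply: norm_group_units.
by rewrite mulrC mulKf.
Qed.

Lemma orbit_coset_bij :
  set_bij (orbits_of (mobius q c) (svahlen q) H) (lcosets [set x | x != 0] N) orbit_coset.
Proof.
split=> [_ [p /H_inner[xi [t [t0 ->]]] <-]|O1 O2 /set_mem[p1 Hp1 <-] /set_mem[p2 Hp2 <-]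
  |_ [t t0 <-]].
- by exists t => //; rewrite orbit_cosetE.
- have [xi1 [t1 [t10 E1]]] := H_inner Hp1; have [xi2 [t2 [t20 E2]]] := H_inner Hp2.
  move: Hp1 Hp2; rewrite E1 E2 !orbit_cosetE // => Hp1 Hp2 E.
  apply: orbit_eq => //; apply/(orbit_inner _ _ _ t10); split=> //.
  have : lcoset t1 N t2 by rewrite E; exists 1; [exact: norm_group1|rewrite mulr1].
  by case=> s sN <-; rewrite mulrC mulKf.
- exists (orbit (Inner 0 t)); last exact: orbit_cosetE.
  by exists (Inner 0 t) => //; apply: Hinner_in.
Qed.
End NormGroup.

(** * Orbits and stabilizers for actions given by graphs *)

Section Cosets.
Context {R : nzRingType} {X : Type} (act : R -> X -> X -> Prop).
Variables (G : set R) (Y : set X) (x0 : X) (S : set R).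
Hypotheses (G_group : unit_subgroup G) (act_action : is_action act G Y).
Hypotheses (act_trans : transitive_on act G Y) (Yx0 : Y x0).
Hypothesis S_stab : forall g, S g <-> G g /\ act g x0 x0.

Lemma act_total g x : G g -> Y x -> exists2 y, Y y & act g x y.
Proof.
have [aF _ _] := act_action => Gg Yx; have [y Yy yP] := aF g x Gg Yx.
by exists y => //; apply/yP.
Qed.

Lemma act_functional g x y z : G g -> Y x -> act g x y -> act g x z -> y = z.
Proof.
have [aF _ _] := act_action => Gg Yx; have [t _ tP] := aF g x Gg Yx.
by move=> /tP-> /tP->.
Qed.

Lemma act_in g x y : G g -> Y x -> act g x y -> Y y.
Proof.
move=> Gg Yx gxy; have [z Yz gxz] := act_total Gg Yx.
by rewrite (act_functional Gg Yx gxy gxz).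
Qed.

Lemma act_inv g h x y : G g -> G h -> is_inverse g h -> Y x -> act g x y -> act h y x.
Proof.
have [_ a1 aM] := act_action => Gg Gh [gh hg] Yx gxy.
have Yy := act_in Gg Yx gxy; have [z Yz hyz] := act_total Gh Yy.
suff -> : x = z by [].
have [G1 _ _] := G_group; apply: (act_functional G1 Yx (a1 _ Yx)).
by rewrite -hg; apply: aM Gh Gg Yx gxy hyz.
Qed.

Lemma stab_group : unit_subgroup S.
Proof.
have [G1 GM GV] := G_group; have [_ a1 aM] := act_action.
split=> [|g h /S_stab[Gg ag] /S_stab[Gh ah]|g /S_stab[Gg ag]].
- by apply/S_stab; split=> //; apply: a1.
- by apply/S_stab; split; [exact: GM|exact: aM ah ag].
- have [h Gh gh] := GV g Gg; exists h => //; apply/S_stab; split=> //.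
  exact: act_inv Gg Gh gh Yx0 ag.
Qed.

(** The action being a relation, the image of x0 under the coset is obtained by choice; the value x0
    is a default for sets that provide no image. *)
Definition coset_point (A : set R) : X :=
  if pselect (exists y, exists2 g, G g /\ A g & act g x0 y) is left h
  then sval (cid h) else x0.

Lemma coset_pointP g : G g -> act g x0 (coset_point (lcoset g S)).
Proof.
move=> Gg; have [G1 GM GV] := G_group; have [_ a1 aM] := act_action.
have [y Yy gy] := act_total Gg Yx0.
have [S1 _ _] := stab_group.
have Sg : lcoset g S g by exists 1; rewrite ?mulr1.
rewrite /coset_point; case: pselect => [h|[]]; last by exists y, g.
case: (cid h) => z /= [g' [_ [s /S_stab[Gs as_] gE]]]; rewrite -gE => gsz.
suff -> : z = y by [].
by apply: (act_functional (GM _ _ Gg Gs) Yx0 gsz); apply: aM as_ gy.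
Qed.

Lemma coset_point_bij : set_bij (lcosets G S) Y coset_point.
Proof.
have [G1 GM GV] := G_group; have [_ a1 aM] := act_action.
split=> [_ [g Gg <-]|A B /set_mem[g Gg gA] /set_mem[h Gh hB]|y Yy].
- exact: act_in (coset_pointP Gg).
- have sub g1 h1 : G g1 -> G h1 ->
      coset_point (lcoset g1 S) = coset_point (lcoset h1 S) -> lcoset g1 S `<=` lcoset h1 S.
    move=> Gg1 Gh1 E1 _ [s /S_stab[Gs as_] <-].
    have [k Gk hk] := GV h1 Gh1.
    exists (k * (g1 * s)); last by rewrite mulrA (proj1 hk) mul1r.
    apply/S_stab; split; first exact: GM Gk (GM _ _ Gg1 Gs).
    have hx := coset_pointP Gh1; rewrite -E1 in hx.
    apply: (aM _ _ _ _ _ Gk (GM _ _ Gg1 Gs) Yx0 _ (act_inv Gh1 Gk hk Yx0 hx)).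
    exact: aM as_ (coset_pointP Gg1).
  by rewrite -gA -hB => E; apply/seteqP; split; apply: sub.
- have [g Gg gy] := act_trans Yx0 Yy; exists (lcoset g S); first by exists g.
  exact: act_functional Gg Yx0 (coset_pointP Gg) gy.
Qed.

Lemma coset_point_equivariant g A : G g -> lcosets G S A ->
  act g (coset_point A) (coset_point (lcoset g A)).
Proof.
have [G1 GM GV] := G_group; have [_ a1 aM] := act_action.
move=> Gg [h Gh <-]; have hx := coset_pointP Gh.
have Yh := act_in Gh Yx0 hx; have [z Yz gz] := act_total Gg Yh.
have -> : lcoset g (lcoset h S) = lcoset (g * h) S.
  apply/seteqP; split=> [_ [_ [s Ss <-] <-]|_ [s Ss <-]].
    by exists s; rewrite ?mulrA.
  by exists (h * s); [exists s|rewrite mulrA].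
rewrite (act_functional (GM _ _ Gg Gh) Yx0 (coset_pointP (GM _ _ Gg Gh)) (y := _) (z := z)) //.
exact: aM hx gz.
Qed.
End Cosets.

(** delta' delta^* is the grading image of delta bar(delta) = N(delta), a scalar and hence fixed;
    the same holds for gamma. *)
Lemma stab_sigma_det (F : fieldType) (V : vectType F) (q : quadForm V) (c : F)
    (M : 'M[clifford q]_2) :
  Ttilde (M 1 0) -> Ttilde (M 1 1) ->
  M 0 0 = cl_gr (M 1 1) /\ M 0 1 = - (c *: cl_gr (M 1 0)) ->
  vdet M = cl_norm (M 1 1) + c *: cl_norm (M 1 0).
Proof.
move=> [_ /scals_gr g1] [_ /scals_gr g2] [alE beE].
rewrite /vdet alE beE mulNr opprK -scalerAl -g1 -g2 /cl_norm !rmorphM /= !cl_gr_bar.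
by [].
Qed.

Theorem theorem3p16 (F : fieldType) (V : vectType F) (q : quadForm V) (c : F) :
  2%N \notin [pchar F] ->
  let G := vahlen q in
  let SG := svahlen q in
  let H := Htilde q c in
  let Ho := Hopen V in
  let K := Ktilde q c in
  let S := stab_sigma q c in
  let act := mobius q c in
  let actK := vahlen_act q in
  let units : set F := [set x | x != 0] in
  let N := norm_group q c in
  [/\ (* transitive action on the completion *)
      [/\ unit_subgroup G, is_action act G H & transitive_on act G H],
      (* equivariant identification with K *)
      [/\ set_bij H K (HtoK q c),
          is_action actK G K &
          forall M p p', G M -> H p -> H p' ->
            act M p p' <-> actK M (HtoK q c p) (HtoK q c p')],
      (* equivariant identification with G / S, via g |-> g . sigma_c *)
      [/\ S `<=` G, unit_subgroup S &
          exists Psi : set 'M[clifford q]_2 -> hpoint V,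
            [/\ set_bij (lcosets G S) H Psi,
                forall g, G g -> act g sigma_pt (Psi (lcoset g S)) &
                forall g A, G g -> lcosets G S A ->
                  act g (Psi A) (Psi (lcoset g A))]],
      (* orbits of the special group *)
      [/\ unit_subgroup SG,
          (Ho `<` H ->
           (* for c = 0 the boundary is never empty; the literal claim can fail
              when all of it lies over the radical, e.g. V = 0, F = rat *)
           (c = 0 -> exists2 la, quadF q la = 0 & ~ para_radical q la) ->
           transitive_on act SG H) &
          (Ho = H ->
           [/\ N `<=` units, unit_subgroup N &
               exists Theta : set (hpoint V) -> set F,
                 set_bij (orbits_of act SG H) (lcosets units N) Theta /\
                 forall xi t, t != 0 ->
                   Theta (orbit_of act SG (Inner xi t)) = lcoset t N])] &
      (* stabilizer in the special group *)
      (forall M, SG M /\ act M sigma_pt sigma_pt <-> S M /\ vdet M = 1) /\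
      (forall M, S M /\ vdet M = 1 <-> stab_sigma1 q c M)].
Proof.
move=> ch2 G SG H Ho K S act actK units N.
have two_neq0 : 2 != 0 :> F by move: ch2; rewrite inE.
have Gg := vahlen_group q two_neq0; have SGg := svahlen_group q two_neq0.
have actH : is_action act G H := mobius_action q c two_neq0.
have transG : transitive_on act G H := vahlen_transitive two_neq0.
have Hs : H sigma_pt by left; rewrite /= oner_neq0.
have SP M : S M <-> G M /\ act M sigma_pt sigma_pt := stab_sigmaP c two_neq0 M.
have detP M : S M -> vdet M = cl_norm (M 1 1) + c *: cl_norm (M 1 0).
  by case=> alE [Tga Tde] _ _; apply: stab_sigma_det.
split.
- by split.
- split; [exact: HtoK_bij|exact: vahlen_actK_action|move=> M p p' GM Hp Hp'].
  by rewrite /act mobius_act //; split=> [[]|] //; split.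
- split; [by move=> M /SP[]|exact: stab_group Gg actH Hs SP|].
  exists (coset_point act G sigma_pt); split.
  + exact: (coset_point_bij Gg actH transG Hs SP).
  + exact: (coset_pointP Gg actH Hs SP).
  + exact: (coset_point_equivariant Gg actH Hs SP).
- split; [exact: SGg|exact: svahlen_transitive|move=> HoE].
  split; [exact: norm_group_units|exact: norm_group_group|].
  exists (@orbit_coset F V); split; first exact: orbit_coset_bij.
  by move=> xi t t0; apply: orbit_cosetE.
- split=> M; split.
  + by move=> [[GM dM] aM]; split=> //; apply/SP.
  + by move=> [/SP[GM aM] dM].
  + by move=> [SM dM]; case: (SM) => alE T gd _; split=> //; rewrite -detP.
  + move=> [alE T gd nE]; have SM : S M by split=> //; rewrite nE oner_neq0.
    by split=> //; rewrite detP.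
Qed.
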